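(* Let $\mathbf{\Phi}$ be the reflected random walk on $\mathbb{R}_+$, $\Phi(k+1)=\max(\Phi(k)+D(k+1),0)$, $k\ge0$, where $\{D(k)\}$ is an i.i.d. real-valued sequence with $\mathsf{E}[D(k)^2]<\infty$, $\mathsf{P}\{D(k)>0\}>0$ and $\delta:=-\mathsf{E}[D(k)]>0$. Let $F(x)=x$ for $x\in\mathbb{R}_+$, let $\phi:=\pi(F)$, and let $H:=V-PV$ with $V(x)=1+\tfrac12\delta^{-1}(x^2+\delta x)$. Fix two parameters $\theta_+<1$ and $\theta_->1$ and define $$F_-=F-\theta_-H,\quad F_+=F-\theta_+H,\quad\phi_n^-=L_n(F_-),\quad\phi_n^+=L_n(F_+),\quad\phi_n=L_n(F),\quad\Delta_n=L_n(H),\quad n\ge1.$$ Then there exist a pair of convex functions $\{I_-,I_+\}$ on $\mathbb{R}$ and a constant $\varepsilon_0>0$ such that for each initial condition $x\in\mathbb{R}_+$, $$\lim_{n\to\infty}n^{-1}\log\mathsf{P}_x\{\phi_n^+\le c\}=-I_+(c)<0,\qquad c\in(\phi-\varepsilon_0,\phi),$$ $$\lim_{n\to\infty}n^{-1}\log\mathsf{P}_x\{\phi_n^-\ge c\}=-I_-(c)<0,\qquad c\in(\phi,\phi+\varepsilon_0).$$ Consequently, for each $\varepsilon\in(0,\varepsilon_0)$, $$\lim_{n\to\infty}n^{-1}\log\mathsf{P}_x\{[\phi_n-\phi]\in[-\varepsilon+\theta_+\Delta_n,\ \varepsilon+\theta_-\Delta_n]^c\}=-\min(I_+(\phi-\v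arepsilon),I_-(\phi+\varepsilon))<0.$$
   Context: $P$ is the transition kernel of $\mathbf{\Phi}$, $PV(x)=\mathsf{E}[V(\Phi(1))\mid\Phi(0)=x]$, and $\mathsf{P}_x$ is the law of the chain with $\Phi(0)=x$. The chain has a unique invariant probability measure $\pi$, and $\pi(F)=\int x\,\pi(dx)<\infty$. $L_n(G):=n^{-1}\sum_{k=0}^{n-1}G(\Phi(k))$. The superscript $c$ on an interval denotes complement in $\mathbb{R}$. Convex functions may take values in the extended reals. *)

(* Defs.v *)
From HB Require Import structures.
From mathcomp Require Import all_boot all_order all_algebra finmap.
From mathcomp Require Import all_classical all_reals all_analysis.

Set Implicit Arguments.
Unset Strict Implicit.
Unset Printing Implicit Defensive.

Import Order.TTheory GRing.Theory Num.Theory.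
Import numFieldNormedType.Exports.

Local Open Scope classical_set_scope.
Local Open Scope ring_scope.

Definition mutually_independent d (T : measurableType d) (R : realType)
    (P : probability T R) (X : nat -> {RV P >-> R}) : Prop :=
  forall (J : {fset nat}) (A : nat -> set R),
    (forall i, i \in J -> measurable (A i)) ->
    P (\bigcap_(i in [set` J]) (X i @^-1` A i)) =
    (\prod_(i <- J) P (X i @^-1` A i))%E.

Definition identically_distributed d (T : measurableType d) (R : realType)
    (P : probability T R) (X : nat -> {RV P >-> R}) : Prop :=
  forall (i j : nat) (A : set R), measurable A ->
    distribution P (X i) A = distribution P (X j) A.

Definition iid d (T : measurableType d) (R : realType)
    (P : probability T R) (X : nat -> {RV P >-> R}) : Prop :=
  mutually_independent X /\ identically_distributed X.

Section reflected_walk.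
Context d (T : measurableType d) (R : realType) (P : probability T R).
Variable D : nat -> {RV P >-> R}.

(* [D k] is the increment applied between times k and k+1, i.e. D(k+1) in the
   recursion Phi(k+1) = max(Phi(k) + D(k+1), 0), k >= 0. *)
Fixpoint walk (x : R) (w : T) (k : nat) : R :=
  if k is k'.+1 then Num.max (walk x w k' + D k' w) 0 else x.

(* All the chains are driven by the same increments, so that P_x is the
   image of P under the path map started at x. *)
Definition path_law (x : R) (B : set (nat -> R)) : \bar R :=
  P (walk x @^-1` B).

Definition transition (x : R) (A : set R) : \bar R :=
  path_law x [set Phi | A (Phi 1%N)].

Definition transition_op (G : R -> R) (x : R) : R :=
  fine 'E_P[fun w => G (walk x w 1%N)].

(* The state space R_+ is encoded as a subset of R. *)
Definition invariant_probability (mu : probability R R) : Prop :=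
  mu `[0, +oo[%classic = 1%E /\
  forall A : set R, measurable A ->
    (\int[mu]_(x in `[0%R, +oo[) transition x A = mu A)%E.

End reflected_walk.

Definition V (R : realType) (delta x : R) : R :=
  1 + 2^-1 * delta^-1 * (x ^+ 2 + delta * x).

Definition time_average (R : realType) (n : nat) (G : R -> R)
    (Phi : nat -> R) : R :=
  n%:R^-1 * \sum_(0 <= k < n) G (Phi k).

(* Convexity through the epigraph, which is meaningful even where
   infinite values of both signs would meet in the convexity inequality. *)
Definition econvex (R : realType) (I : R -> \bar R) : Prop :=
  convex_set [set z : R^o * R^o | (I z.1 <= z.2%:E)%E].

(* Main.v *)
Require Import Defs.
From HB Require Import structures.
From mathcomp Require Import all_boot all_order all_algebra finmap.
From mathcomp Require Import ring lra.
From mathcomp Require Import all_classical all_reals all_analysis.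
From mathcomp Require Import measurable_realfun.

Set Implicit Arguments.
Unset Strict Implicit.
Unset Printing Implicit Defensive.

Import Order.TTheory GRing.Theory Num.Theory.
Import numFieldNormedType.Exports.

Local Open Scope classical_set_scope.
Local Open Scope ring_scope.

(** The chain is a random walk reflected at 0, and 0 is an atom of it.  Put
    G = F - thetap H for the first claim and G = thetam H - F for the second.
    Since H(x) = x + O(1), both functions are, up to a bounded term, a positive
    multiple of x: this is where thetap < 1 < thetam enters.  Moreover
    pi(H) = 0, so that pi(G) is phi in the first case and - phi in the second.
    The first two claims are therefore instances of one statement, additive_lower_tail:
    for S_n = G(Phi(0)) + ... + G(Phi(n-1)) with G coercive and c slightly below
    pi(G), the probability of S_n <= c n decays at a precise exponential rate.
    Coercivity makes lower tails tractable although the chain is not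
    geometrically ergodic in general: a long stay far from 0 only makes S_n larger.

    The rate is defined through paths that start and end at the atom.  The
    probabilities bridge n (0, b) of the events S_n <= b, Phi(n) = 0 are
    supermultiplicative, because paths can be concatenated at the atom.  Hence
    the set of pairs (c, j) such that bridge k (0, c k) >= exp(- j k) for some k
    is convex up to an arbitrarily small error (attainable_convex), and
    rate c, the infimum of j over these pairs, is a convex function of c.
    Concatenating a descent to 0, many copies of one good excursion and a few
    loops at 0 gives the lower bound on the tail (sbelow_lower).

    For the upper bound let K f = exp(s (phi - G)) Q f, where phi is now pi(G)
    and Q is the transition operator.  Chernoff's inequality bounds the tail by
    exp(s (c - phi) n) K^n 1.  For small s > 0 there is a bounded function U
    with K U <= U off the atom (bounded_supersolution), so that only the returns
    to the atom contribute to the growth of K^n 1 (iter_one_growth).  The weight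
    of these returns is in turn controlled by the bridge probabilities, that is,
    by any line lying below the rate function (tilted_atom_layers,
    bridge_le_affine).  With the supporting line at c this yields the matching
    upper bound, provided that the slope - s of that line is small and that
    rate c <= s (phi - c).  Both conditions hold for c close to phi as soon as,
    for every small s, some attainable pair (z, j) satisfies j < s (phi - z):
    by convexity the points (z, j) then force the slope at c to be small.

    This existence statement is small_slope, and it is proved by contradiction.
    If it failed for s, the iterates K^n 1 would grow polynomially, and a
    monotone limit would give a bounded W > 0 with K W <= W everywhere and
    K W = W off the atom.  Integrating ln W against pi and using Jensen's
    inequality, with pi(G - phi) = 0, shows that W(Phi(1)) is almost surely
    determined by Phi(0) under pi, which is impossible because K W = W forces
    the mean of W(Phi(1)) to exceed W(Phi(0)) by a large factor far from 0,
    while pi charges every half-line (no_tight_supersolution).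

    Positivity of the rate below phi (rate_positive) is dual: otherwise, for
    every small s, there is a function W_s with K W_s >= exp(s eta) W_s, where
    eta > 0 is fixed.  These functions tend to 1 as s tends to 0, and the
    first-order term of the inequality gives pi(G) <= phi - eta, which is false
    (no_expanding_solutions).

    Finally, the event of the third claim is the union of the strict versions of
    the two one-sided events, whose rates are the same as those of the weak
    versions; the rate of a union is the smaller of the two rates. *)

(** * Bounded measurable functions *)

Section bounded_measurable.
Context d (X : measurableType d) (R : realType).
Implicit Types (f g : X -> R) (mu : probability X R).

(** Bounded measurable functions are integrable against every probability and
    stable under all the operators below. Unbounded functions enter the
    argument only through truncation or domination. *)
Definition bmeas f : Prop :=
  measurable_fun setT f /\ exists M : R, forall x, `|f x| <= M.

Lemma bmeas_integrable mu f : bmeas f -> mu.-integrable setT (EFin \o f).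
Proof.
move=> [mf [M fM]]; apply: measurable_bounded_integrable => //.
  by apply: fin_num_fun_lty; exact: fin_num_measure.
exists M; split; first by rewrite num_real.
by move=> N MN x _ /=; apply: le_trans (fM x) _; exact: ltW.
Qed.

Lemma bmeas_cst (a : R) : bmeas (fun=> a).
Proof. by split; [exact: measurable_cst|exists `|a|]. Qed.

Lemma bmeasD f g : bmeas f -> bmeas g -> bmeas (fun x => f x + g x).
Proof.
move=> [mf [M fM]] [mg [N gN]]; split; first exact: measurable_funD.
by exists (M + N) => x; rewrite (le_trans (ler_normD _ _))// lerD.
Qed.

Lemma bmeasM f g : bmeas f -> bmeas g -> bmeas (fun x => f x * g x).
Proof.
move=> [mf [M fM]] [mg [N gN]]; split; first exact: measurable_funM.
by exists (M * N) => x; rewrite normrM ler_pM.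
Qed.

Lemma bmeasZ (a : R) f : bmeas f -> bmeas (fun x => a * f x).
Proof. by move=> ?; apply: bmeasM => //; exact: bmeas_cst. Qed.

Lemma bmeasB f g : bmeas f -> bmeas g -> bmeas (fun x => f x - g x).
Proof.
move=> bf bg.
have -> : (fun x => f x - g x) = (fun x => f x + (-1) * g x).
  by apply/funext => x; rewrite mulN1r.
by apply: bmeasD => //; exact: bmeasZ.
Qed.

Lemma bmeasX f n : bmeas f -> bmeas (fun x => f x ^+ n).
Proof.
move=> bf; elim: n => [|n IHn].
  by under eq_fun do rewrite expr0; exact: bmeas_cst.
by under eq_fun do rewrite exprS; exact: bmeasM.
Qed.

Lemma bmeas_sum (F : nat -> X -> R) n :
  (forall i, bmeas (F i)) -> bmeas (fun x => \sum_(i < n) F i x).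
Proof.
move=> bF; elim: n => [|n IHn].
  by under eq_fun do rewrite big_ord0; exact: bmeas_cst.
by under eq_fun do rewrite big_ord_recr /=; exact: bmeasD.
Qed.

Lemma bmeas_bool (b : X -> bool) :
  measurable_fun setT b -> bmeas (fun x => (b x)%:R).
Proof.
move=> mb; split.
  by apply: (measurableT_comp (f := fun c : bool => c%:R : R)).
by exists 1 => x; case: (b x); rewrite ?normr1 ?normr0.
Qed.

Lemma bmeas_between (a b : R) f :
  measurable_fun setT f -> (forall x, a <= f x <= b) -> bmeas f.
Proof.
move=> mf fab; split=> //; exists (`|a| + `|b|) => x.
have /andP[fa fb] := fab x; rewrite ler_norml; apply/andP; split.
  rewrite opprD (le_trans _ fa)//; have := ler_norm (- a).
  by rewrite normrN => aa; have := normr_ge0 b; lra.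
by rewrite (le_trans fb)// (le_trans (ler_norm b))// lerDr.
Qed.

Lemma Rint_cst mu (a : R) : \int[mu]_x a = a.
Proof. by rewrite Rintegral_cst// [X in fine X]probability_setT mulr1. Qed.

Lemma Rint_le mu f g : bmeas f -> bmeas g -> (forall x, f x <= g x) ->
  \int[mu]_x f x <= \int[mu]_x g x.
Proof. by move=> ? ? fg; apply: le_Rintegral => //; exact: bmeas_integrable. Qed.

Lemma RintD mu f g : bmeas f -> bmeas g ->
  \int[mu]_x (f x + g x) = \int[mu]_x f x + \int[mu]_x g x.
Proof. by move=> ? ?; apply: RintegralD => //; exact: bmeas_integrable. Qed.

Lemma RintB mu f g : bmeas f -> bmeas g ->
  \int[mu]_x (f x - g x) = \int[mu]_x f x - \int[mu]_x g x.
Proof. by move=> ? ?; apply: RintegralB => //; exact: bmeas_integrable. Qed.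

Lemma RintZ mu f (a : R) : bmeas f ->
  \int[mu]_x (a * f x) = a * \int[mu]_x f x.
Proof. by move=> ?; apply: RintegralZl => //; exact: bmeas_integrable. Qed.

Lemma Rint_sum mu (F : nat -> X -> R) n : (forall i, bmeas (F i)) ->
  \int[mu]_x (\sum_(i < n) F i x) = \sum_(i < n) \int[mu]_x F i x.
Proof.
move=> bF; elim: n => [|n IHn].
  by rewrite big_ord0 -[RHS](Rint_cst mu); apply: eq_Rintegral => x _; rewrite big_ord0.
rewrite big_ord_recr /= -IHn -(RintD mu (bmeas_sum n bF) (bF n)).
by apply: eq_Rintegral => x _; rewrite big_ord_recr.
Qed.

Lemma Rint_bound mu f (a b : R) : bmeas f -> (forall x, a <= f x <= b) ->
  a <= \int[mu]_x f x <= b.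
Proof.
move=> bf fab; apply/andP; split.
  rewrite -[leLHS](Rint_cst mu a); apply: Rint_le => //; first exact: bmeas_cst.
  by move=> x; have /andP[] := fab x.
rewrite -[leRHS](Rint_cst mu b); apply: Rint_le => //; first exact: bmeas_cst.
by move=> x; have /andP[] := fab x.
Qed.

(** Dominated convergence for real-valued integrals of everywhere convergent
    sequences. *)
Lemma Rint_cvg_dom mu (f_ : nat -> X -> R) f g :
  (forall n, measurable_fun setT (f_ n)) ->
  mu.-integrable setT (EFin \o g) ->
  (forall n x, `|f_ n x| <= g x) ->
  (forall x, f_ n x @[n --> \oo] --> f x) ->
  \int[mu]_x f_ n x @[n --> \oo] --> \int[mu]_x f x.
Proof.
move=> mf ig fg ff.
have mff : measurable_fun setT f by apply: measurable_fun_cvg => // x _; exact: ff.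
have [|||||intf _ cv] := @dominated_convergence _ _ _ mu setT measurableT
  (fun n => EFin \o f_ n) (EFin \o f) (EFin \o g).
- by move=> n; exact/measurable_EFinP.
- exact/measurable_EFinP.
- by apply: aeW => x _; apply: cvg_EFin; [exact: nearW|exact: ff].
- by [].
- by apply: aeW => x n _; rewrite /= lee_fin.
move: cv; rewrite -[X in _ --> X]fineK; last exact: integrable_fin_num.
by move/fine_cvg.
Qed.

Lemma Rint_cvg mu (f_ : nat -> X -> R) f (M : R) :
  (forall n, measurable_fun setT (f_ n)) -> (forall n x, `|f_ n x| <= M) ->
  (forall x, f_ n x @[n --> \oo] --> f x) ->
  \int[mu]_x f_ n x @[n --> \oo] --> \int[mu]_x f x.
Proof.
move=> mf fM ff; apply: (@Rint_cvg_dom _ _ _ (fun=> M)) => //.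
by apply: bmeas_integrable; exact: bmeas_cst.
Qed.

Lemma bmeas_cvg (f_ : nat -> X -> R) f (M : R) :
  (forall n, measurable_fun setT (f_ n)) -> (forall n x, `|f_ n x| <= M) ->
  (forall x, f_ n x @[n --> \oo] --> f x) -> bmeas f.
Proof.
move=> mf fM ff; split.
  by apply: measurable_fun_cvg => // x _; exact: ff.
exists M => x; have /cvg_norm fx := ff x.
have /cvg_lim <- // := fx.
apply: limr_le; first by apply/cvg_ex; eexists; exact: fx.
exact: nearW.
Qed.

End bounded_measurable.

Section bounded_product.
Context d1 d2 (X : measurableType d1) (Y : measurableType d2) (R : realType).
Implicit Types (mu : probability X R) (nu : probability Y R).

Lemma bmeas_comp (f : Y -> R) (h : X -> Y) :
  bmeas f -> measurable_fun setT h -> bmeas (fun x => f (h x)).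
Proof.
by move=> [mf [M fM]] mh; split; [exact: measurableT_comp|exists M].
Qed.

Lemma bmeas_pair (F : X * Y -> R) (x : X) :
  bmeas F -> bmeas (fun y => F (x, y)).
Proof.
move=> [mF [M FM]]; split; last by exists M.
exact: (measurableT_comp mF (measurable_pair1 x)).
Qed.

Lemma bmeas_Rint nu (F : X * Y -> R) :
  bmeas F -> bmeas (fun x => \int[nu]_y F (x, y)).
Proof.
move=> bF; have [mF [M FM]] := bF; split; last first.
  exists M => x; rewrite ler_norml; apply: Rint_bound; first exact: bmeas_pair.
  by move=> y; rewrite -ler_norml.
have -> : (fun x => \int[nu]_y F (x, y)) =
   (fun x => fine (\int[nu]_y (F (x, y) + M)%:E)%E - M).
  apply/funext => x; apply/eqP; rewrite -subr_eq opprK; apply/eqP.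
  rewrite -{1}[M](Rint_cst nu) -RintD//; [exact: bmeas_pair|exact: bmeas_cst].
apply: measurable_funB => //.
apply: (measurableT_comp (f := fine)) => //.
apply: (@measurable_fun_fubini_tonelli_F _ _ _ _ _ nu (fun z => (F z + M)%:E)).
  by apply/measurable_EFinP; apply: measurable_funD.
by move=> z; rewrite lee_fin; have := FM z; rewrite ler_norml; lra.
Qed.

Lemma bmeas_prod_integrable mu nu (F : X * Y -> R) : bmeas F ->
  (mu \x nu)%E.-integrable setT (EFin \o F).
Proof.
move=> bF; apply: measurable_bounded_integrable => //.
- have e : (mu \x nu)%E (setT `*` setT) = 1%E.
    rewrite product_measure1E// -[RHS](mul1e 1%E).
    by congr (_ * _)%E; exact: probability_setT.
  by rewrite setXTT in e; apply: (@le_lt_trans _ _ 1%E); [rewrite -e|exact: ltry].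
- exact: bF.1.
have [_ [M FM]] := bF; exists M; split; first by rewrite num_real.
by move=> N MN x _ /=; rewrite (le_trans (FM x))// ltW.
Qed.

Lemma Rint_prod mu nu (F : X * Y -> R) : bmeas F ->
  fine (\int[mu \x nu]_z (F z)%:E)%E = \int[mu]_x \int[nu]_y F (x, y).
Proof.
move=> bF; rewrite /Rintegral.
rewrite -(integral12_prod_meas1 (bmeas_prod_integrable mu nu bF)); congr fine.
apply: eq_integral => x _; rewrite /fubini_F /= fineK//.
exact: (integrable_fin_num measurableT (bmeas_integrable _ (bmeas_pair x bF))).
Qed.

End bounded_product.

(** * The transition operator of the reflected walk *)

Section reflected_kernel.
Context (R : realType) (nu : probability R R).
Implicit Types (f g : R -> R) (x y : R).

(** The state is clipped at 0 before it moves. Thus the chain lives on the whole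
    line, it agrees with the reflected walk from nonnegative states, and the
    half-line of nonpositive states behaves as a single atom. *)
Definition step x y : R := Num.max (Num.max x 0 + y) 0.

Lemma step_ge0 x y : 0 <= step x y.
Proof. by rewrite /step le_max lexx orbT. Qed.

Lemma step_neg x y : x <= 0 -> step x y = step 0 y.
Proof. by move=> x0; rewrite /step maxxx (max_idPr x0). Qed.

Lemma measurable_step : measurable_fun setT (fun z : R * R => step z.1 z.2).
Proof.
apply: measurable_maxr => //; apply: measurable_funD => //.
by apply: measurable_maxr => //; exact: measurable_fst.
Qed.

(** The transition operator of the walk, as an operator on functions of the state;
    the increments have law [nu]. *)
Definition Q f x : R := \int[nu]_y f (step x y).

Lemma bmeas_step f x : bmeas f -> bmeas (fun y => f (step x y)).
Proof.
move=> bf; apply: (bmeas_comp bf).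
exact: (measurableT_comp measurable_step (measurable_pair1 x)).
Qed.

Lemma bmeas_Q f : bmeas f -> bmeas (Q f).
Proof.
move=> bf; apply: (@bmeas_Rint _ _ _ _ _ nu (fun z => f (step z.1 z.2))).
exact: (bmeas_comp bf measurable_step).
Qed.

Lemma Q_neg f x : x <= 0 -> Q f x = Q f 0.
Proof. by move=> x0; apply: eq_Rintegral => y _; rewrite step_neg. Qed.

Lemma Q_le f g : bmeas f -> bmeas g -> (forall x, f x <= g x) ->
  forall x, Q f x <= Q g x.
Proof.
by move=> bf bg fg x; apply: Rint_le => [||y]; [exact: bmeas_step..|].
Qed.

Lemma Q_cst (a : R) x : Q (fun=> a) x = a.
Proof. exact: Rint_cst. Qed.

Lemma Q_bound f (a b : R) : bmeas f -> (forall x, a <= f x <= b) ->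
  forall x, a <= Q f x <= b.
Proof. by move=> bf fab x; apply: Rint_bound => //; exact: bmeas_step. Qed.

Lemma Q_ge0 f : (forall x, 0 <= f x) -> forall x, 0 <= Q f x.
Proof. by move=> f0 x; apply: Rintegral_ge0. Qed.

Lemma QD f g x : bmeas f -> bmeas g ->
  Q (fun z => f z + g z) x = Q f x + Q g x.
Proof. by move=> bf bg; apply: (RintD nu (bmeas_step x bf) (bmeas_step x bg)). Qed.

Lemma QB f g x : bmeas f -> bmeas g ->
  Q (fun z => f z - g z) x = Q f x - Q g x.
Proof. by move=> bf bg; apply: (RintB nu (bmeas_step x bf) (bmeas_step x bg)). Qed.

Lemma QZ (a : R) f x : bmeas f -> Q (fun z => a * f z) x = a * Q f x.
Proof. by move=> bf; apply: (RintZ nu a (bmeas_step x bf)). Qed.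

Lemma Q_cvg (f_ : nat -> R -> R) f (M : R) :
  (forall n, bmeas (f_ n)) -> (forall n x, `|f_ n x| <= M) ->
  (forall x, f_ n x @[n --> \oo] --> f x) ->
  forall x, Q (f_ n) x @[n --> \oo] --> Q f x.
Proof.
move=> bf fM ff x; apply: (@Rint_cvg _ _ _ _ _ _ M) => // n.
exact: (bmeas_step x (bf n)).1.
Qed.

Section down_steps.
Variables (d p : R).
Hypotheses (d_gt0 : 0 < d) (p_gt0 : 0 < p).
Hypothesis nu_down : p <= \int[nu]_y (y <= - d)%R%:R.

Lemma bmeas_down : bmeas (fun y : R => (y <= - d)%R%:R : R).
Proof. by apply: bmeas_bool; apply: measurable_fun_ler. Qed.

Lemma down_prob_le1 : p <= 1.
Proof.
apply: (le_trans nu_down); rewrite -[leRHS](Rint_cst nu).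
apply: Rint_le => [||y]; [exact: bmeas_down|exact: bmeas_cst|].
by rewrite lern1 leq_b1.
Qed.

Lemma Q_down f x (c : R) : bmeas f -> (forall y, 0 <= f y) -> 0 <= c ->
  (forall y, y <= - d -> c <= f (step x y)) -> p * c <= Q f x.
Proof.
move=> bf f0 c0 fc; apply: (@le_trans _ _ (\int[nu]_y (c * (y <= - d)%R%:R))).
  rewrite RintZ; last exact: bmeas_down.
  by rewrite mulrC ler_wpM2l.
apply: Rint_le => [||y].
- by apply: bmeasZ; exact: bmeas_down.
- exact: bmeas_step.
- by case: (boolP (y <= - d)) => yd; rewrite ?mulr1 ?mulr0//; exact: fc.
Qed.

Lemma step_down x y : y <= - d -> step x y <= Num.max (x - d) 0.
Proof.
move=> yd; rewrite /step; case: (leP x 0) => x0.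
  by rewrite add0r ge_max !le_max lexx !orbT andbT; apply/orP; right; have := d_gt0; lra.
by rewrite ge_max le_max lerD2l yd/= le_max lexx orbT.
Qed.

(** The function is A - t, where t x = A exp(- al (x + d)) on (0, r], and al is
    chosen so that exp(al d) = 2 / p. As t is nonincreasing, a downward step
    of size at least d multiplies it by at least 2 / p, and such steps have
    probability at least p; hence Q t >= 2 t >= t + 1 on (0, r]. *)
Lemma bounded_drift (r : R) : 0 < r -> exists (L : R) (w : R -> R),
  [/\ bmeas w, (forall x, 0 <= w x <= L), (forall x, x <= 0 -> w x = 0),
      (forall x, r < x -> w x = L) &
      (forall x, 0 < x -> x <= r -> Q w x <= w x - 1)].
Proof.
move=> r0; have d0 := d_gt0; have p0 := p_gt0; pose al := ln (2 / p) / d; pose A := expR (al * (r + d)).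
have al_gt0 : 0 < al.
  rewrite divr_gt0// ln_gt0// ltr_pdivlMr// mul1r.
  by have := down_prob_le1; lra.
have eald : p * expR (al * d) = 2.
  rewrite /al divfK ?gt_eqF// lnK; first by rewrite mulrC divfK ?gt_eqF.
  by rewrite posrE divr_gt0.
have A_gt0 : 0 < A by exact: expR_gt0.
(* Since t tends to A exp(- al d) at 0, its value A at the atom gives the full
   factor 2 / p to the steps that end there. *)
pose t x := if x <= 0 then A else if x <= r then A * expR (- (al * (x + d))) else 0.
have t_noninc x y : x <= y -> t y <= t x.
  move=> xy; rewrite /t; case: (leP y 0) => y0; first by rewrite (le_trans xy).
  case: (leP x 0) => x0.
    case: ifP => _; last exact: ltW.
    rewrite ger_pMr// -expR0 ler_expR oppr_le0 mulr_ge0 ?ltW//; lra.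
  case: (leP y r) => yr.
    by rewrite (le_trans xy yr) ler_pM2l// ler_expR lerN2 ler_pM2l// lerD2r.
  by case: ifP => // _; rewrite mulr_ge0 ?expR_ge0 ?ltW.
have t_ge0 x : 0 <= t x.
  by rewrite /t; case: ifP => _; [exact: ltW|case: ifP => // _; rewrite mulr_ge0 ?expR_ge0 ?ltW].
have t_le x : t x <= A.
  case: (leP 0 x) => x0; first by rewrite (le_trans (t_noninc _ _ x0))// /t lexx.
  by rewrite /t (ltW x0).
have mt : measurable_fun setT t.
  apply: measurable_fun_if => //; first exact: measurable_fun_ler.
  apply: measurable_funTS; apply: measurable_fun_if => //.
    exact: measurable_fun_ler.
  apply: measurable_funTS; apply: measurable_funM => //.
  apply: measurableT_comp => //; apply: measurableT_comp => //.
  by apply: measurable_funM => //; exact: measurable_funD.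
have bt : bmeas t by apply: (@bmeas_between _ _ _ 0 A) => // x; rewrite t_ge0 t_le.
exists A, (fun x => A - t x); split.
- by apply: bmeasB => //; exact: bmeas_cst.
- by move=> x; have := t_ge0 x; have := t_le x; lra.
- by move=> x x0; rewrite /t x0 subrr.
- by move=> x rx; rewrite /t !leNgt rx (lt_trans r0 rx)/= subr0.
move=> x x0 xr; rewrite QB ?Q_cst//; last exact: bmeas_cst.
have : p * t (Num.max (x - d) 0) <= Q t x.
  apply: Q_down => // y yd; apply: t_noninc; exact: step_down.
(* A >= exp(al (x + d)) on (0, r], so t >= 1 there and it is enough that the
   right-hand side is at least 2 t x. *)
suff : t x + 1 <= p * t (Num.max (x - d) 0) by lra.
have tx : t x = A * expR (- (al * (x + d))) by rewrite /t leNgt x0/= xr.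
have A1 : 1 <= A * expR (- (al * (x + d))).
  by rewrite -expRD -expR0 ler_expR subr_ge0 ler_pM2l// lerD2r.
case: (leP (x - d) 0) => xd.
  have -> : t 0 = A by rewrite /t lexx.
  suff : 2 * (A * expR (- (al * (x + d)))) <= p * A by rewrite tx; lra.
  rewrite -eald mulrACA ger_pMr ?mulr_gt0//.
  by rewrite -expRD -expR0 ler_expR; have := mulr_gt0 al_gt0 x0; lra.
have -> : t (x - d) = A * expR (- (al * x)).
  by rewrite /t leNgt xd/= ifT ?subrK//; lra.
have -> : p * (A * expR (- (al * x))) = 2 * (A * expR (- (al * (x + d)))).
  rewrite -eald [RHS]mulrACA mulrA -expRD; congr (_ * expR _); ring.
by rewrite tx; lra.
Qed.

End down_steps.

End reflected_kernel.

(** * Maximal solutions off the atom *)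

Section maximal_solution.
Context (R : realType) (nu : probability R R).
Variables (k U : R -> R).
Hypotheses (bk : bmeas k) (k_ge0 : forall x, 0 <= k x).
Hypotheses (bU : bmeas U) (U_ge0 : forall x, 0 <= U x).
Hypothesis U_atom : forall x : R, x <= 0 -> U x = 1.
Hypothesis U_super : forall x : R, 0 < x -> k x * Q nu U x <= U x.

Let next (f : R -> R) (x : R) : R := if x <= 0 then 1 else k x * Q nu f x.
Let V_ n := iter n next U.

Lemma measurable_cond_neg (f : R -> R) : measurable_fun setT f ->
  measurable_fun setT (fun x : R => if x <= 0 then 1 else f x).
Proof.
move=> mf; apply: measurable_fun_if => //; first exact: measurable_fun_ler.
exact: measurable_funTS.
Qed.

Let next_le (f g : R -> R) : bmeas f -> bmeas g -> (forall x, f x <= g x) ->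
  forall x, next f x <= next g x.
Proof.
move=> bf bg fg x; rewrite /next; case: ifP => // _.
by rewrite ler_wpM2l//; exact: Q_le.
Qed.

Let V_ok n : [/\ bmeas (V_ n), (forall x, 0 <= V_ n x <= U x) &
  forall x, V_ n.+1 x <= V_ n x].
Proof.
elim: n => [|n [bV VU Vn]].
  split=> // [x|x]; first by rewrite lexx U_ge0.
  rewrite /= /next; case: ifPn => [x0|]; first by rewrite U_atom.
  by rewrite -ltNge => x0; exact: U_super.
have [_ [M UM]] := bU.
have VU1 x : 0 <= V_ n.+1 x <= U x.
  apply/andP; split; last by rewrite (le_trans (Vn x))//; have /andP[] := VU x.
  rewrite /= /next; case: ifP => // _; apply: mulr_ge0 => //.
  by apply: Q_ge0 => y; have /andP[] := VU y.
have bV1 : bmeas (V_ n.+1).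
  split.
    by apply: measurable_cond_neg; apply: measurable_funM; [exact: bk.1|exact: (bmeas_Q nu bV).1].
  exists M => x; have /andP[? ?] := VU1 x; rewrite ger0_norm//.
  by rewrite (le_trans _ (UM x))// (le_trans _ (ler_norm _)).
split=> // x; exact: next_le.
Qed.

(** The iterates of f |-> k Q f (with value 1 at the atom), started from the
    supersolution U, decrease. Their limit solves the equation by dominated
    convergence, and every subsolution below U stays below all the iterates. *)
Lemma maximal_solution : exists W : R -> R,
  [/\ bmeas W, (forall x, 0 <= W x <= U x), (forall x : R, x <= 0 -> W x = 1),
      (forall x : R, 0 < x -> W x = k x * Q nu W x) &
      forall Z, bmeas Z -> (forall x, Z x <= U x) ->
        (forall x : R, x <= 0 -> Z x <= 1) ->
        (forall x : R, 0 < x -> Z x <= k x * Q nu Z x) -> forall x, Z x <= W x].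
Proof.
pose W x := limn (V_ ^~ x).
have V_noninc x : {homo V_ ^~ x : n m / (n <= m)%N >-> n >= m}.
  by apply/nonincreasing_seqP => n; have [] := V_ok n.
have V_cvg x : V_ n x @[n --> \oo] --> W x.
  apply: nonincreasing_is_cvgn; first exact: V_noninc.
  by exists 0 => _ [n _ <-]; have [_ /(_ x)/andP[]] := V_ok n.
have [_ [M UM]] := bU.
have VM n x : `|V_ n x| <= M.
  have [_ /(_ x)/andP[? ?] _] := V_ok n; rewrite ger0_norm//.
  by rewrite (le_trans _ (UM x))// (le_trans _ (ler_norm _)).
have bV n : bmeas (V_ n) by have [] := V_ok n.
have bW : bmeas W by apply: (bmeas_cvg (fun n => (bV n).1) VM V_cvg).
exists W; split=> // [x|x x0|x x0|Z bZ ZU Z1 Zk x].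
- have icv : cvgn (V_ ^~ x) by apply/cvg_ex; eexists; exact: V_cvg.
  apply/andP; split.
    by apply: limr_ge => //; apply: nearW => n; have [_ /(_ x)/andP[]] := V_ok n.
  by apply: limr_le => //; apply: nearW => n; have [_ /(_ x)/andP[]] := V_ok n.
- apply: (cvg_unique _ (V_cvg x)) => //.
  apply: cvg_near_cst; near=> n.
  have n0 : (0 < n)%N by near: n; exact: nbhs_infty_gt.
  by rewrite -(prednK n0) /= /next x0.
- have : V_ n.+1 x @[n --> \oo] --> k x * Q nu W x.
    under eq_fun do rewrite /= /next leNgt x0 /=.
    by apply: cvgMr; exact: (Q_cvg (M := M)).
  by rewrite (cvg_shiftS (V_ ^~ x)) => /(cvg_unique _ (V_cvg x)) ->.
- apply: limr_ge; first by apply/cvg_ex; eexists; exact: V_cvg.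
  apply: nearW => n; elim: n x => [//|n IHn] x /=.
  rewrite /next; case: ifPn => [|]; first exact: Z1.
  rewrite -ltNge => x0; rewrite (le_trans (Zk _ x0))// ler_wpM2l//.
  exact: Q_le.
Unshelve. all: by end_near. Qed.

End maximal_solution.

(** * The tilted kernel *)

Section tilted_kernel.
Context (R : realType) (nu : probability R R).
Variables (G : R -> R) (phi : R).
Implicit Types (f g U : R -> R) (s x : R).

(** The kernel of Chernoff's method: its n-th iterate at the constant 1 is the
    expectation of exp(s (n phi - S_n)), where S_n is the sum of G along n
    steps. *)
Definition tilted s f x : R := expR (s * (phi - G x)) * Q nu f x.

Definition atom x : R := (x <= 0)%R%:R.

(** The total tilted weight of the paths of length n that start and end at the
    atom. *)
Definition return_weight s n : R := iter n (tilted s) atom 0.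

Lemma bmeas_atom : bmeas atom.
Proof. by apply: bmeas_bool; apply: measurable_fun_ler. Qed.

Lemma atom_ge0 x : 0 <= atom x. Proof. exact: ler0n. Qed.

Variable kap : R.
Hypotheses (mG : measurable_fun setT G) (G_neg : forall x : R, x <= 0 -> G x = G 0).
Hypothesis G_kap : forall x, phi - G x <= kap.

Section fixed_slope.
Variable s : R.
Hypothesis s_ge0 : 0 <= s.

Lemma bmeas_tilt (lam : R) : bmeas (fun x => expR (s * (phi - G x) - lam)).
Proof.
apply: (@bmeas_between _ _ _ 0 (expR (s * kap - lam))).
  apply: measurableT_comp => //; apply: measurable_funB => //.
  by apply: measurable_funM => //; exact: measurable_funB.
by move=> x; rewrite expR_ge0 ler_expR lerD2r ler_wpM2l.
Qed.

Lemma bmeas_tilted f : bmeas f -> bmeas (tilted s f).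
Proof.
move=> bf; apply: bmeasM; last exact: bmeas_Q.
by have := bmeas_tilt 0; under eq_fun do rewrite subr0.
Qed.

Lemma tilted_le f g : bmeas f -> bmeas g -> (forall x, f x <= g x) ->
  forall x, tilted s f x <= tilted s g x.
Proof.
by move=> bf bg fg x; rewrite /tilted ler_wpM2l ?expR_ge0//; exact: Q_le.
Qed.

Lemma tilted_ge0 f : (forall x, 0 <= f x) -> forall x, 0 <= tilted s f x.
Proof. by move=> f0 x; rewrite mulr_ge0 ?expR_ge0//; exact: Q_ge0. Qed.

Lemma tilted_neg f x : x <= 0 -> tilted s f x = tilted s f 0.
Proof. by move=> x0; rewrite /tilted G_neg// (Q_neg _ _ x0). Qed.

Lemma bmeas_iter_tilted n f : bmeas f -> bmeas (iter n (tilted s) f).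
Proof. by move=> bf; elim: n => //= n; exact: bmeas_tilted. Qed.

Lemma iter_tilted_le n f g : bmeas f -> bmeas g -> (forall x, f x <= g x) ->
  forall x, iter n (tilted s) f x <= iter n (tilted s) g x.
Proof.
move=> bf bg fg; elim: n => //= n IHn.
by apply: tilted_le => //; exact: bmeas_iter_tilted.
Qed.

Lemma iter_tilted_ge0 n f : (forall x, 0 <= f x) ->
  forall x, 0 <= iter n (tilted s) f x.
Proof. by move=> f0; elim: n => //= n; exact: tilted_ge0. Qed.

Lemma iter_tiltedDZ n f g (c : R) x : bmeas f -> bmeas g ->
  iter n (tilted s) (fun z => f z + c * g z) x =
  iter n (tilted s) f x + c * iter n (tilted s) g x.
Proof.
move=> bf bg; elim: n x => //= n IHn x; rewrite /tilted.
have -> : Q nu (iter n (tilted s) (fun z => f z + c * g z)) x =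
  Q nu (fun z => iter n (tilted s) f z + c * iter n (tilted s) g z) x.
  by congr Q; apply/funext.
rewrite QD; [|exact: bmeas_iter_tilted|apply: bmeasZ; exact: bmeas_iter_tilted].
by rewrite QZ; [ring|exact: bmeas_iter_tilted].
Qed.

Lemma iter_tiltedZ n f (c : R) x : bmeas f ->
  iter n (tilted s) (fun z => c * f z) x = c * iter n (tilted s) f x.
Proof.
move=> bf; elim: n x => //= n IHn x; rewrite /tilted.
have -> : Q nu (iter n (tilted s) (fun z => c * f z)) x =
  Q nu (fun z => c * iter n (tilted s) f z) x by congr Q; apply/funext.
by rewrite QZ; [ring|exact: bmeas_iter_tilted].
Qed.

Section supersolution.
Variable U : R -> R.
Hypotheses (bU : bmeas U) (U_atom : forall x : R, x <= 0 -> U x = 1).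
Hypothesis U_ge1 : forall x, 1 <= U x.
Hypothesis U_super : forall x : R, 0 < x -> tilted s U x <= U x.

(** First entrance: before the atom is reached the supersolution absorbs every
    step, and from the atom on the weight is a return weight. *)
Lemma iter_tilted_atom_le n (M : R) x : 1 <= M ->
  (forall j, (j <= n)%N -> return_weight s j <= M) ->
  iter n (tilted s) atom x <= M * U x.
Proof.
move=> M1; elim: n x => [|n IHn] x rM.
  rewrite /= /atom (le_trans _ (_ : 1 <= _))//; first by case: (x <= 0).
  by rewrite (le_trans M1)// ler_peMr// (le_trans ler01).
case: (leP x 0) => x0.
  by rewrite iterS tilted_neg// U_atom// mulr1; exact: (rM n.+1).
rewrite iterS.
have {}IHn y : iter n (tilted s) atom y <= M * U y.
  by apply: IHn => j jn; apply: rM; exact: leqW.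
have bM : bmeas (fun z => M * U z) by exact: bmeasZ.
apply: (le_trans (tilted_le (bmeas_iter_tilted n bmeas_atom) bM IHn x)).
rewrite /tilted QZ// mulrCA ler_wpM2l ?(le_trans ler01)//.
exact: U_super.
Qed.

(** Last exit: U increases under the kernel only at the atom, so each step adds at
    most a multiple of the weight of reaching the atom. *)
Lemma iter_tilted_one_le n (M : R) x : 1 <= M ->
  (forall j, (j <= n)%N -> return_weight s j <= M) ->
  iter n (tilted s) (fun=> 1) x <= (1 + n%:R * tilted s U 0 * M) * U x.
Proof.
move=> M1 rM.
apply: (@le_trans _ _ (iter n (tilted s) U x)).
  by apply: iter_tilted_le => //; exact: bmeas_cst.
elim: n rM => [|n IHn] rM; first by rewrite mul0r mul0r addr0 mul1r.
have UD y : tilted s U y <= U y + tilted s U 0 * atom y.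
  rewrite /atom; case: (leP y 0) => y0; last by rewrite mulr0 addr0 U_super.
  by rewrite mulr1 tilted_neg// lerDr (le_trans ler01).
have bUD : bmeas (fun y => U y + tilted s U 0 * atom y).
  by apply: bmeasD => //; apply: bmeasZ; exact: bmeas_atom.
rewrite iterSr (le_trans (iter_tilted_le n (bmeas_tilted bU) bUD UD x))//.
rewrite iter_tiltedDZ//; last exact: bmeas_atom.
have h1 := IHn (fun j jn => rM j (leqW jn)).
have h2 := iter_tilted_atom_le x M1 (fun j jn => rM j (leqW jn)).
have h3 : 0 <= tilted s U 0 by apply: tilted_ge0 => y; rewrite (le_trans ler01).
have h4 := ler_wpM2l h3 h2.
rewrite -natr1; lra.
Qed.

End supersolution.
End fixed_slope.

(** A perturbation of 1 of order s. Below r the tilt gains at most exp(s k1),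
    which the bounded drift function, multiplied by 2 s k1, compensates; above
    r the tilt is at most 1 because G >= phi there, and U is already maximal.
    The condition s C <= 1 keeps the terms of second order in s harmless. *)
Lemma bounded_supersolution (d p a B : R) : 0 < d -> 0 < p ->
  p <= \int[nu]_y (y <= - d)%R%:R ->
  0 < a -> (forall x, 0 <= x -> `|G x - a * x| <= B) ->
  exists s0 C : R, [/\ 0 < s0, 0 <= C, s0 * C <= 1 &
  forall s, 0 <= s <= s0 -> exists U : R -> R, [/\ bmeas U,
    (forall x : R, x <= 0 -> U x = 1), (forall x, 1 <= U x <= 1 + s * C) &
    (forall x : R, 0 < x -> tilted s U x <= U x)]].
Proof.
move=> d0 p0 nud a0 GB.
(* Beyond r the coercivity of G gives G >= phi. *)
pose r := Num.max 1 ((B + phi) / a).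
have r0 : 0 < r by rewrite lt_max ltr01.
have Gr x : r < x -> phi <= G x.
  rewrite gt_max => /andP[x1]; rewrite ltr_pdivrMr// => xB.
  have x0 : 0 <= x by rewrite ltW// (lt_trans ltr01).
  by have := GB _ x0; rewrite ler_norml mulrC => /andP[? _]; lra.
have [L [w [bw wL w0 wr wdrift]]] := bounded_drift d0 p0 nud r0.
pose k1 := Num.max 1 kap.
have k1_gt0 : 0 < k1 by rewrite lt_max ltr01.
have Gk1 x : phi - G x <= k1 by rewrite le_max G_kap orbT.
have L0 : 0 <= L by have /andP[h1 h2] := wL 0; exact: le_trans h1 h2.
have C0 : 0 <= 2 * k1 * L by rewrite !mulr_ge0// ltW.
exists (1 + 2 * k1 * L)^-1, (2 * k1 * L); split => //.
- by rewrite invr_gt0; lra.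
- by rewrite mulrC ler_pdivrMr ?mul1r; lra.
move=> s /andP[s0 ss0].
have sC : s * (2 * k1 * L) <= 1.
  rewrite (le_trans (ler_wpM2r C0 ss0))// mulrC ler_pdivrMr ?mul1r; lra.
pose c := 2 * s * k1.
have c0 : 0 <= c by rewrite !mulr_ge0// ltW.
have cw x : 0 <= c * w x <= s * (2 * k1 * L).
  have /andP[w1 w2] := wL x; rewrite mulr_ge0//=.
  by have := ler_wpM2l c0 w2; rewrite /c; lra.
have bU : bmeas (fun x => 1 + c * w x).
  by apply: bmeasD; [exact: bmeas_cst|exact: bmeasZ].
exists (fun x => 1 + c * w x); split => //.
- by move=> x x0; rewrite w0// mulr0 addr0.
- by move=> x; have /andP[? ?] := cw x; apply/andP; split; lra.
move=> x x0; rewrite /tilted.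
have QU : Q nu (fun z => 1 + c * w z) x = 1 + c * Q nu w x.
  by rewrite QD ?Q_cst ?QZ//; [exact: bmeas_cst|exact: bmeasZ].
rewrite QU.
have /andP[Qw0 QwL] := Q_bound nu bw wL x.
have cQw : 0 <= c * Q nu w x by rewrite mulr_ge0.
case: (leP x r) => xr.
  apply: (@le_trans _ _ (expR (s * k1) * (1 + c * Q nu w x))).
    by rewrite ler_wpM2r ?ler_expR ?ler_wpM2l//; lra.
  have := ler_wpM2l c0 (wdrift _ x0 xr) => h.
  have /andP[? ?] := cw x.
  have e1 : 1 - s * k1 <= expR (- (s * k1)).
    by have := expR_ge1Dx (- (s * k1)).
  suff : 1 + c * Q nu w x <= expR (- (s * k1)) * (1 + c * w x).
    move=> /(ler_wpM2l (expR_ge0 (s * k1))).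
    by rewrite [leRHS]mulrA -expRD subrr expR0 mul1r.
  have sk0 : 0 <= s * k1 by rewrite mulr_ge0// ltW.
  have e2 : (1 - s * k1) * (1 + c * w x) <= expR (- (s * k1)) * (1 + c * w x).
    by rewrite ler_wpM2r//; lra.
  apply: le_trans e2.
  have e3 : s * k1 * (c * w x) <= s * k1 * 1 by rewrite ler_wpM2l//; lra.
  rewrite /c in h e3 *; lra.
rewrite (wr _ xr) -[leRHS]mul1r ler_pM ?expR_ge0//.
- lra.
- by rewrite -expR0 ler_expR mulr_ge0_le0// subr_le0 Gr.
- by rewrite lerD2l ler_wpM2l.
Qed.

End tilted_kernel.

(** * Paths with a budget *)

(** A single term suffices: the one whose index is the integer part of t, or N - 1
    when t = N; the summand 1 covers negative t. *)
Lemma expR_layers (R : realType) (s t : R) N : 0 <= s -> t <= N%:R ->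
  expR (s * t) <= 1 + \sum_(l < N) expR (s * l.+1%:R) * (0 <= t - l%:R)%R%:R.
Proof.
move=> s0 tN.
have sum_ge0 (P : pred 'I_N) :
    0 <= \sum_(l < N | P l) expR (s * l.+1%:R) * (0 <= t - l%:R)%R%:R.
  by apply: sumr_ge0 => l _; rewrite mulr_ge0 ?expR_ge0.
case: (ltP t 0) => t0.
  rewrite -[leLHS]addr0 lerD ?(sum_ge0 xpredT)//.
  by rewrite -expR0 ler_expR mulr_ge0_le0// ltW.
have [lN|tN'] := ltnP (Num.truncn t) N.
  rewrite (bigD1 (Ordinal lN))//= addrCA subr_ge0 truncn_le t0 /= mulr1.
  rewrite -[leLHS]addr0 lerD//; last by rewrite addr_ge0// sum_ge0.
  by rewrite ler_expR ler_wpM2l// ltW// truncnS_gt.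
have {}tN : t = N%:R.
  by apply/eqP; rewrite eq_le tN/= -truncn_ge_nat.
case: N => [|N] in tN tN' sum_ge0 *.
  by rewrite tN mulr0 expR0 big_ord0 addr0.
rewrite (bigD1 ord_max)//= subr_ge0 {2}tN ler_nat leqnSn /= mulr1 tN.
by rewrite addrCA lerDl addr_ge0// -tN sum_ge0.
Qed.

Section budget.
Context (R : realType) (nu : probability R R).
Variable G : R -> R.
Hypotheses (mG : measurable_fun setT G) (G_neg : forall x : R, x <= 0 -> G x = G 0).
Implicit Types (f g : R * R -> R) (x b c : R) (z : R * R).

(** The second coordinate is the part of a budget that remains after G has been
    paid at each visited state. Since the joint process is again driven by a
    kernel, the tail probabilities of the additive functional satisfy one-step
    recursions. *)
Definition budget_op f z : R := \int[nu]_y f (step z.1 y, z.2 - G z.1).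

(** This iteration and the two after it are P_x(S_n <= b, Phi(n) = 0), P_x(S_n <=
    b) and P_x(S_n < b) at (x, b), where S_n is the sum of G over the first n
    states. *)
Definition bridge n : R * R -> R :=
  iter n budget_op (fun z => ((z.1 <= 0)%R && (0 <= z.2)%R)%:R).
Definition below n : R * R -> R :=
  iter n budget_op (fun z => (0 <= z.2)%R%:R).
Definition sbelow n : R * R -> R :=
  iter n budget_op (fun z => (0 < z.2)%R%:R).

Definition advance (u : (R * R) * R) : R * R :=
  (step u.1.1 u.2, u.1.2 - G u.1.1).

Lemma measurable_advance : measurable_fun setT advance.
Proof.
have m11 : measurable_fun setT (fun u : (R * R) * R => u.1.1).
  by apply: measurableT_comp => //; exact: measurable_fst.
apply: measurable_fun_pair => /=.
  apply: (measurableT_comp (@measurable_step R)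
    (f := fun z => step z.1 z.2) (g := fun u : (R * R) * R => (u.1.1, u.2))).
  by apply: measurable_fun_pair => //; exact: measurable_snd.
apply: measurable_funB; last exact: measurableT_comp.
by apply: measurableT_comp => //; exact: measurable_snd.
Qed.

Let bmeas_move f :
  bmeas f -> bmeas (fun u : (R * R) * R => f (step u.1.1 u.2, u.1.2 - G u.1.1)).
Proof. by move=> bf; exact: (bmeas_comp bf measurable_advance). Qed.

Lemma bmeas_budget_op f : bmeas f -> bmeas (budget_op f).
Proof.
move=> bf; refine (@bmeas_Rint _ _ _ _ _ nu
  (fun u : (R * R) * R => f (step u.1.1 u.2, u.1.2 - G u.1.1)) (bmeas_move bf)).
Qed.

Lemma bmeas_budget_fiber f z : bmeas f ->
  bmeas (fun y => f (step z.1 y, z.2 - G z.1)).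
Proof.
by move=> bf; refine (@bmeas_pair _ _ _ _ _
  (fun u : (R * R) * R => f (step u.1.1 u.2, u.1.2 - G u.1.1)) z (bmeas_move bf)).
Qed.

Lemma bmeas_iter_budget n f : bmeas f -> bmeas (iter n budget_op f).
Proof. by move=> bf; elim: n => //= n; exact: bmeas_budget_op. Qed.

Lemma budget_op_le f g z : bmeas f -> bmeas g ->
  (forall z, f z <= g z) -> budget_op f z <= budget_op g z.
Proof. by move=> bf bg fg; apply: Rint_le => [||y]; [exact: bmeas_budget_fiber..|]. Qed.

Lemma iter_budget_le n f g z : bmeas f -> bmeas g ->
  (forall z, f z <= g z) -> iter n budget_op f z <= iter n budget_op g z.
Proof.
move=> bf bg fg; elim: n z => //= n IHn z.
by apply: budget_op_le => //; exact: bmeas_iter_budget.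
Qed.

Lemma iter_budget_bound n f (a c : R) : bmeas f -> (forall z, a <= f z <= c) ->
  forall z, a <= iter n budget_op f z <= c.
Proof.
move=> bf fac; elim: n => //= n IHn z; apply: Rint_bound => //.
exact/bmeas_budget_fiber/bmeas_iter_budget.
Qed.

Let m_nonneg : measurable_fun setT (fun z : R * R => 0 <= z.2).
Proof. by apply: measurable_fun_ler => //; exact: measurable_snd. Qed.

Lemma bmeas_bridge n : bmeas (bridge n).
Proof.
apply: bmeas_iter_budget; apply: bmeas_bool; apply: measurable_and => //.
by apply: measurable_fun_ler => //; exact: measurable_fst.
Qed.

Lemma bmeas_below n : bmeas (below n).
Proof. by apply: bmeas_iter_budget; exact: bmeas_bool. Qed.

Lemma bmeas_sbelow n : bmeas (sbelow n).
Proof.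
apply: bmeas_iter_budget; apply: bmeas_bool.
by apply: measurable_fun_ltr => //; exact: measurable_snd.
Qed.

Lemma bridge_bound n z : 0 <= bridge n z <= 1.
Proof.
by apply: iter_budget_bound; [exact: (bmeas_bridge 0)|move=> y; rewrite ler0n lern1 leq_b1].
Qed.

Lemma sbelow_le_below n z : sbelow n z <= below n z.
Proof.
apply: iter_budget_le; [exact: (bmeas_sbelow 0)|exact: (bmeas_below 0)|move=> y].
by rewrite ler_nat; case: (ltP 0 y.2) => [/ltW ->|_].
Qed.

Lemma budget_op_neg f x b : x <= 0 -> budget_op f (x, b) = budget_op f (0, b).
Proof. by move=> x0; apply: eq_Rintegral => y _; rewrite /= step_neg// G_neg. Qed.

Lemma bridge_neg n x b : x <= 0 -> bridge n (x, b) = bridge n (0, b).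
Proof.
by case: n => [|n] x0; [rewrite /bridge /= x0 lexx|exact: budget_op_neg].
Qed.

Lemma bridge_homo n x b c : b <= c -> bridge n (x, b) <= bridge n (x, c).
Proof.
elim: n x b c => [|n IHn] x b c bc.
  rewrite ler_nat /=; case: (x <= 0) => //=.
  by case: (leP 0 b) => // b0; rewrite (le_trans b0 bc).
apply: Rint_le => [||y]; try exact: (bmeas_budget_fiber (_, _) (bmeas_bridge n)).
by apply: IHn; rewrite lerD2r.
Qed.

(** A path which is at the atom at time n can be continued by any path that starts
    at the atom, and the two budgets add up. *)
Lemma bridge_superadd n m x b c :
  bridge n (x, b) * bridge m (0, c) <= bridge (n + m) (x, b + c).
Proof.
elim: n x b => [|n IHn] x b.
  rewrite {1}/bridge /=; case: (leP x 0) => x0 /=; last first.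
    by rewrite mul0r; have /andP[] := bridge_bound (0 + m) (x, b + c).
  case: (leP 0 b) => b0; last first.
    by rewrite mul0r; have /andP[] := bridge_bound (0 + m) (x, b + c).
  by rewrite mul1r add0n (bridge_neg _ _ x0) bridge_homo// lerDr.
have bf k t := bmeas_budget_fiber t (bmeas_bridge k).
rewrite mulrC -RintZ; last exact: (bf n (x, b)).
apply: Rint_le => [||y]; [exact: bmeasZ (bf n (x, b))|exact: (bf _ (x, b + c))|].
by rewrite mulrC (le_trans (IHn _ _))//= addrAC.
Qed.

Lemma bridge_le_sbelow n x b c : b < c -> bridge n (x, b) <= sbelow n (x, c).
Proof.
elim: n x b c => [|n IHn] x b c bc.
  rewrite ler_nat /=; case: (x <= 0) => //=.
  by case: (leP 0 b) => // b0; rewrite (le_lt_trans b0 bc).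
apply: Rint_le => [||y].
- exact: (bmeas_budget_fiber (_, _) (bmeas_bridge n)).
- exact: (bmeas_budget_fiber (_, _) (bmeas_sbelow n)).
by apply: IHn; rewrite ltrD2r.
Qed.

Section chernoff.
Variables (phi kap s : R).
Hypotheses (s_ge0 : 0 <= s) (G_kap : forall x, phi - G x <= kap).

Let K := tilted nu G phi s.

Let iter_budget_chernoff n f (g : R -> R) : bmeas f -> bmeas g ->
  (forall x b, f (x, b) <= expR (s * b) * g x) ->
  forall x b, iter n budget_op f (x, b) <=
    expR (s * (b - phi * n%:R)) * iter n K g x.
Proof.
move=> bf bg fg; elim: n => [|n IHn] x b; first by rewrite mulr0 subr0; exact: fg.
have bK := bmeas_iter_tilted nu mG G_kap s_ge0 n bg.
rewrite iterS /budget_op /=.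
apply: (@le_trans _ _ (\int[nu]_y (expR (s * (b - G x - phi * n%:R)) *
    iter n K g (step x y)))).
  apply: Rint_le => [||y]; last exact: IHn.
    exact: (bmeas_budget_fiber (x, b) (bmeas_iter_budget n bf)).
  by apply: bmeasZ; exact: bmeas_step.
rewrite RintZ; last exact: bmeas_step.
rewrite {2}/K /tilted mulrA -expRD le_eqVlt; apply/orP; left; apply/eqP.
by congr (expR _ * _); rewrite -natr1; ring.
Qed.

Lemma bridge_chernoff n x b :
  bridge n (x, b) <= expR (s * (b - phi * n%:R)) * iter n K (@atom R) x.
Proof.
apply: iter_budget_chernoff; [exact: (bmeas_bridge 0)|exact: bmeas_atom|].
move=> {}x {}b; rewrite /= /atom; case: (x <= 0) => /=; last by rewrite mulr0.
rewrite mulr1; case: (leP 0 b) => b0; last exact: expR_ge0.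
by rewrite -expR0 ler_expR mulr_ge0.
Qed.

Lemma below_chernoff n x b :
  below n (x, b) <= expR (s * (b - phi * n%:R)) * iter n K (fun=> 1) x.
Proof.
apply: iter_budget_chernoff; [exact: (bmeas_below 0)|exact: bmeas_cst|].
move=> {}x {}b /=; rewrite mulr1; case: (leP 0 b) => b0; last exact: expR_ge0.
by rewrite -expR0 ler_expR mulr_ge0.
Qed.

(** A converse of Chernoff's inequality. The value of exp(s (t + k phi - S_k)) is
    recovered from the events t + k phi - S_k >= l, whose probabilities on
    paths ending at the atom are bridge probabilities. As phi - G <= kap, the
    levels l beyond t + kap k are never reached: only linearly many terms
    occur. *)
Lemma tilted_atom_layers k N x t : t + kap * k%:R <= N%:R ->
  expR (s * t) * iter k K (@atom R) x <=
  1 + \sum_(l < N) expR (s * l.+1%:R) * bridge k (x, t + phi * k%:R - l%:R).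
Proof.
elim: k x t => [|k IHk] x t.
  rewrite !mulr0 !addr0 => tN; rewrite /= /atom.
  case: (leP x 0) => x0 /=; first by rewrite mulr1 expR_layers.
  by rewrite mulr0 addr_ge0// sumr_ge0// => l _; rewrite mulr_ge0 ?expR_ge0.
move=> tN; pose t' := t + phi - G x.
have t'N : t' + kap * k%:R <= N%:R.
  rewrite (le_trans _ tN)// -natr1 /t'; have := G_kap x; lra.
pose f y l := expR (s * l.+1%:R) * bridge k (step x y, t' + phi * k%:R - l%:R).
have bfi b : bmeas (fun y => bridge k (step x y, b)).
  have := bmeas_budget_fiber (x, b + G x) (bmeas_bridge k).
  by rewrite /= addrK.
have bf l : bmeas (f ^~ l) by apply: bmeasZ.
have -> : expR (s * t) * iter k.+1 K (@atom R) x =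
    \int[nu]_y (expR (s * t') * iter k K (@atom R) (step x y)).
  rewrite RintZ; last first.
    exact/bmeas_step/(bmeas_iter_tilted nu mG G_kap s_ge0)/bmeas_atom.
  rewrite iterS {1}/K /tilted mulrA -expRD; congr (expR _ * _).
  by rewrite /t'; ring.
have -> : 1 + \sum_(l < N) expR (s * l.+1%:R) *
      bridge k.+1 (x, t + phi * k.+1%:R - l%:R) =
    \int[nu]_y (1 + \sum_(l < N) f y l).
  rewrite RintD ?Rint_cst; [|exact: bmeas_cst|exact: (bmeas_sum (F := fun l y => f y l))].
  rewrite (Rint_sum nu (F := fun l y => f y l))//; congr (1 + _).
  apply: eq_bigr => l _; rewrite /f RintZ//; congr (_ * _).
  apply: eq_Rintegral => y _; congr (bridge k (_, _)) => /=.
  by rewrite /t' -natr1; ring.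
apply: Rint_le => [||y].
- exact/bmeasZ/bmeas_step/(bmeas_iter_tilted nu mG G_kap s_ge0)/bmeas_atom.
- by apply: bmeasD; [exact: bmeas_cst|exact: (bmeas_sum (F := fun l y => f y l))].
exact: IHk.
Qed.

End chernoff.

Section loops.
Variables (d p X C : R).
Hypotheses (d_gt0 : 0 < d) (p_gt0 : 0 < p).
Hypothesis nu_down : p <= \int[nu]_y (y <= - d)%R%:R.
Hypothesis G_le : forall x, x <= X -> G x <= C.

(** Steps of size at least d downwards lead from height j d to the atom, and the
    path never leaves the region where G is at most C. *)
Lemma bridge_descent j x : 0 <= X -> x <= X -> x <= j%:R * d ->
  p ^+ j <= bridge j (x, j%:R * C).
Proof.
move=> X0; elim: j x => [|j IHj] x xX xj.
  by rewrite mul0r in xj; rewrite /bridge /= xj mul0r lexx.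
have bfi := bmeas_budget_fiber (x, j.+1%:R * C) (bmeas_bridge j).
apply: (@le_trans _ _ (\int[nu]_y (p ^+ j * (y <= - d)%R%:R))).
  rewrite RintZ; last exact: bmeas_down.
  by rewrite exprSr ler_wpM2l// exprn_ge0// ltW.
apply: Rint_le => [||y] //; first by apply: bmeasZ; exact: bmeas_down.
case: (leP y (- d)) => yd; last first.
  by rewrite mulr0; have /andP[] := bridge_bound j (step x y, j.+1%:R * C - G x).
rewrite mulr1.
have st := step_down d_gt0 x yd.
have stX : step x y <= X.
  by rewrite (le_trans st)// ge_max X0 andbT; have := d_gt0; lra.
have stj : step x y <= j%:R * d.
  rewrite (le_trans st)// ge_max mulr_ge0 ?ler0n ?(ltW d_gt0)// andbT.
  by move: xj; rewrite -natr1; lra.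
rewrite (le_trans (IHj _ stX stj))// bridge_homo//= -natr1.
by have := G_le xX; lra.
Qed.

End loops.

End budget.

(** * From independent increments to budgets *)

Section independence.
Context d (T : measurableType d) (R : realType) (P : probability T R).

Lemma Rint_distribution d' (T' : measurableType d') (X : {mfun T >-> T'})
    (f : T' -> R) : bmeas f ->
  \int[distribution P X]_x f x = \int[P]_w f (X w).
Proof.
move=> bf; congr fine.
apply: (@integral_distribution _ _ _ _ _ P X (EFin \o f)).
  by apply/measurable_EFinP; exact: bf.1.
exact: (bmeas_integrable P (bmeas_comp bf (measurable_funPT X))).
Qed.

Context d1 d2 (T1 : measurableType d1) (T2 : measurableType d2).

Lemma rectangle_unique (m1 m2 : {measure set (T1 * T2) -> \bar R}) :
  (m1 setT < +oo)%E ->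
  (forall C B, measurable C -> measurable B -> m1 (C `*` B) = m2 (C `*` B)) ->
  forall F, measurable F -> m1 F = m2 F.
Proof.
move=> m1oo m12 F mF.
pose G := [set C `*` B | C in @measurable _ T1 & B in @measurable _ T2].
apply: (@g_sigma_algebra_measure_unique _ _ _ G _ (fun=> setT)).
- by move=> _ [C mC [B mB <-]]; exact: measurableX.
- by move=> _; exists setT => //; exists setT => //; rewrite setXTT.
- by apply/seteqP; split => // x _; exists 0%N.
- move=> _ _ [C mC [B mB <-]] [C' mC' [B' mB' <-]].
  exists (C `&` C'); first exact: measurableI.
  by exists (B `&` B'); [exact: measurableI|rewrite setXI].
- by move=> _ [C mC [B mB <-]]; exact: m12.
- by move=> _.
- by rewrite -measurable_prod_measurableType.
Qed.

(** Independence on rectangles makes the joint law a product measure, so that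
    Fubini's theorem computes the expectation. *)
Lemma joint_expectation (X : {mfun T >-> T1}) (Y : {mfun T >-> T2}) :
  (forall C B, measurable C -> measurable B ->
     P (X @^-1` C `&` Y @^-1` B) = (P (X @^-1` C) * P (Y @^-1` B))%E) ->
  forall f : T1 * T2 -> R, bmeas f ->
  \int[P]_w f (X w, Y w) = \int[P]_w \int[distribution P Y]_y f (X w, y).
Proof.
move=> XY f bf.
have mZ : measurable_fun setT (fun w => (X w, Y w)).
  by apply: measurable_fun_pair; exact: measurable_funPT.
pose Z : {mfun T >-> (T1 * T2)%type} :=
  HB.pack (fun w => (X w, Y w)) (isMeasurableFun.Build _ _ _ _ _ mZ).
rewrite -(Rint_distribution Z bf).
rewrite -(Rint_distribution X (bmeas_Rint (distribution P Y) bf)).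
have -> : \int[distribution P Z]_x f x =
    fine (\int[distribution P X \x distribution P Y]_x (f x)%:E)%E.
  congr fine; apply: eq_measure_integral => F mF _.
  rewrite -(@product_measure_unique _ _ _ _ _ (distribution P X)
    (distribution P Y) (distribution P Z))//; exact: XY.
exact: Rint_prod.
Qed.

End independence.

Section driven_walk.
Context d (T : measurableType d) (R : realType) (P : probability T R).
Variables (D : nat -> {RV P >-> R}) (G : R -> R) (x b : R).
Hypotheses (D_iid : iid D) (mG : measurable_fun setT G) (x_ge0 : 0 <= x).

Let nu := distribution P (D 0%N).

Lemma walk_ge0 w k : 0 <= walk D x w k.
Proof. by case: k => //= k; rewrite le_max lexx orbT. Qed.

Lemma walkS w k : walk D x w k.+1 = step (walk D x w k) (D k w).
Proof. by rewrite /= /step (max_idPl (walk_ge0 w k)). Qed.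

Definition state n w : R * R :=
  (walk D x w n, b - \sum_(0 <= k < n) G (walk D x w k)).

Lemma stateS n w : state n.+1 w = advance G (state n w, D n w).
Proof.
by rewrite /state /advance walkS /= big_nat_recr//= opprD addrA.
Qed.

Lemma measurable_state n : measurable_fun setT (state n).
Proof.
elim: n => [|n IHn].
  have -> : state 0 = fun=> (x, b).
    by apply/funext => w; rewrite /state big_nil subr0.
  exact: measurable_cst.
have -> : state n.+1 = fun w => advance G (state n w, D n w).
  by apply/funext => w; rewrite stateS.
apply: (measurableT_comp (measurable_advance mG)).
by apply: measurable_fun_pair => //; exact: measurable_funPT.
Qed.

Let cyl (J : {fset nat}) (A : nat -> set R) : set T :=
  \bigcap_(i in [set` J]) (D i @^-1` A i).

Let measurable_D i (A : set R) : measurable A -> measurable (D i @^-1` A).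
Proof. by move=> mA; rewrite -[X in measurable X]setTI; exact: measurable_funPT. Qed.

Let measurable_cyl J A : (forall i, i \in J -> measurable (A i)) ->
  measurable (cyl J A).
Proof.
move=> mA; apply: fin_bigcap_measurable; first exact: finite_fset.
by move=> i iJ; apply: measurable_D; exact: mA.
Qed.

Let upd (A : nat -> set R) n B i := if i == n then B else A i.

Let cyl_cons n J A B : n \notin J ->
  cyl (n |` J)%fset (upd A n B) = D n @^-1` B `&` cyl J A.
Proof.
move=> nJ; apply/seteqP; split => [w wJ|w [wB wJ] i].
  split; first by have := wJ n; rewrite /= !inE eqxx /upd eqxx; exact.
  move=> i /= iJ; have := wJ i; rewrite /= !inE iJ orbT /upd.
  by case: eqP => [ein|_]; [rewrite -ein iJ in nJ|exact].
by rewrite /= !inE /upd; case: eqP => [-> //|_ /= iJ]; exact: wJ.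
Qed.

Let upd_measurable n J A B : measurable B ->
  (forall i, i \in J -> measurable (A i)) ->
  forall i, i \in (n |` J)%fset -> measurable (upd A n B i).
Proof.
by move=> mB mA i; rewrite !inE /upd; case: eqP => //= _; exact: mA.
Qed.

Let P_cons n J A B : n \notin J -> measurable B ->
  (forall i, i \in J -> measurable (A i)) ->
  P (D n @^-1` B `&` cyl J A) = (P (D n @^-1` B) * P (cyl J A))%E.
Proof.
move=> nJ mB mA; rewrite -cyl_cons// /cyl D_iid.1; last exact: upd_measurable.
rewrite D_iid.1// big_fsetU1//= /upd eqxx; congr (_ * _)%E.
rewrite big_seq_cond [RHS]big_seq_cond; apply: eq_bigr => i /andP[iJ _].
by case: eqP => // ein; rewrite -ein iJ in nJ.
Qed.

(** Independence of the increments is a product rule for finite families of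
    events. The state at time n + 1 is an image of the state at time n and the
    n-th increment, so this increment can be moved from the family into the
    state: two finite measures that agree on rectangles agree. *)
Lemma state_indep n (J : {fset nat}) (A : nat -> set R) (C : set (R * R)) :
  (forall i, i \in J -> (n <= i)%N) ->
  (forall i, i \in J -> measurable (A i)) -> measurable C ->
  P (state n @^-1` C `&` cyl J A) = (P (state n @^-1` C) * P (cyl J A))%E.
Proof.
elim: n J A C => [|n IHn] J A C nJ mA mC.
  have -> : state 0 = fun=> (x, b).
    by apply/funext => w; rewrite /state big_nil subr0.
  rewrite preimage_cst; case: ifPn => _.
    by rewrite setTI probability_setT mul1e.
  by rewrite set0I measure0 mul0e.
have nJ' : n \notin J by apply/negP => /nJ; rewrite ltnn.
have mZ : measurable_fun setT (fun w => (state n w, D n w)).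
  by apply: measurable_fun_pair; [exact: measurable_state|exact: measurable_funPT].
have c0 : 0 <= fine (P (cyl J A)) by exact: fine_ge0.
pose c : {nonneg R} := NngNum c0.
have cE : (c%:num%:E = P (cyl J A))%E.
  rewrite /= fineK// fin_num_measure//; exact: measurable_cyl.
have mcJ := measurable_cyl mA.
have key F : measurable F ->
    P ((fun w => (state n w, D n w)) @^-1` F `&` cyl J A) =
    (P (cyl J A) * P ((fun w => (state n w, D n w)) @^-1` F))%E.
  move=> mF; rewrite -cE.
  pose mu1 := measure_function_pushforward__canonical__measure_function_Measure
    (mrestr P mcJ) mZ.
  pose mu2 := measure_function_pushforward__canonical__measure_function_Measure
    (mscale c P) mZ.
  apply: (@rectangle_unique R _ _ _ _ mu1 mu2) => //.
    rewrite /mu1 /= /pushforward /mrestr preimage_setT setTI.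
    by rewrite (le_lt_trans (probability_le1 P mcJ))// ltry.
  move=> C' B mC' mB; rewrite /mu1 /mu2 /= /pushforward /mrestr /mscale cE.
  have -> : (fun w => (state n w, D n w)) @^-1` (C' `*` B) =
      state n @^-1` C' `&` D n @^-1` B by [].
  have /= e1 := IHn _ _ C' _ (upd_measurable (n := n) mB mA) mC'.
  have e2 := IHn [fset n]%fset (fun=> B) C'.
  have cyl1 : cyl [fset n]%fset (fun=> B) = D n @^-1` B.
    apply/seteqP; split => [w wn|w wB i]; first by apply: (wn n); rewrite /= inE.
    by rewrite /= inE => /eqP ->.
  rewrite -setIA -cyl_cons// e1; last first.
    by move=> i; rewrite !inE => /orP[/eqP -> //|/nJ /ltnW].
  rewrite cyl_cons// P_cons// -cyl1 e2 ?cyl1//.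
  - by rewrite muleA muleC.
  - by move=> i; rewrite inE => /eqP ->.
have -> : state n.+1 @^-1` C =
    (fun w => (state n w, D n w)) @^-1` (advance G @^-1` C).
  by apply/seteqP; split => w /=; rewrite stateS.
rewrite key; first by rewrite muleC.
by rewrite -[X in measurable X]setTI; exact: (measurable_advance mG).
Qed.

(** The Markov property, one step at a time: the next increment is independent of
    the present state and has law [nu]. *)
Lemma expectation_state n (f : R * R -> R) : bmeas f ->
  \int[P]_w f (state n w) = iter n (budget_op nu G) f (x, b).
Proof.
elim: n f => [|n IHn] f bf.
  rewrite /= -[RHS](Rint_cst P); apply: eq_Rintegral => w _.
  by rewrite /state big_nil subr0.
rewrite iterSr -IHn; last exact: bmeas_budget_op.
pose X : {mfun T >-> (R * R)%type} :=
  HB.pack (state n) (isMeasurableFun.Build _ _ _ _ _ (measurable_state n)).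
have -> : \int[P]_w f (state n.+1 w) = \int[P]_w f (advance G (X w, D n w)).
  by apply: eq_Rintegral => w _; rewrite stateS.
rewrite (@joint_expectation _ _ _ P _ _ _ _ X (D n) _ (f \o advance G)); last 2 first.
- move=> C B mC mB.
  have cyl1 : cyl [fset n]%fset (fun=> B) = D n @^-1` B.
    apply/seteqP; split => [w wn|w wB i]; first by apply: (wn n); rewrite /= inE.
    by rewrite /= inE => /eqP ->.
  rewrite -cyl1 state_indep//.
  by move=> i; rewrite inE => /eqP ->.
- exact: (bmeas_comp bf (measurable_advance mG)).
apply: eq_Rintegral => w _; rewrite /budget_op; congr fine.
apply: eq_measure_integral => B mB _; exact: D_iid.2.
Qed.

Lemma prob_state n (q : pred (R * R)) : measurable_fun setT q ->
  P [set w | q (state n w)] =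
  (iter n (budget_op nu G) (fun z => (q z)%:R) (x, b))%:E.
Proof.
move=> mq; rewrite -expectation_state; last exact: bmeas_bool.
have mS : measurable [set w | q (state n w)].
  rewrite -[X in measurable X]setTI.
  exact: (measurableT_comp mq (measurable_state n)).
rewrite /Rintegral fineK; last first.
  apply: (integrable_fin_num measurableT); apply: bmeas_integrable.
  refine (@bmeas_comp _ _ _ _ R (fun z => (q z)%:R) (state n) _ _).
    exact: bmeas_bool.
  exact: measurable_state.
rewrite -(setIT [set w | _]) -integral_indic//.
apply: eq_integral => w _; rewrite indicE.
by have -> : (w \in [set w | q (state n w)]) = q (state n w)
  by apply/idP/idP; rewrite inE.
Qed.

End driven_walk.

(** * Rigidity of tight supersolutions *)

(** Concavity of the logarithm with a quadratic remainder: twice the inequality ln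
    t <= t - 1 at the square root t of a / b. *)
Lemma ln_sub_le (R : realType) (A a b : R) : 0 < a -> a <= A -> 0 < b -> b <= A ->
  ln a - ln b <= (a - b) / b - (a - b) ^+ 2 / (4 * A ^+ 2).
Proof.
move=> a0 aA b0 bA.
have A0 : 0 < A by exact: lt_le_trans aA.
have sq (c : R) : 0 < c -> exists2 r, 0 < r & c = r ^+ 2.
  by move=> c0; exists (Num.sqrt c); rewrite ?sqrtr_gt0// sqr_sqrtr// ltW.
have [al al0 ea] := sq _ a0; have [be be0 eb] := sq _ b0.
move: a0 aA b0 bA; rewrite {}ea {}eb => _ aA _ bA.
have l1 : ln (al ^+ 2) - ln (be ^+ 2) <= 2 * (al / be - 1).
  (* Halving the logarithm gains the square of al / be - 1. *)
  have -> : ln (al ^+ 2) - ln (be ^+ 2) = 2 * ln (al / be).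
    rewrite !lnXn// lnM ?posrE ?invr_gt0// lnV ?posrE//.
    by rewrite -mulrnBl mulr_natl.
  rewrite ler_wpM2l//; have := le_ln1Dx (x := al / be - 1).
  rewrite addrCA subrr addr0; apply.
  by rewrite ltrBrDl subrr divr_gt0.
apply: (le_trans l1).
have e1 : (al ^+ 2 - be ^+ 2) / be ^+ 2 =
    2 * (al / be - 1) + (al - be) ^+ 2 / be ^+ 2.
  by field; rewrite gt_eqF.
rewrite e1 -addrA lerDl subr_ge0 subr_sqr exprMn -mulrA.
rewrite ler_wpM2l ?sqr_ge0// ler_pdivrMr ?mulr_gt0 ?exprn_gt0//.
have h1 : (al + be) ^+ 2 <= 4 * A.
  have := sqr_ge0 (al - be).
  have -> : (al - be) ^+ 2 = 2 * al ^+ 2 + 2 * be ^+ 2 - (al + be) ^+ 2 by ring.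
  lra.
by rewrite (le_trans h1)// ler_pdivlMl ?exprn_gt0// mulrCA ler_wpM2l// expr2 ler_pM2r.
Qed.

Section real_integrable.
Context d (X : measurableType d) (R : realType) (mu : probability X R).
Implicit Types f g : X -> R.

Lemma rintegrableB f g : mu.-integrable setT (EFin \o f) ->
  mu.-integrable setT (EFin \o g) ->
  mu.-integrable setT (EFin \o (fun x => f x - g x)).
Proof.
move=> jf jg; have -> : EFin \o (fun x => f x - g x) = ((EFin \o f) \- (EFin \o g))%E.
  by apply/funext.
exact: integrableB.
Qed.

Lemma rintegrableZ f (c : R) : mu.-integrable setT (EFin \o f) ->
  mu.-integrable setT (EFin \o (fun x => c * f x)).
Proof.
move=> jf; have -> : EFin \o (fun x => c * f x) = (fun x => c%:E * (EFin \o f) x)%E.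
  by apply/funext.
exact: integrableZl.
Qed.

Lemma rintegrableD f g : mu.-integrable setT (EFin \o f) ->
  mu.-integrable setT (EFin \o g) ->
  mu.-integrable setT (EFin \o (fun x => f x + g x)).
Proof.
move=> jf jg; have -> : EFin \o (fun x => f x + g x) = ((EFin \o f) \+ (EFin \o g))%E.
  by apply/funext.
exact: integrableD.
Qed.

Lemma rintegrable_cst (c : R) : mu.-integrable setT (EFin \o (fun _ : X => c)).
Proof. by apply: bmeas_integrable; exact: bmeas_cst. Qed.

End real_integrable.

Section stationarity.
Context (R : realType) (nu pi : probability R R).
Hypothesis pi_inv : forall f, bmeas f -> \int[pi]_x Q nu f x = \int[pi]_x f x.

Section unbounded_support.
Variables (d1 p1 : R).
Hypotheses (d1_gt0 : 0 < d1) (p1_gt0 : 0 < p1).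
Hypothesis nu_up : p1 <= \int[nu]_y (d1 <= y)%R%:R.

Let bmeas_gt (r : R) : bmeas (fun x : R => (r < x)%R%:R : R).
Proof. by apply: bmeas_bool; apply: measurable_fun_ltr. Qed.

Let bmeas_ge (r : R) : bmeas (fun x : R => (r <= x)%R%:R : R).
Proof. by apply: bmeas_bool; apply: measurable_fun_ler. Qed.

Lemma Q_up (r x : R) : r < x + d1 ->
  p1 <= Q nu (fun z => (r < z)%R%:R) x.
Proof.
move=> rx; apply: (le_trans nu_up).
apply: Rint_le => [||y]; [exact: bmeas_ge|exact: (bmeas_step x (bmeas_gt r))|].
rewrite ler_nat; case: (leP d1 y) => //= dy.
suff -> : r < step x y by [].
rewrite /step lt_max; apply/orP; left.
by rewrite (lt_le_trans rx)// lerD// le_max lexx.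
Qed.

(** From any state, n steps upwards of size at least d1 lead beyond n d1 - 1 with
    probability at least p1 ^ n, and [pi] is invariant. *)
Lemma stationary_unbounded (r : R) : 0 < \int[pi]_x (r < x)%R%:R.
Proof.
have key n : p1 ^+ n <= \int[pi]_x (n%:R * d1 - 1 < x)%R%:R.
  elim: n => [|n IHn].
    rewrite -pi_inv// -[leLHS](Rint_cst pi).
    apply: Rint_le => [||x]; [exact: bmeas_cst|exact: bmeas_Q|].
    rewrite -[leLHS](Q_cst nu _ x).
    apply: Rint_le => [||y]; [exact: bmeas_cst|exact: (bmeas_step x (bmeas_gt _))|].
    by rewrite expr0 mul0r sub0r (lt_le_trans _ (step_ge0 x y))// ltrN10.
  rewrite -pi_inv//.
  apply: (@le_trans _ _ (\int[pi]_x (p1 * (n%:R * d1 - 1 < x)%R%:R))).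
    by rewrite RintZ// exprS ler_wpM2l// ltW.
  apply: Rint_le => [||x]; [exact: bmeasZ|exact: bmeas_Q|].
  case: ltP => nx /=; last by rewrite mulr0 Q_ge0.
  by rewrite mulr1 Q_up// -natr1; lra.
pose n := Num.truncn ((`|r| + 1) / d1).
have nr : `|r| + 1 <= n.+1%:R * d1 by rewrite -ler_pdivrMr// ltW// truncnS_gt.
have : 0 < p1 ^+ n.+1 by rewrite exprn_gt0.
move=> /lt_le_trans; apply; apply: (le_trans (key n.+1)).
apply: Rint_le => // x; rewrite ler_nat.
case: ltP => //= nx; suff -> : r < x by [].
by rewrite (le_lt_trans (ler_norm r))// (le_lt_trans _ nx)// lerBrDr.
Qed.

End unbounded_support.

(** The minimum of the indicator of b and n f increases to the indicator. *)
Lemma Rint_gt0 (b : R -> bool) (f : R -> R) : measurable_fun setT b ->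
  bmeas f -> (forall x, 0 <= f x) -> (forall x, b x -> 0 < f x) ->
  0 < \int[pi]_x (b x)%:R -> 0 < \int[pi]_x f x.
Proof.
move=> mb bf f0 bf0 pb; rewrite ltNge; apply/negP => f_le0.
pose h n x : R := Num.min (b x)%:R (n%:R * f x).
have mbR := (bmeas_bool R mb).1.
have mh n : measurable_fun setT (h n).
  by apply: measurable_minr => //; apply: measurable_funM => //; exact: bf.1.
have h01 n x : 0 <= h n x <= 1.
  by rewrite le_min ler0n mulr_ge0//= ge_min lern1 leq_b1.
have hcv x : h n x @[n --> \oo] --> ((b x)%:R : R).
  case: (boolP (b x)) => bx; last first.
    have -> : (h ^~ x) = fun=> 0.
      by apply/funext => n; rewrite /h (negbTE bx) min_l ?mulr_ge0.
    exact: cvg_cst.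
  apply: cvg_near_cst; near=> n; rewrite /h bx min_l// mulrC -ler_pdivrMl ?bf0//.
  by near: n; exact: nbhs_infty_ger.
have := @Rint_cvg _ _ _ pi h _ 1 mh _ hcv.
have hM n x : `|h n x| <= 1.
  by have /andP[? ?] := h01 n x; rewrite ger0_norm.
move=> /(_ hM) cv; move: pb; rewrite ltNge => /negP; apply.
rewrite -(cvg_lim _ cv)//; apply: limr_le; first by apply/cvg_ex; eexists; exact: cv.
apply: nearW => n; apply: (@le_trans _ _ (\int[pi]_x (n%:R * f x))).
  apply: Rint_le => [||x]; [|exact: bmeasZ|by rewrite ge_min lexx orbT].
  by apply: (@bmeas_between _ _ _ 0 1).
by rewrite RintZ// mulr_ge0_le0.
Unshelve. all: by end_near. Qed.

Section rigidity.
Variables (d1 p1 : R).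
Hypotheses (d1_gt0 : 0 < d1) (p1_gt0 : 0 < p1).
Hypothesis nu_up : p1 <= \int[nu]_y (d1 <= y)%R%:R.
Variables (G W : R -> R) (phi s : R).
Hypotheses (s_gt0 : 0 < s) (mG : measurable_fun setT G).
Hypothesis G_int : pi.-integrable setT (EFin \o G).
Hypothesis G_mean : \int[pi]_x G x = phi.
Hypothesis G_coercive : forall M : R, exists r : R, forall x, r < x -> M <= G x.
Hypotheses (bW : bmeas W) (W_bound : forall x, 0 < W x <= 2).
Hypothesis W_super : forall x, Q nu W x <= expR (s * (G x - phi)) * W x.
Hypothesis W_tight : forall x : R, 0 < x -> Q nu W x = expR (s * (G x - phi)) * W x.

(** The variance of W after one step from x. *)
Let qvar x : R := Q nu (fun z => W z ^+ 2) x - Q nu W x ^+ 2.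

Let W_ge0 x : 0 <= W x. Proof. by have /andP[/ltW] := W_bound x. Qed.
Let bQ := bmeas_Q nu bW.
Let QW_bound x : 0 <= Q nu W x <= 2.
Proof. by apply: Q_bound => // y; have /andP[/ltW -> ->] := W_bound y. Qed.
Let bqvar : bmeas qvar.
Proof. by apply: bmeasB; [exact/bmeas_Q/bmeasX|exact: bmeasX]. Qed.

Let qvarE x : \int[nu]_y ((W (step x y) - Q nu W x) ^+ 2) = qvar x.
Proof.
set q := Q nu W x.
transitivity (\int[nu]_y ((W (step x y) ^+ 2) + ((- 2 * q) * W (step x y) + q ^+ 2))).
  by apply: eq_Rintegral => y _; ring.
have b1 := bmeas_step x bW.
rewrite RintD; [|exact: bmeasX|apply: bmeasD; [exact: bmeasZ|exact: bmeas_cst]].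
rewrite RintD; [|exact: bmeasZ|exact: bmeas_cst].
by rewrite RintZ// Rint_cst /qvar /Q -/(Q nu W x) -/q; ring.
Qed.

Let qvar_ge0 x : 0 <= qvar x.
Proof. by rewrite -qvarE; apply: Rintegral_ge0 => y _; exact: sqr_ge0. Qed.

Let bln (f : R -> R) (e : R) : bmeas f -> 0 < e -> (forall x, 0 <= f x <= 2) ->
  bmeas (fun x => ln (f x + e)).
Proof.
move=> bf e0 f02; apply: (@bmeas_between _ _ _ (ln e) (ln (2 + e))).
  apply: measurableT_comp => //; apply: measurable_funD => //; exact: bf.1.
move=> x; have /andP[f0 f2] := f02 x.
by rewrite !ler_ln ?posrE ?lerD2r ?lerDr ?f0//; lra.
Qed.

Let Q_ln (e : R) x : 0 < e -> e <= 1 ->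
  Q nu (fun z => ln (W z + e)) x <= ln (Q nu W x + e) - qvar x / 36.
Proof.
move=> e0 e1; set q := Q nu W x; pose b := q + e.
have /andP[q0 q2] : 0 <= q <= 2 := QW_bound x.
have b0 : 0 < b by rewrite /b; lra.
have b1 := bmeas_step x bW.
have W02 y : 0 <= W y <= 2 by have /andP[/ltW -> ->] := W_bound y.
apply: (@le_trans _ _ (\int[nu]_y (ln b + ((W (step x y) - q) * b^-1 -
    (W (step x y) - q) ^+ 2 * 36^-1)))).
  apply: Rint_le => [||y].
  - exact: (bmeas_step x (bln bW e0 W02)).
  - apply: bmeasD; first exact: bmeas_cst.
    apply: bmeasB; apply: bmeasM; try exact: bmeas_cst.
      by apply: bmeasB => //; exact: bmeas_cst.
    by apply: bmeasX; apply: bmeasB => //; exact: bmeas_cst.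
  have /andP[w0 w2] := W02 (step x y).
  have := @ln_sub_le R 3 (W (step x y) + e) b.
  have -> : W (step x y) + e - b = W (step x y) - q by rewrite /b; ring.
  have -> : 4 * 3 ^+ 2 = 36 :> R by ring.
  move=> /(_ _ _ b0); rewrite lerBlDl; apply; rewrite /b; lra.
have bd : bmeas (fun y => W (step x y) - q) by apply: bmeasB => //; exact: bmeas_cst.
have bd2 : bmeas (fun y => (W (step x y) - q) ^+ 2) by exact: bmeasX.
rewrite RintD; [|exact: bmeas_cst|apply: bmeasB; apply: bmeasM => //; exact: bmeas_cst].
rewrite RintB; [|apply: bmeasM => //; exact: bmeas_cst..].
rewrite Rint_cst (RintegralZr _ measurableT (bmeas_integrable nu bd)).
rewrite (RintegralZr _ measurableT (bmeas_integrable nu bd2)) qvarE.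
rewrite RintB//; last exact: bmeas_cst.
by rewrite Rint_cst -/(Q nu W x) -/q subrr mul0r; lra.
Qed.

(** The bound on the increment of ln W, with W regularised by e because it may be
    arbitrarily close to 0; as e tends to 0 it tends to s (G - phi). *)
Let m_ (e : R) x : R := ln ((expR (s * (G x - phi)) * W x + e) / (W x + e)).

Let qvar_le (e : R) : 0 < e -> e <= 1 -> pi.-integrable setT (EFin \o m_ e) ->
  \int[pi]_x qvar x <= 36 * \int[pi]_x m_ e x.
Proof.
move=> e0 e1 im.
have W02 y : 0 <= W y <= 2 by have /andP[/ltW -> ->] := W_bound y.
have bl := bln bW e0 W02; have blQ := bln bQ e0 QW_bound.
have bq36 : bmeas (fun x => qvar x / 36) by apply: bmeasM => //; exact: bmeas_cst.
have h1 : \int[pi]_x (ln (W x + e)) <=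
    \int[pi]_x (ln (Q nu W x + e)) - \int[pi]_x (qvar x / 36).
  rewrite -RintB// -[leLHS](pi_inv bl).
  by apply: Rint_le => [||x]; [exact: bmeas_Q|exact: bmeasB|exact: Q_ln].
have h2 : \int[pi]_x (ln (Q nu W x + e)) - \int[pi]_x (ln (W x + e)) <=
    \int[pi]_x m_ e x.
  rewrite -RintB//; apply: le_Rintegral => //.
    by apply: bmeas_integrable; exact: bmeasB.
  move=> x _; have /andP[W0 W2] := W_bound x.
  have /andP[q0 q2] := QW_bound x.
  have e2 := expR_gt0 (s * (G x - phi)).
  rewrite /m_ lnM ?posrE ?invr_gt0 ?addr_gt0 ?mulr_gt0//.
  have q1 : 0 < Q nu W x + e by lra.
  rewrite lnV ?posrE ?addr_gt0// lerD2r ler_ln ?posrE//; first by rewrite lerD2r.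
  by rewrite addr_gt0// mulr_gt0.
have : \int[pi]_x (qvar x / 36) = \int[pi]_x qvar x / 36.
  exact: (RintegralZr _ measurableT (bmeas_integrable pi bqvar)).
lra.
Qed.

Let m_bound (e : R) x : 0 < e -> `|m_ e x| <= s * `|G x - phi|.
Proof.
move=> e0; have /andP[W0 _] := W_bound x.
rewrite /m_; set u := s * (G x - phi).
have -> : s * `|G x - phi| = `|u| by rewrite normrM (gtr0_norm s_gt0).
have d0 : 0 < W x + e by rewrite addr_gt0.
have eu := expR_gt0 u.
have n0 : 0 < expR u * W x + e by rewrite addr_gt0 ?mulr_gt0.
have lnle a b : 0 < b -> b <= expR a -> ln b <= a.
  by move=> b0 ba; rewrite -[leRHS]expRK ler_ln ?posrE ?expR_gt0.
have lnge a b : 0 < b -> expR a <= b -> a <= ln b.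
  by move=> b0 ba; rewrite -[leLHS]expRK ler_ln ?posrE ?expR_gt0.
have r0 : 0 < (expR u * W x + e) / (W x + e) by rewrite divr_gt0.
rewrite ler_norml; apply/andP; split.
  apply: lnge => //; rewrite ler_pdivlMr// mulrDr lerD//.
    apply: ler_wpM2r; first exact: ltW.
    by rewrite ler_expR lerNl ler_normr lexx orbT.
  by rewrite ger_pMl// -expR0 ler_expR oppr_le0.
apply: lnle => //; rewrite ler_pdivrMr// mulrDr lerD//.
  by apply: ler_wpM2r; [exact: ltW|rewrite ler_expR ler_norm].
by rewrite ler_peMl ?(ltW e0)// -expR0 ler_expR.
Qed.

Let mm (e : R) : 0 < e -> measurable_fun setT (m_ e).
Proof.
move=> e0; have -> : m_ e = fun x =>
    ln (expR (s * (G x - phi)) * W x + e) - ln (W x + e).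
  apply/funext => x; have /andP[W0 _] := W_bound x; have e2 := expR_gt0 (s * (G x - phi)).
  rewrite /m_ lnM ?posrE ?invr_gt0 ?addr_gt0 ?mulr_gt0//.
  by rewrite lnV ?posrE ?addr_gt0.
apply: measurable_funB; apply: measurableT_comp => //.
  apply: measurable_funD => //; apply: measurable_funM; last exact: bW.1.
  apply: measurableT_comp => //; apply: measurable_funM => //.
  exact: measurable_funB.
by apply: measurable_funD => //; exact: bW.1.
Qed.

Let G_int' : pi.-integrable setT (EFin \o (fun x => s * `|G x - phi|)).
Proof.
apply: rintegrableZ; apply: integrable_norm.
by apply: rintegrableB => //; exact: rintegrable_cst.
Qed.

Let qvar_mean : \int[pi]_x qvar x <= 0.
Proof.
pose e n : R := n.+1%:R^-1.
have e0 n : 0 < e n by rewrite invr_gt0.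
have e1 n : e n <= 1 by rewrite invf_le1 ?ler1n.
have cv : \int[pi]_x m_ (e n) x @[n --> \oo] --> \int[pi]_x (s * (G x - phi)).
  apply: (Rint_cvg_dom (fun n => mm (e0 n)) G_int') => [n x|x]; first exact: m_bound.
  have /andP[W0 _] := W_bound x.
  have -> : s * (G x - phi) =
      ln ((expR (s * (G x - phi)) * W x + 0) / (W x + 0)).
    by rewrite !addr0 mulfK ?gt_eqF// expRK.
  have ce : e n @[n --> \oo] --> (0 : R) by exact: cvg_harmonic.
  apply: continuous_cvg.
    by apply: continuous_ln; rewrite !addr0 mulfK ?gt_eqF ?expR_gt0.
  apply: cvgM; first by apply: cvgD => //; exact: cvg_cst.
  apply: cvgV; first by rewrite addr0 gt_eqF.
  by apply: cvgD => //; exact: cvg_cst.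
have z : \int[pi]_x (s * (G x - phi)) = 0.
  rewrite RintegralZl//; last by apply: rintegrableB => //; exact: rintegrable_cst.
  rewrite RintegralB//; last exact: rintegrable_cst.
  by rewrite Rint_cst G_mean subrr mulr0.
rewrite z in cv.
have cv36 : 36 * \int[pi]_x m_ (e n) x @[n --> \oo] --> (0 : R).
  by rewrite -(mulr0 36); exact: cvgMr.
rewrite -(cvg_lim _ cv36)//; apply: limr_ge; first by apply/cvg_ex; eexists; exact: cv36.
apply: nearW => n; apply: qvar_le => //.
apply: (le_integrable measurableT _ _ G_int'); first by apply/measurable_EFinP; exact: mm.
move=> x _ /=; rewrite lee_fin (le_trans (m_bound x (e0 n)))//.
exact: ler_norm.
Qed.

(** Jensen's inequality for the logarithm is strict by a multiple of the one-step
    variance qvar of W. Integrated against [pi], it reads pi(ln W) <= pi(ln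
    QW) - pi(qvar) / 36, where ln QW <= ln W + s (G - phi) and pi(G - phi) =
    0; hence qvar vanishes almost everywhere. But far from the atom QW >= (2 /
    p1) W, so that, W(Phi(1)) being almost surely QW, upward steps, which have
    probability at least p1, already give Q(W B) >= 2 W B, where B is the
    indicator of a remote half-line. Invariance then forces pi(W B) = 0,
    although W > 0 and [pi] charges that half-line. *)
Lemma no_tight_supersolution : False.
Proof.
have [r Gr] := G_coercive (phi + (ln (2 / p1)) / s).
pose r1 := Num.max r 0; pose B x : R := (r1 < x)%R%:R.
have bB : bmeas B by apply: bmeas_bool; apply: measurable_fun_ltr.
have bWB : bmeas (fun x => W x * B x) by exact: bmeasM.
have WBgt : 0 < \int[pi]_x (W x * B x).
  apply: (@Rint_gt0 (fun x => r1 < x)) => //.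
  - exact: measurable_fun_ltr.
  - by move=> x; rewrite mulr_ge0.
  - by move=> x; rewrite /B => ->; rewrite mulr1; have /andP[] := W_bound x.
  - exact: (stationary_unbounded d1_gt0 p1_gt0 nu_up).
(* In key, w + w ^ 2 / (2 tau) + tau / 2 >= 0 for w = W (step x y) - q replaces W
   by its mean q at the price of the variance, with total error tau / 2. *)
pose tau := \int[pi]_x (W x * B x).
have key x : 2 * (W x * B x) - tau / 2 - (qvar x / (2 * tau)) <=
    Q nu (fun z => W z * B z) x.
  have tau2 : 0 < 2 * tau by rewrite mulr_gt0.
  have qv : 0 <= qvar x / (2 * tau) by rewrite divr_ge0 ?qvar_ge0// ltW.
  have QWB : 0 <= Q nu (fun z => W z * B z) x.
    by apply: Q_ge0 => z; rewrite mulr_ge0 ?ler0n.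
  have [xr|xr] := leP x r1.
    have -> : B x = 0 by rewrite /B ltNge xr.
    by have := WBgt; rewrite -/tau; lra.
  have -> : B x = 1 by rewrite /B xr.
  move: (xr); rewrite gt_max => /andP[xr0 x0].
  set q := Q nu W x.
  have q0 : 0 <= q by have /andP[] := QW_bound x.
  (* The choice of r makes exp(s (G - phi)) at least 2 / p1 beyond r. *)
  have qW : 2 * W x <= q * p1.
    rewrite /q W_tight// mulrAC ler_wpM2r// -ler_pdivrMr//.
    rewrite -[leLHS]lnK ?posrE ?divr_gt0// ler_expR.
    have := Gr _ xr0; rewrite -lerBrDl ler_pdivrMr// [leRHS]mulrC; exact.
  apply: (@le_trans _ _ (q * Q nu B x - tau / 2 - qvar x / (2 * tau))).
    have xd : r1 < x + d1 by rewrite (lt_trans xr)// ltrDl.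
    by have := ler_wpM2l q0 (Q_up nu_up xd); rewrite -/B; lra.
  have bd : bmeas (fun y => W (step x y) - q).
    by apply: bmeasB; [exact: (bmeas_step x bW)|exact: bmeas_cst].
  have bs := bmeas_step x bB.
  have bd2 : bmeas (fun y => (2 * tau)^-1 * (W (step x y) - q) ^+ 2).
    by apply: bmeasZ; exact: bmeasX.
  have bqB : bmeas (fun y => q * B (step x y) - tau / 2).
    by apply: bmeasB; [exact: bmeasZ|exact: bmeas_cst].
  have -> : q * Q nu B x - tau / 2 - qvar x / (2 * tau) =
      \int[nu]_y (q * B (step x y) - tau / 2 - (2 * tau)^-1 * (W (step x y) - q) ^+ 2).
    rewrite RintB// RintB; [|exact: bmeasZ|exact: bmeas_cst].
    rewrite (RintZ nu q bs) (RintZ nu (2 * tau)^-1 (bmeasX 2 bd)).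
    by rewrite Rint_cst qvarE (mulrC (qvar x)).
  apply: Rint_le => [||y]; [exact: bmeasB|exact: (bmeas_step x bWB)|].
  set w := W _ - q.
  have w2 : 0 <= (2 * tau)^-1 * w ^+ 2 by rewrite mulr_ge0 ?sqr_ge0// invr_ge0 ltW.
  rewrite /B; case: (r1 < step x y) => /=; last by have := WBgt; rewrite -/tau; lra.
  have : 0 <= (2 * tau)^-1 * (w + tau) ^+ 2.
    by rewrite mulr_ge0 ?sqr_ge0// invr_ge0 ltW.
  have -> : (2 * tau)^-1 * (w + tau) ^+ 2 = (2 * tau)^-1 * w ^+ 2 + w + tau / 2.
    by field; rewrite gt_eqF.
  by rewrite /w; lra.
have : 2 * tau - tau / 2 - (\int[pi]_x qvar x) / (2 * tau) <= tau.
  have bq : bmeas (fun x => qvar x / (2 * tau)) by apply: bmeasM => //; exact: bmeas_cst.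
  have b2 : bmeas (fun x => 2 * (W x * B x) - tau / 2).
    by apply: bmeasB; [exact: bmeasZ|exact: bmeas_cst].
  have : \int[pi]_x (2 * (W x * B x) - tau / 2 - (qvar x / (2 * tau))) <= tau.
    rewrite -[leRHS](pi_inv bWB).
    by apply: Rint_le => //; [exact: bmeasB|exact: bmeas_Q].
  rewrite RintB// RintB; [|exact: bmeasZ|exact: bmeas_cst].
  rewrite RintZ// Rint_cst.
  by rewrite (RintegralZr _ measurableT (bmeas_integrable pi bqvar)).
have : (\int[pi]_x qvar x) / (2 * tau) <= 0.
  by rewrite mulr_le0_ge0// ?qvar_mean// invr_ge0 mulr_ge0// ltW.
have : 0 < tau by [].
lra.
Qed.

End rigidity.
End stationarity.

(** * Drift and expanding solutions *)

Section drift.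
Context (R : realType) (nu : probability R R).
Variables (d p : R).
Hypotheses (d_gt0 : 0 < d) (p_gt0 : 0 < p).
Hypothesis nu_down : p <= \int[nu]_y (y <= - d)%R%:R.
Variables (v : R -> R) (B : R).
Hypotheses (mv : measurable_fun setT v) (v_ge0 : forall x, 0 <= v x).
Hypothesis v_int : forall x, nu.-integrable setT (EFin \o (fun y => v (step x y))).
Hypothesis v_drift : forall x, 0 <= x -> \int[nu]_y v (step x y) <= v x - x + B.

(** The constant B is absorbed by the bounded drift function on (0, r], and by
    half of the drift - x beyond r. *)
Lemma strong_drift : exists u : R -> R, [/\ measurable_fun setT u,
  (forall x, 0 <= u x),
  (forall x, nu.-integrable setT (EFin \o (fun y => u (step x y)))) &
  (forall x : R, 0 < x -> \int[nu]_y u (step x y) <= u x - (1 + x) / 2)].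
Proof.
pose r := 1 + 2 * `|B|.
have r0 : 0 < r by rewrite /r; have := normr_ge0 B; lra.
have [L [w [bw wL _ wr wdrift]]] := bounded_drift d_gt0 p_gt0 nu_down r0.
pose C := 1 + `|B|.
have C0 : 0 <= C by rewrite /C; have := normr_ge0 B; lra.
have BB := ler_norm B.
have wi x : nu.-integrable setT (EFin \o (fun y => C * w (step x y))).
  by apply: rintegrableZ; apply: bmeas_integrable; exact: bmeas_step.
exists (fun x => v x + C * w x); split.
- by apply: measurable_funD => //; apply: measurable_funM => //; exact: bw.1.
- by move=> x; have /andP[? ?] := wL x; rewrite addr_ge0// mulr_ge0.
- by move=> x; exact: rintegrableD.
move=> x x0; rewrite RintegralD// RintZ; last exact: bmeas_step.
have vd := v_drift (ltW x0); rewrite -/(Q nu w x).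
have [xr|rx] := leP x r.
  by have := ler_wpM2l C0 (wdrift _ x0 xr); rewrite /C in C0 *; lra.
have /andP[_ QwL] := Q_bound nu bw wL x.
by have := ler_wpM2l C0 QwL; rewrite (wr _ rx); rewrite /r in rx; lra.
Qed.

Variables (G : R -> R) (phi B3 : R).
Hypothesis G_le : forall x : R, 0 < x -> G x - phi <= B3 * (1 + x).

(** The positive part of 1 - s C u. To first order in s one step costs s (G - phi)
    + lam, which is at most s C (1 + x) / 2, a lower bound for the mean
    decrease of s C u. *)
Lemma subsolution : exists u : R -> R, (forall x, 0 <= u x) /\
  forall s lam : R, 0 <= s -> lam <= s -> exists Z : R -> R,
  [/\ bmeas Z, (forall x, Z x <= 1), (forall x, 1 - s * u x <= Z x) &
    (forall x : R, 0 < x -> Z x <= expR (s * (phi - G x) - lam) * Q nu Z x)].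
Proof.
have [u [mu u0 ui udrift]] := strong_drift.
pose C := 2 * (`|B3| + 1).
have C0 : 0 <= C by rewrite /C; have := normr_ge0 B3; lra.
exists (fun x => C * u x); split=> [x|s lam s0 ls]; first by rewrite mulr_ge0.
have sC0 : 0 <= s * C by rewrite mulr_ge0.
have bZ : bmeas (fun x => Num.max 0 (1 - s * (C * u x))).
  apply: (@bmeas_between _ _ _ 0 1).
    apply: measurable_maxr => //; apply: measurable_funB => //.
    by apply: measurable_funM => //; apply: measurable_funM.
  move=> x; rewrite le_max lexx/= ge_max ler01/=.
  by have := mulr_ge0 sC0 (u0 x); lra.
have Z01 x : 0 <= Num.max 0 (1 - s * (C * u x)) <= 1.
  rewrite le_max lexx/= ge_max ler01/=.
  by have := mulr_ge0 sC0 (u0 x); lra.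
exists (fun x => Num.max 0 (1 - s * (C * u x))); split => //.
- by move=> x; have /andP[] := Z01 x.
- by move=> x; rewrite le_max lexx orbT.
move=> x x0.
set q := Q nu _ x.
have /andP[q0 q1] : 0 <= q <= 1 by exact: Q_bound.
rewrite ge_max mulr_ge0 ?expR_ge0//=.
have qd : 1 - s * (C * u x) + s * (C * ((1 + x) / 2)) <= q.
  have i1 : nu.-integrable setT (EFin \o (fun y => s * C * u (step x y))).
    exact: rintegrableZ.
  apply: (@le_trans _ _ (\int[nu]_y (1 - s * C * u (step x y)))).
    rewrite RintegralB//; last exact: rintegrable_cst.
    rewrite Rint_cst RintegralZl//.
    by have := ler_wpM2l sC0 (udrift _ x0); lra.
  apply: le_Rintegral => //.
  - by apply: rintegrableB => //; exact: rintegrable_cst.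
  - by apply: bmeas_integrable; exact: (bmeas_step x bZ).
  - by move=> y _; rewrite -mulrA le_max lexx orbT.
pose t := s * (G x - phi) + lam.
have ex : s * (phi - G x) - lam = - t by rewrite /t; ring.
have tle : t <= s * (C * ((1 + x) / 2)).
  have h1 : G x - phi <= `|B3| * (1 + x).
    by rewrite (le_trans (G_le x0))// ler_wpM2r ?ler_norm//; lra.
  have := ler_wpM2l s0 h1; have := ler_wpM2l s0 (ltW x0).
  by rewrite /t /C; lra.
rewrite ex.
have [t0|t0] := leP t 0.
  rewrite (@le_trans _ _ q)//.
    have : 0 <= s * (C * ((1 + x) / 2)) by rewrite !mulr_ge0//; lra.
    lra.
  by rewrite ler_peMl// -expR0 ler_expR oppr_ge0.
apply: (@le_trans _ _ ((1 - t) * q)); last first.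
  by rewrite ler_wpM2r//; have := expR_ge1Dx (- t).
have : t * q <= t * 1 by rewrite ler_wpM2l// ltW.
lra.
Qed.

End drift.

Section expanding.
Context (R : realType) (nu pi : probability R R).
Hypothesis pi_inv : forall f, bmeas f -> \int[pi]_x Q nu f x = \int[pi]_x f x.

(** By invariance the integral of (exp(s g) - 1) W is at most 0, and exp(s g) - 1
    >= s min(g, m). Divide by s, let s tend to 0, where W tends to 1 between
    its two bounds, and then let m tend to infinity. *)
Lemma no_expanding_solutions (g u : R -> R) (C K : R) (s : nat -> R)
    (W : nat -> R -> R) :
  measurable_fun setT g -> pi.-integrable setT (EFin \o g) ->
  (forall x, - K <= g x) -> 0 <= C ->
  (forall n, 0 < s n) -> (forall n, s n * C <= 1) ->
  s n @[n --> \oo] --> (0 : R) ->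
  (forall n, bmeas (W n)) -> (forall n x, 0 <= W n x <= 1 + s n * C) ->
  (forall n x, 1 - s n * u x <= W n x) ->
  (forall n x, expR (s n * g x) * W n x <= Q nu (W n) x) ->
  \int[pi]_x g x <= 0.
Proof.
move=> mg ig gK C0 s0 sC scv bW WC Wu WQ.
have W2 n x : 0 <= W n x <= 2.
  have /andP[-> h]/= := WC n x; rewrite (le_trans h)//; have := sC n; lra.
have Wcv x : W n x @[n --> \oo] --> (1 : R).
  apply: (@squeeze_cvgr _ _ _ _ (fun n => 1 - s n * u x) (fun n => 1 + s n * C)).
  - by apply: nearW => n; rewrite Wu/=; have /andP[] := WC n x.
  - rewrite -[X in _ --> X]subr0 -(mul0r (u x)).
    by apply: cvgB; [exact: cvg_cst|exact: cvgMl].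
  - rewrite -[X in _ --> X]addr0 -(mul0r C).
    by apply: cvgD; [exact: cvg_cst|exact: cvgMl].
have K0 : 0 <= `|K| by [].
pose gM (m : nat) x := Num.min (g x) m%:R.
have mgM m : measurable_fun setT (gM m) by exact: measurable_minr.
have gM_bound m x : - `|K| <= gM m x <= m%:R.
  rewrite le_min ge_min lexx orbT andbT; apply/andP; split.
    by rewrite (le_trans _ (gK x))// lerN2 ler_norm.
  by rewrite (le_trans _ (ler0n _ _))// oppr_le0.
have bgM m : bmeas (gM m) by apply: (bmeas_between (mgM m) (gM_bound m)).
have gMW m n : \int[pi]_x (gM m x * W n x) <= 0.
  have bgW : bmeas (fun x => gM m x * W n x) by exact: bmeasM.
  have : \int[pi]_x (s n * (gM m x * W n x)) <= \int[pi]_x (Q nu (W n) x - W n x).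
    apply: Rint_le => [||x]; [exact: bmeasZ|apply: bmeasB => //; exact: bmeas_Q|].
    have /andP[W0 _] := W2 n x; rewrite lerBrDr (le_trans _ (WQ n x))//.
    have h1 : 1 + s n * gM m x <= expR (s n * g x).
      apply: le_trans (expR_ge1Dx _); rewrite lerD2l ler_pM2l//.
      by rewrite ge_min lexx.
    by have := ler_wpM2r W0 h1; lra.
  rewrite RintB ?pi_inv ?subrr//; last exact: bmeas_Q.
  by rewrite RintZ// pmulr_rle0.
have gM_le0 m : \int[pi]_x gM m x <= 0.
  have cv : \int[pi]_x (gM m x * W n x) @[n --> \oo] --> \int[pi]_x gM m x.
    apply: (@Rint_cvg _ _ _ _ _ _ ((`|K| + m%:R) * 2)) => [n|n x|x].
    - by apply: measurable_funM => //; exact: (bW n).1.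
    - rewrite normrM ler_pM//.
        have /andP[h1 h2] := gM_bound m x; rewrite ler_norml; apply/andP; split.
          by have := ler0n R m; lra.
        lra.
      by have /andP[h1 h2] := W2 n x; rewrite ger0_norm.
    - by rewrite -[X in _ --> X]mulr1; apply: cvgMr.
  rewrite -(cvg_lim _ cv)//; apply: limr_le; first by apply/cvg_ex; eexists; exact: cv.
  exact: nearW.
have cv : \int[pi]_x gM m x @[m --> \oo] --> \int[pi]_x g x.
  apply: (Rint_cvg_dom mgM (integrable_norm ig)) => [m x|x] /=.
    rewrite /gM; case: (leP (g x) m%:R) => // gm.
    by rewrite normr_nat (le_trans (ltW gm))// ler_norm.
  apply: cvg_near_cst; near=> m; rewrite /gM min_l//.
  by near: m; exact: nbhs_infty_ger.
rewrite -(cvg_lim _ cv)//; apply: limr_le; first by apply/cvg_ex; eexists; exact: cv.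
exact: nearW.
Unshelve. all: by end_near. Qed.

End expanding.

(** * The rate function *)

Section attainable_rates.
Context (R : realType) (nu : probability R R).
Variable G : R -> R.
Hypotheses (mG : measurable_fun setT G) (G_neg : forall x : R, x <= 0 -> G x = G 0).
Implicit Types (c j z : R).

Local Notation bridge := (bridge nu G).

(** The decay rate j at mean cost c is realised by excursions of some fixed
    length. Only one length is required: repeating the excursion gives all its
    multiples. *)
Definition attainable c j : Prop :=
  exists2 k : nat, (0 < k)%N & expR (- (j * k%:R)) <= bridge k (0, c * k%:R).

Lemma attainable_ge0 c j : attainable c j -> 0 <= j.
Proof.
move=> [k k0 h]; have /andP[_ b1] := bridge_bound nu mG k (0, c * k%:R).
have := le_trans h b1; rewrite -[leRHS]expR0 ler_expR oppr_le0.
by rewrite pmulr_lge0// ltr0n.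
Qed.

Lemma attainable_homo c c' j j' : c <= c' -> j <= j' ->
  attainable c j -> attainable c' j'.
Proof.
move=> cc' jj' [k k0 h]; exists k => //.
apply: (@le_trans _ _ (expR (- (j * k%:R)))).
  by rewrite ler_expR lerN2 ler_wpM2r.
by rewrite (le_trans h)// bridge_homo// ler_wpM2r.
Qed.

Lemma bridge_below_range (m : R) n x b : (forall x, m <= G x) -> b < m * n%:R ->
  bridge n (x, b) <= 0.
Proof.
move=> Gm; elim: n x b => [|n IHn] x b bm.
  by rewrite mulr0 in bm; rewrite lern0 /= andbC leNgt bm.
rewrite -(Rint_cst nu 0); apply: Rint_le => [||y]; [|exact: bmeas_cst|].
  exact: (bmeas_budget_fiber mG (x, b) (bmeas_bridge nu mG n)).
apply: IHn => /=; move: bm; rewrite -natr1; have := Gm x; lra.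
Qed.

Lemma attainable_low (m : R) c j : (forall x, m <= G x) -> attainable c j -> m <= c.
Proof.
move=> Gm [k k0 h]; rewrite leNgt; apply/negP => cm.
have := bridge_below_range (n := k) 0 Gm (_ : c * k%:R < _).
rewrite ltr_pM2r ?ltr0n// => /(_ cm) /(le_trans h).
by rewrite leNgt expR_gt0.
Qed.

Lemma bridge_exp k q y : bridge k (0, y) ^+ q <= bridge (k * q) (0, y * q%:R).
Proof.
elim: q => [|q IHq]; first by rewrite muln0 mulr0 expr0 /= lexx.
have -> : y * q.+1%:R = y + y * q%:R by rewrite -natr1; ring.
rewrite exprS mulnS; apply: le_trans (bridge_superadd nu mG G_neg _ _ _ _ _).
by apply: ler_wpM2l => //; have /andP[] := bridge_bound nu mG k (0, y).
Qed.

Let attainable_blocks c1 c2 j1 j2 k1 k2 q1 q2 :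
  expR (- (j1 * k1%:R)) <= bridge k1 (0, c1 * k1%:R) ->
  expR (- (j2 * k2%:R)) <= bridge k2 (0, c2 * k2%:R) ->
  expR (- (j1 * (k1 * q1)%:R + j2 * (k2 * q2)%:R)) <=
  bridge (k1 * q1 + k2 * q2) (0, c1 * (k1 * q1)%:R + c2 * (k2 * q2)%:R).
Proof.
move=> h1 h2.
have pw c j k q : expR (- (j * k%:R)) <= bridge k (0, c * k%:R) ->
    expR (- (j * (k * q)%:R)) <= bridge (k * q) (0, c * (k * q)%:R).
  move=> h; rewrite natrM !mulrA -mulNr expRM_natr.
  apply: le_trans (bridge_exp _ _ _).
  by apply: lerXn2r; rewrite ?nnegrE ?expR_ge0//;
    have /andP[] := bridge_bound nu mG k (0, c * k%:R).
rewrite opprD expRD; apply: le_trans (bridge_superadd nu mG G_neg _ _ _ _ _).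
by apply: ler_pM; rewrite ?expR_ge0//; exact: pw.
Qed.

Let attainable_convex_le c1 c2 j1 j2 (t e : R) : c1 <= c2 -> 0 <= t <= 1 -> 0 < e ->
  attainable c1 j1 -> attainable c2 j2 ->
  attainable (t * c1 + (1 - t) * c2) (t * j1 + (1 - t) * j2 + e).
Proof.
move=> c12 /andP[t0 t1] e0 [k1 k10 h1] [k2 k20 h2].
pose n := (Num.truncn ((`|j1| + `|j2|) / e)).+1.
have n0 : 0 < n%:R :> R by rewrite ltr0n.
have ne : `|j1| + `|j2| <= e * n%:R.
  by rewrite mulrC -ler_pdivrMr// ltW// truncnS_gt.
(* m / n is the proportion t rounded up, capped at 1. *)
pose m := minn (Num.truncn (t * n%:R)).+1 n.
have mn : (m <= n)%N by exact: geq_minr.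
have tm : t * n%:R <= m%:R.
  rewrite /m /minn; case: ifP => _; first by rewrite ltW// truncnS_gt.
  by rewrite ger_pMl.
have mt : m%:R <= t * n%:R + 1.
  apply: (@le_trans _ _ (Num.truncn (t * n%:R)).+1%:R).
    by rewrite ler_nat geq_minl.
  by rewrite -natr1 lerD2r truncn_le mulr_ge0.
pose w := m%:R / n%:R : R.
have tw : t <= w by rewrite ler_pdivlMr.
have wt : w <= t + n%:R^-1.
  by rewrite ler_pdivrMr// mulrDl mulVf ?gt_eqF.
(* The factors k1 and k2 give the two kinds of blocks total lengths in the exact
   ratio m : n - m. *)
have := attainable_blocks (m * k2) ((n - m) * k1) h1 h2.
pose k := (k1 * k2 * n)%N.
have k0 : (0 < k)%N by rewrite !muln_gt0 k10 k20.
have ek : (k1 * (m * k2) + k2 * ((n - m) * k1))%N = k.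
  by rewrite /k -[X in _ = (_ * X)%N](subnKC mn); ring.
have e1 : (k1 * (m * k2))%:R = w * k%:R :> R.
  by rewrite /w /k !natrM; field; rewrite gt_eqF.
have e2 : (k2 * ((n - m) * k1))%:R = (1 - w) * k%:R :> R.
  by rewrite /w /k !natrM natrB//; field; rewrite gt_eqF.
rewrite ek e1 e2 => hk.
have : attainable (c1 * w + c2 * (1 - w)) (j1 * w + j2 * (1 - w)).
  exists k => //; have ring2 (a b u K : R) :
    (a * u + b * (1 - u)) * K = a * (u * K) + b * ((1 - u) * K) by ring.
  by rewrite !ring2.
clearbody w.
apply: attainable_homo.
  have : (w - t) * (c2 - c1) >= 0 by rewrite mulr_ge0 ?subr_ge0.
  lra.
have h : (w - t) * (j1 - j2) <= n%:R^-1 * (e * n%:R).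
  apply: (@le_trans _ _ ((w - t) * (`|j1| + `|j2|))).
    rewrite ler_wpM2l ?subr_ge0// lerD ?ler_norm//.
    by rewrite (le_trans (ler_norm _))// normrN.
  by rewrite ler_pM ?subr_ge0 ?addr_ge0//; lra.
have hn : n%:R^-1 * (e * n%:R) = e by rewrite mulrC mulfK ?gt_eqF.
rewrite hn in h.
lra.
Qed.

(** Mix blocks of the two kinds. The proportion is rounded to a fraction with
    denominator n, upwards for the cheaper kind so that the mean cost does not
    exceed its target; the resulting error on the rate is at most e when n is
    large. *)
Lemma attainable_convex c1 c2 j1 j2 (t e : R) : 0 <= t <= 1 -> 0 < e ->
  attainable c1 j1 -> attainable c2 j2 ->
  attainable (t * c1 + (1 - t) * c2) (t * j1 + (1 - t) * j2 + e).
Proof.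
move=> t01 e0 A1 A2; have [c12|/ltW c21] := leP c1 c2.
  exact: attainable_convex_le.
have t01' : 0 <= 1 - t <= 1 by lra.
have := attainable_convex_le c21 t01' e0 A2 A1.
by rewrite opprB addrCA subrr addr0 (addrC (_ * c2)) (addrC (_ * j2)).
Qed.

(** A bridge of positive probability is itself an attainable pair, so a line below
    all attainable pairs bounds every bridge, without any asymptotics. *)
Lemma bridge_le_affine (l s : R) k y :
  (forall z j, attainable z j -> l - s * z <= j) -> (0 < k)%N ->
  bridge k (0, y) <= expR (s * y - l * k%:R).
Proof.
move=> ls k0; have [b0|b0] := leP (bridge k (0, y)) 0.
  exact: le_trans (expR_ge0 _).
have k0' : 0 < k%:R :> R by rewrite ltr0n.
rewrite -[leLHS]lnK ?posrE// ler_expR.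
have /ls : attainable (y / k%:R) (- ln (bridge k (0, y)) / k%:R).
  by exists k => //; rewrite !divfK ?gt_eqF// opprK lnK ?posrE.
rewrite ler_pdivlMr// mulrBl mulrA divfK ?gt_eqF//; lra.
Qed.

Definition rate c : \bar R := ereal_inf [set j%:E | j in attainable c].

Lemma rate_le c (y : R) : (rate c <= y%:E)%E <->
  forall e, 0 < e -> attainable c (y + e).
Proof.
split=> [ry e e0|h].
  have : (rate c < (y + e)%:E)%E by rewrite (le_lt_trans ry)// lte_fin ltrDl.
  move=> /ereal_inf_lt[_ [j Aj <-]]; rewrite lte_fin => je.
  by apply: attainable_homo Aj => //; exact: ltW.
apply/lee_addgt0Pr => e e0; apply: ereal_inf_lbound.
by exists (y + e) => //; exact: h.
Qed.

Lemma rate_convex : econvex rate.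
Proof.
move=> [c1 y1] [c2 y2] t; rewrite !inE /= => /rate_le h1 /rate_le h2.
apply/rate_le => e e0; have e2 : 0 < e / 2 by rewrite divr_gt0.
have t01 : 0 <= t%:num <= 1 by apply/andP.
have := attainable_convex t01 e2 (h1 _ e2) (h2 _ e2).
by apply: attainable_homo => //=; rewrite /GRing.scale /= /unstable.onem; lra.
Qed.

End attainable_rates.

(** * Logarithmic asymptotics *)

Section log_scale.
Context (R : realType).

(** The exponential rate is stated with explicit bounds rather than with
    logarithms: this form passes directly through sums and comparisons. *)
Definition exp_rate (J : R) (r : nat -> R) : Prop :=
  forall dl : R, 0 < dl -> \forall n \near \oo,
    expR (- ((J + dl) * n%:R)) <= r n /\ r n <= expR (- ((J - dl) * n%:R)).

Lemma expR_beats_square (C dl : R) : 0 < dl ->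
  \forall n \near \oo, C * n.+1%:R ^+ 2 <= expR (dl * n%:R).
Proof.
(* exp(e n) >= e (n + 1) when e <= 1; the cube of this beats the square once e ^
   3 n >= C. *)
move=> dl0; pose e := Num.min (dl / 3) 1.
have e0 : 0 < e by rewrite lt_min ltr01 andbT divr_gt0.
have e1 : e <= 1 by rewrite ge_min lexx orbT.
have ed : e * 3 <= dl by rewrite -ler_pdivlMr// ge_min lexx.
near=> n.
have nC : C / e ^+ 3 <= n.+1%:R.
  rewrite (@le_trans _ _ n%:R)//; last by rewrite ler_nat.
  by near: n; exact: nbhs_infty_ger.
rewrite ler_pdivrMr ?exprn_gt0// in nC.
have h1 : e * n.+1%:R <= expR (e * n%:R).
  by apply: le_trans (expR_ge1Dx _); rewrite -natr1 mulrDr mulr1; lra.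
have h3 : (e * n.+1%:R) ^+ 3 <= expR (dl * n%:R).
  apply: (@le_trans _ _ (expR (e * n%:R) ^+ 3)).
    by rewrite lerXn2r ?nnegrE ?expR_ge0// mulr_ge0// ltW.
  by rewrite -expRM_natr ler_expR mulrAC ler_wpM2r.
apply: le_trans h3.
have -> : (e * n.+1%:R) ^+ 3 = n.+1%:R * e ^+ 3 * n.+1%:R ^+ 2 by ring.
by apply: ler_wpM2r => //; exact: sqr_ge0.
Unshelve. all: by end_near. Qed.

Lemma exp_rate_lne (J : R) (r : nat -> R) (q : nat -> \bar R) :
  (forall n, (0 < n)%N -> q n = (r n)%:E) -> exp_rate J r ->
  ((n%:R^-1)%:E * lne (q n) @[n --> \oo] --> - J%:E)%E.
Proof.
move=> qr hJ; rewrite -EFinN.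
have cv : n%:R^-1 * ln (r n) @[n --> \oo] --> - J.
  apply/cvgrPdist_le => dl dl0.
  have := hJ _ dl0; apply: filterS2 (nbhs_infty_gt 0) => n n0 [lo up].
  have n0' : 0 < n%:R :> R by rewrite ltr0n.
  have r0 : 0 < r n by rewrite (lt_le_trans _ lo)// expR_gt0.
  have llo : - ((J + dl) * n%:R) <= ln (r n).
    by rewrite -[leLHS]expRK ler_ln ?posrE ?expR_gt0.
  have lup : ln (r n) <= - ((J - dl) * n%:R).
    by rewrite -[leRHS]expRK ler_ln ?posrE ?expR_gt0.
  have e : n%:R^-1 * ln (r n) = ln (r n) / n%:R by rewrite mulrC.
  rewrite e distrC ler_distl; apply/andP; split.
    by rewrite ler_pdivlMr//; lra.
  by rewrite ler_pdivrMr//; lra.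
have qE : \forall n \near \oo,
    ((n%:R^-1)%:E * lne (q n))%E = (n%:R^-1 * ln (r n))%:E.
  near=> n.
  have n0 : (0 < n)%N by near: n; exact: nbhs_infty_gt.
  have [lo _] : expR (- ((J + 1) * n%:R)) <= r n /\
      r n <= expR (- ((J - 1) * n%:R)) by near: n; exact: hJ.
  by rewrite qr// lne_EFin// (lt_le_trans _ lo)// expR_gt0.
apply: cvg_EFin; first by apply: filterS qE => n ->.
apply: cvg_trans cv; apply: near_eq_cvg.
by apply: filterS qE => n /= ->.
Unshelve. all: by end_near. Qed.

Lemma exp_rate_union (J1 J2 : R) (r1 r2 r : nat -> R) :
  exp_rate J1 r1 -> exp_rate J2 r2 ->
  (forall n, (0 < n)%N -> [/\ r1 n <= r n, r2 n <= r n & r n <= r1 n + r2 n]) ->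
  exp_rate (Num.min J1 J2) r.
Proof.
move=> h1 h2 hr dl dl0; have dl2 : 0 < dl / 2 by rewrite divr_gt0.
have b2 := expR_beats_square 2 dl2.
near=> n.
have n0 : (0 < n)%N by near: n; exact: nbhs_infty_gt.
have [l1 _] : expR (- ((J1 + dl) * n%:R)) <= r1 n /\ r1 n <= expR (- ((J1 - dl) * n%:R)).
  by near: n; exact: h1.
have [l2 _] : expR (- ((J2 + dl) * n%:R)) <= r2 n /\ r2 n <= expR (- ((J2 - dl) * n%:R)).
  by near: n; exact: h2.
have [_ u1] : expR (- ((J1 + dl / 2) * n%:R)) <= r1 n /\
    r1 n <= expR (- ((J1 - dl / 2) * n%:R)).
  by near: n; exact: h1.
have [_ u2] : expR (- ((J2 + dl / 2) * n%:R)) <= r2 n /\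
    r2 n <= expR (- ((J2 - dl / 2) * n%:R)).
  by near: n; exact: h2.
have e2 : 2 * n.+1%:R ^+ 2 <= expR (dl / 2 * n%:R) by near: n; exact: b2.
have [a1 a2 a3] := hr n n0.
set m := Num.min J1 J2.
have m1 : m <= J1 by rewrite ge_min lexx.
have m2 : m <= J2 by rewrite ge_min lexx orbT.
split.
  rewrite /m; case: (leP J1 J2) => _; first exact: le_trans a1.
  exact: le_trans a2.
have v J : m <= J -> expR (- ((J - dl / 2) * n%:R)) <= expR (- ((m - dl / 2) * n%:R)).
  by move=> mJ; rewrite ler_expR lerN2 ler_wpM2r// lerD2r.
apply: (@le_trans _ _ (2 * expR (- ((m - dl / 2) * n%:R)))).
  by have := v _ m1; have := v _ m2; lra.
have two : 2 <= expR (dl / 2 * n%:R).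
  rewrite (le_trans _ e2)// ler_peMr// exprn_ege1// ler1n.
  by [].
apply: (le_trans (ler_wpM2r (expR_ge0 _) two)).
by rewrite -expRD ler_expR; lra.
Unshelve. all: by end_near. Qed.

End log_scale.

(** * Solutions and growth of the tilted kernel *)

Section tilted_solutions.
Context (R : realType) (nu : probability R R).
Variables (d p : R).
Hypotheses (d_gt0 : 0 < d) (p_gt0 : 0 < p).
Hypothesis nu_down : p <= \int[nu]_y (y <= - d)%R%:R.
Variables (G : R -> R) (a B phi : R).
Hypotheses (mG : measurable_fun setT G) (G_neg : forall x : R, x <= 0 -> G x = G 0).
Hypotheses (a_gt0 : 0 < a) (G_lin : forall x, 0 <= x -> `|G x - a * x| <= B).

Lemma G_lower x : - B <= G x.
Proof.
have h x' : 0 <= x' -> - B <= G x'.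
  move=> x0; have := G_lin x0; rewrite ler_norml => /andP[h _].
  by have := mulr_ge0 (ltW a_gt0) x0; lra.
by have [x0|/ltW/h//] := leP x 0; rewrite G_neg// h.
Qed.

Lemma G_kap x : phi - G x <= phi + B.
Proof. by have := G_lower x; lra. Qed.

Lemma G_upper (X x : R) : 0 <= X -> x <= X -> G x <= a * X + B.
Proof.
have h x' : 0 <= x' -> x' <= X -> G x' <= a * X + B.
  move=> x0 xX; have := G_lin x0; rewrite ler_norml => /andP[_ h].
  by have := ler_wpM2l (ltW a_gt0) xX; lra.
by move=> X0 xX; have [x0|/ltW x0] := leP x 0; [rewrite G_neg// h|exact: h].
Qed.

Lemma G_coercive (M : R) : exists r : R, forall x, r < x -> M <= G x.
Proof.
exists (Num.max 0 ((M + B) / a)) => x; rewrite gt_max ltr_pdivrMr// => /andP[x0 xM].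
by have := G_lin (ltW x0); rewrite ler_norml => /andP[h _]; lra.
Qed.

Definition solves (s lam : R) (W : R -> R) : Prop :=
  [/\ bmeas W, (forall x : R, x <= 0 -> W x = 1) &
      forall x : R, 0 < x -> W x = expR (s * (phi - G x) - lam) * Q nu W x].

(** The factor exp(- lam) only helps, so a supersolution for lam = 0 bounds the
    iteration for every lam >= 0. *)
Lemma solution_exists (s lam : R) (U : R -> R) : 0 <= s -> 0 <= lam -> bmeas U ->
  (forall x : R, x <= 0 -> U x = 1) -> (forall x, 1 <= U x) ->
  (forall x : R, 0 < x -> tilted nu G phi s U x <= U x) ->
  exists W : R -> R, [/\ solves s lam W, (forall x, 0 <= W x <= U x) &
    forall Z, bmeas Z -> (forall x, Z x <= U x) ->
      (forall x : R, x <= 0 -> Z x <= 1) ->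
      (forall x : R, 0 < x -> Z x <= expR (s * (phi - G x) - lam) * Q nu Z x) ->
      forall x, Z x <= W x].
Proof.
move=> s0 lam0 bU U_atom U1 U_super.
have U0 x : 0 <= U x by rewrite (le_trans ler01).
have [|x|x x0|W [bW WU Wa We Wm]] := @maximal_solution R nu
  (fun x => expR (s * (phi - G x) - lam)) U _ _ bU U0 U_atom _.
- exact: (bmeas_tilt mG G_kap s0).
- exact: expR_ge0.
- apply: le_trans (U_super _ x0); rewrite /tilted ler_wpM2r ?Q_ge0//.
  by rewrite ler_expR lerBlDr lerDl.
by exists W; split.
Qed.

(** The atom, where W = 1, is reached from any height by finitely many steps of
    size at least d, along which the tilt is bounded below. *)
Lemma solves_gt0 (s lam : R) W : 0 <= s -> solves s lam W ->
  (forall x, 0 <= W x) -> forall x, 0 < W x.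
Proof.
move=> s0 [bW Wa We] W0.
have key j : exists2 rho : R, 0 < rho & forall x, x <= j%:R * d -> rho <= W x.
  elim: j => [|j [rho rho0 IHj]].
    by exists 1 => // x; rewrite mul0r => x0; rewrite Wa.
  pose X := j.+1%:R * d; pose K := expR (s * (phi - (a * X + B)) - lam).
  have X0 : 0 <= X by rewrite mulr_ge0// ltW.
  have K0 : 0 < K by exact: expR_gt0.
  exists (Num.min 1 (K * (p * rho))).
    by rewrite lt_min ltr01 mulr_gt0// mulr_gt0.
  move=> x xX; have [x0|x0] := leP x 0; first by rewrite Wa// ge_min lexx.
  rewrite ge_min; apply/orP; right; rewrite We//.
  have pr0 : 0 <= p * rho by rewrite mulr_ge0// ltW.
  apply: ler_pM => //; first exact: ltW.
    rewrite ler_expR lerD2r ler_wpM2l// lerD2l lerN2.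
    exact: G_upper.
  apply: (Q_down nu_down bW W0 (ltW rho0)) => y yd; apply: IHj.
  apply: (le_trans (step_down d_gt0 x yd)).
  rewrite ge_max mulr_ge0 ?(ltW d_gt0)// andbT.
  by move: xX; rewrite /X -natr1; lra.
move=> x; have [rho rho0 h] := key (Num.truncn (x / d)).+1.
by apply: (lt_le_trans rho0); apply: h; rewrite -ler_pdivrMr// ltW// truncnS_gt.
Qed.

Let tiltedE s lam W y : tilted nu G phi s W y =
  expR lam * (expR (s * (phi - G y) - lam) * Q nu W y).
Proof. by rewrite mulrA -expRD addrC subrK. Qed.

(** Off the atom the equation is exact. Hence a single inequality at the atom
    decides whether W is a supersolution or, in the opposite case, a
    subsolution of the tilted kernel on the whole line. *)
Lemma atom_supersolution (s lam : R) W : solves s lam W -> (forall x, 0 <= W x) ->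
  expR (s * (phi - G 0) - lam) * Q nu W 0 <= 1 ->
  forall x, tilted nu G phi s W x <= expR lam * W x.
Proof.
move=> [bW Wa We] W0 th x.
have h y : expR (s * (phi - G y) - lam) * Q nu W y <= W y ->
    tilted nu G phi s W y <= expR lam * W y.
  by move=> hy; rewrite (tiltedE _ lam) ler_wpM2l ?expR_ge0.
have [x0|x0] := leP x 0.
  rewrite tilted_neg// Wa// -(Wa 0)//; apply: h.
  by rewrite Wa.
by apply: h; rewrite -We.
Qed.

Lemma atom_subsolution (s lam : R) W : solves s lam W ->
  1 < expR (s * (phi - G 0) - lam) * Q nu W 0 ->
  forall x, expR lam * W x <= tilted nu G phi s W x.
Proof.
move=> [bW Wa We] th x.
have h y : W y <= expR (s * (phi - G y) - lam) * Q nu W y ->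
    expR lam * W y <= tilted nu G phi s W y.
  by move=> hy; rewrite (tiltedE _ lam) ler_wpM2l ?expR_ge0.
have [x0|x0] := leP x 0.
  by rewrite tilted_neg// Wa// -(Wa 0)//; apply: h; rewrite Wa// ltW.
by apply: h; rewrite -We.
Qed.

Lemma iter_supersolution (s mu : R) W n : 0 <= s -> bmeas W ->
  (forall x, tilted nu G phi s W x <= expR mu * W x) ->
  forall x, iter n (tilted nu G phi s) W x <= expR (mu * n%:R) * W x.
Proof.
move=> s0 bW h; elim: n => [|n IHn] x; first by rewrite mulr0 expR0 mul1r.
have bI := bmeas_iter_tilted nu mG G_kap s0 n bW.
rewrite iterS (le_trans (tilted_le nu G phi s bI (bmeasZ _ bW) IHn x))//.
rewrite /tilted QZ// mulrCA -/(tilted nu G phi s W x).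
by rewrite -natr1 mulrDr mulr1 expRD -mulrA ler_wpM2l ?expR_ge0.
Qed.

Lemma iter_subsolution (s mu : R) W n : 0 <= s -> bmeas W ->
  (forall x, expR mu * W x <= tilted nu G phi s W x) ->
  forall x, expR (mu * n%:R) * W x <= iter n (tilted nu G phi s) W x.
Proof.
move=> s0 bW h; elim: n => [|n IHn] x; first by rewrite mulr0 expR0 mul1r.
have bI := bmeas_iter_tilted nu mG G_kap s0 n bW.
rewrite iterS; apply: le_trans (tilted_le nu G phi s (bmeasZ _ bW) bI IHn x).
rewrite /tilted QZ// mulrCA -/(tilted nu G phi s W x).
by rewrite -natr1 mulrDr mulr1 expRD -mulrA ler_wpM2l ?expR_ge0.
Qed.

Lemma return_weight_le (s rho : R) : 0 <= s -> 0 <= rho ->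
  (forall k y, (0 < k)%N ->
    bridge nu G k (0, y) <= expR (k%:R * rho + s * (y - phi * k%:R))) ->
  exists2 C : R, 0 <= C & forall n j, (j <= n)%N ->
    return_weight nu G phi s j <= (1 + C * n%:R) * expR (rho * n%:R).
Proof.
move=> s0 rho0 hb.
(* kN j levels suffice at time j because phi - G <= kN. *)
pose kN := (Num.truncn `|phi + B|).+1.
have kNB : phi + B <= kN%:R by rewrite (le_trans (ler_norm _))// ltW// truncnS_gt.
exists (kN%:R * expR s); first by rewrite mulr_ge0 ?expR_ge0.
move=> n j jn.
have en : 1 <= expR (rho * n%:R) by rewrite -expR0 ler_expR mulr_ge0.
case: j jn => [|j] jn.
  rewrite /return_weight /= /atom lexx (le_trans en)// ler_peMl ?expR_ge0//.
  by rewrite lerDl !mulr_ge0 ?expR_ge0.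
have tN : 0 + (phi + B) * j.+1%:R <= (kN * j.+1)%:R by rewrite add0r natrM ler_wpM2r.
have := tilted_atom_layers nu mG s0 G_kap 0 tN.
rewrite mulr0 expR0 mul1r -/(return_weight nu G phi s j.+1) => /le_trans; apply.
apply: (@le_trans _ _ (1 + \sum_(l < kN * j.+1) (expR s * expR (rho * j.+1%:R)))).
  rewrite lerD2l; apply: ler_sum => l _.
  apply: (le_trans (ler_wpM2l (expR_ge0 _) (hb j.+1 _ isT))).
  by rewrite -!expRD ler_expR -(natr1 l); lra.
rewrite sumr_const card_ord -[X in 1 + X <= _]mulr_natr natrM.
have ej : expR (rho * j.+1%:R) <= expR (rho * n%:R).
  by rewrite ler_expR ler_wpM2l// ler_nat.
rewrite mulrDl mul1r; apply: lerD => //.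
have -> : kN%:R * expR s * n%:R * expR (rho * n%:R) =
  expR s * expR (rho * n%:R) * (kN%:R * n%:R) by ring.
apply: ler_pM; rewrite ?mulr_ge0 ?expR_ge0//.
  by rewrite ler_wpM2l ?expR_ge0.
by rewrite ler_wpM2l// ler_nat.
Qed.

(** One factor n comes from the number of levels in the layer decomposition of the
    return weights, the other from the last exit from the atom. *)
Lemma iter_one_growth (s rho : R) U : 0 <= s -> 0 <= rho -> bmeas U ->
  (forall x : R, x <= 0 -> U x = 1) -> (forall x, 1 <= U x <= 2) ->
  (forall x : R, 0 < x -> tilted nu G phi s U x <= U x) ->
  (forall k y, (0 < k)%N ->
    bridge nu G k (0, y) <= expR (k%:R * rho + s * (y - phi * k%:R))) ->
  exists2 C : R, 0 <= C & forall n x,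
    iter n (tilted nu G phi s) (fun=> 1) x <= C * n.+1%:R ^+ 2 * expR (rho * n%:R).
Proof.
move=> s0 rho0 bU U_atom U12 U_super hb.
have [C C0 hC] := return_weight_le s0 rho0 hb.
have U1 x : 1 <= U x by have /andP[] := U12 x.
have C1 : 0 <= tilted nu G phi s U 0.
  by apply: tilted_ge0 => y; rewrite (le_trans ler01).
set c1 := tilted nu G phi s U 0 in C1.
exists (2 * ((1 + c1) * (1 + C))); first by rewrite !mulr_ge0// addr_ge0.
move=> n x; set E := expR (rho * n%:R).
have E1 : 1 <= E by rewrite /E -expR0 ler_expR mulr_ge0.
have n0 : 0 <= n%:R :> R by [].
have Cn0 : 0 <= C * n%:R by rewrite mulr_ge0.
have M1 : 1 <= (1 + C * n%:R) * E.
  by rewrite (le_trans E1)// ler_peMl ?(le_trans ler01)// lerDl.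
have h := iter_tilted_one_le mG G_neg G_kap s0 bU U_atom U1 U_super x M1 (hC n).
apply: (le_trans h); rewrite -/c1.
have M0 : 0 <= (1 + C * n%:R) * E by rewrite (le_trans ler01).
have nc1 : 0 <= n%:R * c1 by rewrite mulr_ge0.
have /andP[_ U2] := U12 x.
apply: (@le_trans _ _ ((1 + n%:R * c1) * ((1 + C * n%:R) * E) * 2)).
  apply: ler_pM => //; first by rewrite addr_ge0// mulr_ge0.
    by rewrite (le_trans ler01).
  by rewrite [leRHS]mulrDl mul1r lerD2r.
have rg A' B' : A' * (B' * E) * 2 = A' * B' * 2 * E by ring.
rewrite rg; apply: ler_wpM2r; first exact: le_trans E1.
have q1 : 1 + n%:R * c1 <= (1 + c1) * n.+1%:R by rewrite -natr1; lra.
have q2 : 1 + C * n%:R <= (1 + C) * n.+1%:R by rewrite -natr1; lra.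
rewrite [leRHS](_ : _ = (1 + c1) * n.+1%:R * ((1 + C) * n.+1%:R) * 2); last by ring.
by apply: ler_wpM2r => //; apply: ler_pM => //; apply: addr_ge0.
Qed.

End tilted_solutions.

(** * Slopes of the rate function *)

Section slopes.
Context (R : realType) (nu pi : probability R R).
Hypothesis pi_inv : forall f, bmeas f -> \int[pi]_x Q nu f x = \int[pi]_x f x.
Variables (d p d1 p1 : R).
Hypotheses (d_gt0 : 0 < d) (p_gt0 : 0 < p).
Hypothesis nu_down : p <= \int[nu]_y (y <= - d)%R%:R.
Hypotheses (d1_gt0 : 0 < d1) (p1_gt0 : 0 < p1).
Hypothesis nu_up : p1 <= \int[nu]_y (d1 <= y)%R%:R.
Variables (G : R -> R) (a B phi : R).
Hypotheses (mG : measurable_fun setT G) (G_neg : forall x : R, x <= 0 -> G x = G 0).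
Hypotheses (a_gt0 : 0 < a) (G_lin : forall x, 0 <= x -> `|G x - a * x| <= B).
Hypothesis G_int : pi.-integrable setT (EFin \o G).
Hypothesis G_mean : \int[pi]_x G x = phi.

Let kap := G_kap phi G_neg a_gt0 G_lin.

(** Otherwise all attainable pairs lie above the line of slope - s through (phi,
    0), and the iterates of the tilted kernel grow polynomially. The solution
    W of K W = exp(lam) W off the atom is then a supersolution at the atom for
    every lam > 0, since exponential growth is excluded. As lam decreases to 0
    these solutions increase to a positive bounded W with K W <= W, and K W =
    W off the atom. *)
Lemma small_slope (s : R) U : 0 < s -> bmeas U ->
  (forall x : R, x <= 0 -> U x = 1) -> (forall x, 1 <= U x <= 2) ->
  (forall x : R, 0 < x -> tilted nu G phi s U x <= U x) ->
  exists z j : R, attainable nu G z j /\ j < s * (phi - z).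
Proof.
move=> s_gt0 bU U_atom U12 U_super; apply: contrapT => H.
have s0 := ltW s_gt0.
have Hs z j : attainable nu G z j -> s * phi - s * z <= j.
  move=> A; rewrite -mulrBr leNgt; apply/negP => js; apply: H.
  by exists z, j.
have hb k y : (0 < k)%N ->
    bridge nu G k (0, y) <= expR (k%:R * 0 + s * (y - phi * k%:R)).
  move=> k0; apply: (le_trans (bridge_le_affine y Hs k0)).
  by rewrite ler_expR; lra.
have [C C0 growth] := iter_one_growth mG G_neg a_gt0 G_lin s0 (lexx 0) bU U_atom
  U12 U_super hb.
pose lam (j : nat) : R := j.+1%:R^-1.
have lam0 j : 0 < lam j by rewrite invr_gt0.
have U1 x : 1 <= U x by have /andP[] := U12 x.
have /choice[W hW] j := solution_exists mG G_neg a_gt0 G_lin s0 (ltW (lam0 j)) bU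
  U_atom U1 U_super.
have W02 j x : 0 <= W j x <= 2.
  have [_ /(_ x)/andP[-> h] _] := hW j; rewrite (le_trans h)//.
  by have /andP[] := U12 x.
have W0 j x : 0 <= W j x by have /andP[] := W02 j x.
have Ws j : solves nu G phi s (lam j) (W j) by have [] := hW j.
have bW j : bmeas (W j) by have [] := Ws j.
have Wa j x : x <= 0 -> W j x = 1 by have [_ h _] := Ws j; exact: h.
(* Were this false, K^n W would grow like exp(lam n) at the atom, while W <= 2
   and K^n 1 grows polynomially. *)
have theta j : expR (s * (phi - G 0) - lam j) * Q nu (W j) 0 <= 1.
  rewrite leNgt; apply/negP => th.
  have grow n := iter_subsolution mG G_neg a_gt0 G_lin n s0 (bW j)
    (atom_subsolution G_neg (Ws j) th) 0.
  have [N _ /(_ N (leqnn N)) /=] := expR_beats_square (2 * C + 1) (lam0 j).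
  apply/negP; rewrite -ltNge; have := grow N; rewrite Wa// mulr1 => /le_lt_trans; apply.
  apply: (@le_lt_trans _ _ (2 * (C * N.+1%:R ^+ 2))).
    apply: (@le_trans _ _ (2 * iter N (tilted nu G phi s) (fun=> 1) 0)).
      rewrite -(iter_tiltedZ nu mG kap s0 N 2 0 (bmeas_cst R 1)).
      apply: (iter_tilted_le nu mG kap s0) => //.
        by apply: bmeasZ; exact: bmeas_cst.
      by move=> x; rewrite mulr1; have /andP[] := W02 j x.
    by rewrite ler_wpM2l// (le_trans (growth N 0))// mul0r expR0 mulr1.
  have : 0 < N.+1%:R ^+ 2 :> R by rewrite exprn_gt0.
  lra.
have Wsup j x := atom_supersolution G_neg (Ws j) (W0 j) (theta j) x.
have Wtight j x : 0 < x -> tilted nu G phi s (W j) x = expR (lam j) * W j x.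
  move=> x0; have [_ _ h] := Ws j; rewrite (h _ x0) mulrA -expRD.
  by rewrite addrC subrK.
have lam_noninc j : lam j.+1 <= lam j by rewrite lef_pV2 ?posrE// ler_nat.
(* A solution for lam j is a subsolution for the smaller lam j.+1, hence below
   the maximal solution. *)
have Wmono x : {homo W ^~ x : n m / (n <= m)%N >-> n <= m}.
  apply/nondecreasing_seqP => j; have [_ _ h] := hW j.+1; apply: h => //.
  - by move=> y; have [_ /(_ y)/andP[]] := hW j.
  - by move=> y y0; rewrite Wa.
  move=> y y0; have [_ _ /(_ y y0) e] := Ws j; rewrite {1}e.
  by rewrite ler_wpM2r ?Q_ge0// ler_expR lerD2l lerN2.
pose Wl x := limn (W ^~ x).
have Wcv x : W n x @[n --> \oo] --> Wl x.
  apply: nondecreasing_is_cvgn; first exact: Wmono.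
  by exists 2 => _ [n _ <-]; have /andP[] := W02 n x.
have WM n x : `|W n x| <= 2 by have /andP[? ?] := W02 n x; rewrite ger0_norm.
have bWl : bmeas Wl by apply: (bmeas_cvg (fun n => (bW n).1) WM Wcv).
have Wl_bound x : 0 < Wl x <= 2.
  have icv : cvgn (W ^~ x) by apply/cvg_ex; eexists; exact: Wcv.
  apply/andP; split; last first.
    by apply: limr_le => //; apply: nearW => n; have /andP[] := W02 n x.
  apply: (@lt_le_trans _ _ (W 0%N x)).
    exact: (solves_gt0 d_gt0 p_gt0 nu_down G_neg a_gt0 G_lin s0 (Ws 0%N) (W0 0%N)).
  by apply: limr_ge => //; apply: nearW => n; exact: Wmono.
have Qcv x : tilted nu G phi s (W n) x @[n --> \oo] --> tilted nu G phi s Wl x.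
  by apply: cvgMr; exact: (Q_cvg bW WM Wcv).
have Ecv x : expR (lam n) * W n x @[n --> \oo] --> Wl x.
  rewrite -[X in _ --> X]mul1r -(@expR0 R); apply: cvgM; last exact: Wcv.
  by apply: continuous_cvg; [exact: continuous_expR|exact: cvg_harmonic].
have inv x : Q nu Wl x = expR (s * (G x - phi)) * tilted nu G phi s Wl x.
  by rewrite /tilted mulrA -expRD -mulrDr addrA subrK subrr mulr0 expR0 mul1r.
apply: (no_tight_supersolution pi_inv d1_gt0 p1_gt0 nu_up s_gt0 mG G_int G_mean
  _ bWl Wl_bound).
- exact: (G_coercive a_gt0 G_lin).
- move=> x; rewrite inv ler_wpM2l ?expR_ge0//.
  apply: (ler_cvg_to (Qcv x) (Ecv x)); apply: nearW => n; exact: Wsup.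
- move=> x x0; rewrite inv; congr (_ * _).
  apply: (cvg_unique _ (Qcv x)) => //.
  suff -> : (fun n => tilted nu G phi s (W n) x) = fun n => expR (lam n) * W n x.
    exact: Ecv.
  by apply/funext => n; exact: Wtight.
Qed.

Variables (v : R -> R) (B2 : R).
Hypotheses (mv : measurable_fun setT v) (v_ge0 : forall x, 0 <= v x).
Hypothesis v_int : forall x, nu.-integrable setT (EFin \o (fun y => v (step x y))).
Hypothesis v_drift : forall x, 0 <= x -> \int[nu]_y v (step x y) <= v x - x + B2.

(** Take lam = s eta. If the maximal solution W is a supersolution at the atom for
    some s > 0, then Chernoff's inequality bounds the bridges exponentially.
    If it is a strict subsolution there along a sequence of slopes s tending
    to 0, then W, being squeezed between 1 - s u and 1 + s C, contradicts
    pi(G) = phi to first order. *)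
Lemma rate_positive (c : R) : c < phi -> exists2 be : R, 0 < be &
  forall j, attainable nu G c j -> be <= j.
Proof.
(* eta <= 1 ensures lam = s eta <= s, as the subsolution requires. *)
move=> c_phi; pose eta := Num.min 1 ((phi - c) / 2).
have eta0 : 0 < eta by rewrite lt_min ltr01/= divr_gt0// subr_gt0.
have eta1 : eta <= 1 by rewrite ge_min lexx.
have etac : eta * 2 <= phi - c by rewrite -ler_pdivlMr// ge_min lexx orbT.
have [s0 [C [s0_gt0 C0 s0C HU]]] :=
  bounded_supersolution kap d_gt0 p_gt0 nu_down a_gt0 G_lin.
have G_le x : 0 < x -> G x - phi <= (a + `|B| + `|phi|) * (1 + x).
  move=> x0; have := G_lin (ltW x0); rewrite ler_norml => /andP[_ h].
  have := ler_norm B; have := ler_norm (- phi); rewrite normrN.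
  have := a_gt0; have := mulr_ge0 (normr_ge0 B) (ltW x0); have := mulr_ge0 (normr_ge0 phi) (ltW x0).
  lra.
have [u [u0 Hu]] := subsolution d_gt0 p_gt0 nu_down mv v_ge0 v_int v_drift G_le.
pose s (n : nat) : R := s0 * n.+1%:R^-1.
have sn0 n : 0 < s n by rewrite mulr_gt0.
have sle n : s n <= s0 by rewrite ger_pMr// invf_le1 ?ler1n.
have sC n : s n * C <= 1 by rewrite (le_trans _ s0C)// ler_wpM2r.
have lam0 n : 0 <= s n * eta by rewrite mulr_ge0// ltW.
have ls n : s n * eta <= s n by rewrite ger_pMr.
have hW n : exists W : R -> R, [/\ solves nu G phi (s n) (s n * eta) W,
    (forall x, 0 <= W x <= 1 + s n * C) & forall x, 1 - s n * u x <= W x].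
  have sn : 0 <= s n <= s0 by rewrite ltW//=.
  have [U [bU Ua U1 Us]] := HU _ sn.
  have U1' x : 1 <= U x by have /andP[] := U1 x.
  have [W [Ws WU Wm]] := solution_exists mG G_neg a_gt0 G_lin (ltW (sn0 n)) (lam0 n)
    bU Ua U1' Us.
  have [Z [bZ Z1 Zu Zs]] := Hu _ _ (ltW (sn0 n)) (ls n).
  exists W; split=> // x.
    by have /andP[-> h]/= := WU x; rewrite (le_trans h)//; have /andP[] := U1 x.
  rewrite (le_trans (Zu x))//; apply: Wm => // y.
  by rewrite (le_trans (Z1 y)).
have /choice[W {}hW] := hW.
have [[n th]|nth] := pselect (exists n,
    expR (s n * (phi - G 0) - s n * eta) * Q nu (W n) 0 <= 1).
  have [Ws Wb _] := hW n.
  have W0 x : 0 <= W n x by have /andP[] := Wb x.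
  have [bW Wa _] := Ws.
  have sup := atom_supersolution G_neg Ws W0 th.
  exists (s n * (phi - c) / 2); first by rewrite divr_gt0// mulr_gt0// subr_gt0.
  move=> j [k k0 h].
  have h1 := bridge_chernoff nu mG (ltW (sn0 n)) kap k 0 (c * k%:R).
  have h2 : iter k (tilted nu G phi (s n)) (@atom R) 0 <= expR (s n * eta * k%:R).
    apply: (@le_trans _ _ (iter k (tilted nu G phi (s n)) (W n) 0)).
      apply: (iter_tilted_le nu mG kap (ltW (sn0 n))) => //; first exact: bmeas_atom.
      by move=> x; rewrite /atom; case: (leP x 0) => x0; [rewrite Wa ?lexx|exact: W0].
    have := iter_supersolution mG G_neg a_gt0 G_lin k (ltW (sn0 n)) bW sup 0.
    by rewrite Wa// mulr1.
  have := le_trans h (le_trans h1 (ler_wpM2l (expR_ge0 _) h2)).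
  rewrite -expRD ler_expR.
  have -> : s n * (c * k%:R - phi * k%:R) + s n * eta * k%:R =
    - (s n * (phi - c - eta) * k%:R) by ring.
  rewrite lerN2 ler_pM2r ?ltr0n// => /(le_trans _); apply.
  rewrite -mulrA ler_pM2l//; lra.
exfalso.
have th n : 1 < expR (s n * (phi - G 0) - s n * eta) * Q nu (W n) 0.
  by rewrite ltNge; apply/negP => h; apply: nth; exists n.
have gi : pi.-integrable setT (EFin \o (fun x => G x - (phi - eta))).
  by apply: rintegrableB => //; exact: rintegrable_cst.
have : \int[pi]_x (G x - (phi - eta)) <= 0.
  apply: (@no_expanding_solutions _ nu pi pi_inv _ u C (B + (phi - eta)) s W) => //.
  - exact: measurable_funB.
  - by move=> x; have := G_lower G_neg a_gt0 G_lin x; lra.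
  - by rewrite -(mulr0 s0); apply: cvgMr; exact: cvg_harmonic.
  - by move=> n; have [[]] := hW n.
  - by move=> n x; have [_ h _] := hW n.
  - by move=> n x; have [_ _ h] := hW n.
  move=> n x; have [Ws _ _] := hW n.
  have := atom_subsolution G_neg Ws (th n) x.
  move=> /(ler_wpM2l (expR_ge0 (s n * (G x - phi)))).
  rewrite /tilted !mulrA -!expRD.
  have -> : s n * (G x - phi) + s n * eta = s n * (G x - (phi - eta)) by ring.
  by rewrite -mulrDr addrA subrK subrr mulr0 expR0 mul1r.
rewrite RintegralB//; last exact: rintegrable_cst.
by rewrite Rint_cst G_mean; lra.
Qed.

End slopes.

(** * Lower tails of coercive additive functionals *)

Section asymptotics.
Context (R : realType) (nu pi : probability R R).
Hypothesis pi_inv : forall f, bmeas f -> \int[pi]_x Q nu f x = \int[pi]_x f x.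
Variables (d p d1 p1 : R).
Hypotheses (d_gt0 : 0 < d) (p_gt0 : 0 < p).
Hypothesis nu_down : p <= \int[nu]_y (y <= - d)%R%:R.
Hypotheses (d1_gt0 : 0 < d1) (p1_gt0 : 0 < p1).
Hypothesis nu_up : p1 <= \int[nu]_y (d1 <= y)%R%:R.
Variables (G : R -> R) (a B phi : R).
Hypotheses (mG : measurable_fun setT G) (G_neg : forall x : R, x <= 0 -> G x = G 0).
Hypotheses (a_gt0 : 0 < a) (G_lin : forall x, 0 <= x -> `|G x - a * x| <= B).

Let kap := G_kap phi G_neg a_gt0 G_lin.
Let Glo := G_lower G_neg a_gt0 G_lin.

(** Descend from x to the atom in m steps, repeat q times an excursion realising
    the pair (c', j), and fill the remaining r steps with loops at the atom.
    The initial and final parts have bounded cost and probability bounded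
    below, and c' < c leaves room for that cost. *)
Lemma sbelow_lower (c' j c x dl : R) : attainable nu G c' j -> c' < c -> 0 < dl ->
  \forall n \near \oo,
    expR (- ((j + dl) * n%:R)) <= sbelow nu G n (x, c * n%:R).
Proof.
move=> A cc dl0; have j0 := attainable_ge0 mG A; have [k k0 h] := A.
pose X := Num.max x 0; pose Cc := a * X + B.
have X0 : 0 <= X by rewrite le_max lexx orbT.
have xX : x <= X by rewrite le_max lexx.
pose m := (Num.truncn (X / d)).+1.
have Xm : X <= m%:R * d by rewrite -ler_pdivrMr// ltW// truncnS_gt.
have bm : p ^+ m <= bridge nu G m (x, m%:R * Cc).
  apply: (bridge_descent mG d_gt0 p_gt0 nu_down (X := X)) => //.
    by move=> z; exact: G_upper.
  exact: le_trans Xm.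
have br r : p ^+ r <= bridge nu G r (0, r%:R * (a * 0 + B)).
  apply: (bridge_descent mG d_gt0 p_gt0 nu_down (X := 0)) => //.
    by move=> z; exact: G_upper.
  by rewrite mulr_ge0// ltW.
have ple1 := down_prob_le1 nu_down.
have ppos n : 0 < p ^+ n by rewrite exprn_gt0.
pose K := m%:R * (`|Cc| + `|c'|) + k%:R * (`|B| + `|c'|).
near=> n.
have mn : (m <= n)%N by near: n; exact: nbhs_infty_ge.
have nK : K < (c - c') * n%:R.
  rewrite mulrC -ltr_pdivrMr ?subr_gt0//.
  by near: n; exact: nbhs_infty_gtr.
have np : (p ^+ (m + k))^-1 / dl <= n%:R by near: n; exact: nbhs_infty_ger.
pose q := ((n - m) %/ k)%N; pose r := ((n - m) %% k)%N.
have en : n = (m + (k * q + r))%N by rewrite mulnC -divn_eq subnKC.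
have rk : (r <= k)%N by rewrite ltnW// ltn_pmod.
have rk' : r%:R <= k%:R :> R by rewrite ler_nat.
have enR : n%:R = m%:R + k%:R * q%:R + r%:R :> R.
  by rewrite {1}en !natrD natrM addrA.
pose y := m%:R * Cc + (c' * k%:R * q%:R + r%:R * (a * 0 + B)).
have yn : y < c * n%:R.
  apply: (@le_lt_trans _ _ (c' * n%:R + K)); last by lra.
  rewrite /y /K enR mulr0 add0r.
  have h1 : m%:R * (Cc - c') <= m%:R * (`|Cc| + `|c'|).
    by rewrite ler_wpM2l// lerD ?ler_norm// -normrN ler_norm.
  have h2 : r%:R * (B - c') <= k%:R * (`|B| + `|c'|).
    apply: (@le_trans _ _ (r%:R * (`|B| + `|c'|))).
      by rewrite ler_wpM2l// lerD ?ler_norm// -normrN ler_norm.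
    by rewrite ler_wpM2r// addr_ge0.
  lra.
apply: le_trans (bridge_le_sbelow nu mG n x yn).
rewrite [in leRHS]en.
apply: le_trans (bridge_superadd nu mG G_neg _ _ _ _ _).
apply: (@le_trans _ _ (p ^+ m * (expR (- (j * n%:R)) * p ^+ k))); last first.
  apply: ler_pM => //; first exact: ltW.
    by rewrite mulr_ge0 ?expR_ge0// ltW.
  apply: le_trans (bridge_superadd nu mG G_neg _ _ _ _ _).
  apply: ler_pM => //; rewrite ?expR_ge0 ?(ltW (ppos _))//.
    apply: le_trans (bridge_exp nu mG G_neg k q (c' * k%:R)).
    apply: (@le_trans _ _ (expR (- (j * k%:R)) ^+ q)); last first.
      by apply: lerXn2r; rewrite ?nnegrE ?expR_ge0//;
        have /andP[] := bridge_bound nu mG k (0, c' * k%:R).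
    rewrite -expRM_natr ler_expR mulNr lerN2 -mulrA ler_wpM2l// enR.
    by have := ler0n R m; have := ler0n R r; lra.
  apply: le_trans (br r); rewrite -(subnK rk) exprD ler_piMl ?(ltW (ppos _))//.
  by rewrite exprn_ile1// ltW.
rewrite mulrCA -exprD mulrDl opprD expRD ler_wpM2l ?expR_ge0//.
rewrite expRN -[leRHS]invrK lef_pV2 ?posrE ?expR_gt0 ?invr_gt0//.
apply: le_trans (expR_ge1Dx _); move: np.
by rewrite ler_pdivrMr// [_ * dl]mulrC; lra.
Unshelve. all: by end_near. Qed.

Hypothesis G_int : pi.-integrable setT (EFin \o G).
Hypothesis G_mean : \int[pi]_x G x = phi.
Variables (v : R -> R) (B2 : R).
Hypotheses (mv : measurable_fun setT v) (v_ge0 : forall x, 0 <= v x).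
Hypothesis v_int : forall x, nu.-integrable setT (EFin \o (fun y => v (step x y))).
Hypothesis v_drift : forall x, 0 <= x -> \int[nu]_y v (step x y) <= v x - x + B2.

Let att := attainable nu G.

(** The slope s is the infimum of the chord slopes from the left. By convexity at
    c it also bounds the slopes of the chords to the right, and the chord from
    (z0, j0) bounds it from above. *)
Lemma supporting_line (c Jc z0 j0 : R) :
  (forall j, att c j -> Jc <= j) -> (forall e, 0 < e -> att c (Jc + e)) ->
  att z0 j0 -> z0 < c ->
  exists s : R, [/\ 0 <= s, s <= (j0 - Jc) / (c - z0) &
    forall z j, att z j -> Jc + s * c - s * z <= j].
Proof.
move=> Jlb Jatt A0 zc.
(* The slopes, up to sign, of the chords from attainable pairs left of c to (c,
   Jc). *)
pose S : set R := [set y | exists z j, [/\ att z j, z < c & y = (j - Jc) / (c - z)]].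
have S0 : S ((j0 - Jc) / (c - z0)) by exists z0, j0; split.
have Slb : lbound S 0.
  move=> _ [z [j [Az zc' ->]]]; rewrite divr_ge0 ?subr_ge0 ?(ltW zc')//.
  by apply: Jlb; apply: (attainable_homo mG (ltW zc') (lexx j)).
have hS : has_inf S by split; [by exists ((j0 - Jc) / (c - z0))|by exists 0].
have infS y : S y -> inf S <= y by move=> Sy; exact: (ge_inf hS.2).
exists (inf S); split; [exact: lb_le_inf hS.1 Slb|exact: infS|].
move=> z j Az; have [zc'|cz|zc2] := ltgtP z c; last 1 first.
  by move: Az; rewrite zc2 addrK; exact: Jlb.
  have : inf S <= (j - Jc) / (c - z) by apply: infS; exists z, j; split.
  by rewrite ler_pdivlMr ?subr_gt0//; lra.
rewrite leNgt; apply/negP => hlt.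
have : inf S < (Jc - j) / (z - c) by rewrite ltr_pdivlMr ?subr_gt0//; lra.
move=> /(inf_lt hS.1)[_ [z1 [j1 [A1 z1c ->]]]].
rewrite ltr_pdivrMr ?subr_gt0// mulrAC ltr_pdivlMr ?subr_gt0// => hcon.
have zz : 0 < z - z1 by lra.
pose t := (z - c) / (z - z1).
have t01 : 0 <= t <= 1.
  rewrite divr_ge0 ?(ltW zz) ?subr_ge0 ?(ltW cz)//= ler_pdivrMr// mul1r; lra.
have tz : t * (z - z1) = z - c by rewrite divfK ?gt_eqF.
have : Jc <= t * j1 + (1 - t) * j.
  apply/ler_addgt0Pr => e e0; apply: Jlb.
  have := attainable_convex mG G_neg t01 e0 A1 Az.
  have -> // : t * z1 + (1 - t) * z = c.
  have -> : t * z1 + (1 - t) * z = z - t * (z - z1) by ring.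
  by rewrite tz; ring.
move=> /(ler_wpM2r (ltW zz)).
have -> : (t * j1 + (1 - t) * j) * (z - z1) = t * (z - z1) * (j1 - j) + j * (z - z1).
  by ring.
by rewrite tz; lra.
Qed.

(** Fix s0 small and an attainable pair (z0, j0) with j0 < s0 (phi - z0). For c >
    z0 + j0 / s0 the supporting line at c has slope at most s0 in absolute
    value, by comparison with (z0, j0). Moreover Jc <= s (phi - c), that is,
    the line is nonpositive at phi: otherwise every attainable pair, lying
    above it, would satisfy j >= s1 (phi - z) for a small s1 > 0, against
    small_slope. *)
Theorem additive_lower_tail : exists2 e0 : R, 0 < e0 &
  forall c, phi - e0 < c < phi -> exists Jc : R, [/\ 0 < Jc, rate nu G c = Jc%:E &
  forall x : R, exp_rate Jc (fun n => below nu G n (x, c * n%:R)) /\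
    exp_rate Jc (fun n => sbelow nu G n (x, c * n%:R))].
Proof.
have [s0 [C [s0_gt0 C0 s0C HU0]]] :=
  bounded_supersolution kap d_gt0 p_gt0 nu_down a_gt0 G_lin.
have HU s : 0 <= s <= s0 -> exists U : R -> R, [/\ bmeas U,
    (forall x : R, x <= 0 -> U x = 1), (forall x, 1 <= U x <= 2) &
    (forall x : R, 0 < x -> tilted nu G phi s U x <= U x)].
  move=> ss; have [U [bU Ua U1 Us]] := HU0 s ss; exists U; split=> // x.
  have /andP[-> h] := U1 x; rewrite (le_trans h)//.
  have /andP[_ ss0] := ss; have := ler_wpM2r C0 ss0; lra.
have slope s : 0 < s <= s0 -> exists z j : R, att z j /\ j < s * (phi - z).
  move=> /andP[sg sle]; have ss : 0 <= s <= s0 by rewrite ltW.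
  have [U [bU Ua U12 Us]] := HU s ss.
  exact: (small_slope pi_inv d_gt0 p_gt0 nu_down d1_gt0 p1_gt0 nu_up mG G_neg a_gt0
    G_lin G_int G_mean sg bU Ua U12 Us).
have [|z0 [j0 [A0 jz]]] := slope s0; first by rewrite s0_gt0 lexx.
have j00 := attainable_ge0 mG A0.
exists (phi - z0 - j0 / s0).
  by rewrite subr_gt0 ltr_pdivrMr// mulrC.
move=> c /andP[c_lo c_phi].
have c_lo' : j0 / s0 < c - z0 by lra.
have zc : z0 < c.
  by have : 0 <= j0 / s0 by [rewrite divr_ge0// ltW]; lra.
have Ac : att c j0 by exact: (attainable_homo mG (ltW zc) (lexx _) A0).
pose SJ := [set j | att c j].
have hSJ : has_inf SJ.
  by split; [exists j0|exists 0 => j Aj; exact: (attainable_ge0 mG Aj)].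
pose Jc := inf SJ.
have Jlb j : att c j -> Jc <= j by move=> Aj; exact: (ge_inf hSJ.2).
have Jatt e : 0 < e -> att c (Jc + e).
  move=> e0; have : Jc < Jc + e by rewrite ltrDl.
  move=> /(inf_lt hSJ.1)[j Aj je].
  exact: (attainable_homo mG (lexx _) (ltW je) Aj).
have Jpos : 0 < Jc.
  have [be be0 hbe] := rate_positive pi_inv d_gt0 p_gt0 nu_down mG G_neg a_gt0 G_lin
    G_int G_mean mv v_ge0 v_int v_drift c_phi.
  apply: (lt_le_trans be0); apply: lb_le_inf; first exact: hSJ.1.
  by move=> j; exact: hbe.
exists Jc; split=> //.
  apply/eqP; rewrite eq_le; apply/andP; split; first exact/(rate_le nu mG).
  by apply: le_ereal_inf_tmp => _ [j Aj <-]; rewrite lee_fin; exact: Jlb.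
have [s [s_ge0 s_le Hs]] := supporting_line Jlb Jatt A0 zc.
have ss0 : s <= s0.
  rewrite (le_trans s_le)// ler_pdivrMr ?subr_gt0//.
  move: c_lo'; rewrite ltr_pdivrMr// mulrC; lra.
have rho_ge0 : 0 <= s * (phi - c) - Jc.
  rewrite leNgt; apply/negP => hneg.
  (* phi - z < K for every attainable z, since z >= - B; a slope s1 with s1 K at
     most the gap then contradicts small_slope. *)
  pose K := `|phi + B| + 1.
  have K0 : 0 < K by rewrite ltr_wpDl.
  pose gap := Jc - s * (phi - c).
  have gap0 : 0 < gap by rewrite /gap; lra.
  pose s1 := Num.min s0 (gap / K).
  have s10 : 0 < s1 by rewrite lt_min s0_gt0 divr_gt0.
  have s1K : s1 * K <= gap by rewrite -ler_pdivlMr// ge_min lexx orbT.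
  have [|z [j [Az jlt]]] := slope s1; first by rewrite s10 ge_min lexx.
  have zlo : - B <= z := attainable_low mG Glo Az.
  have jge := attainable_ge0 mG Az.
  have zphi : 0 < phi - z.
    by rewrite -(pmulr_rgt0 _ s10) (le_lt_trans jge jlt).
  have h1 := Hs _ _ Az.
  have h2 : s1 * (phi - z) <= s1 * K.
    by rewrite ler_wpM2l ?(ltW s10)// /K; have := ler_norm (phi + B); lra.
  have h3 : 0 <= s * (phi - z) by rewrite mulr_ge0// ltW.
  by rewrite /gap in s1K; lra.
have [|U [bU Ua U12 Us]] := HU s; first by rewrite s_ge0.
have hb k y : (0 < k)%N -> bridge nu G k (0, y) <=
    expR (k%:R * (s * (phi - c) - Jc) + s * (y - phi * k%:R)).
  move=> k0; apply: (le_trans (bridge_le_affine y Hs k0)).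
  by rewrite ler_expR; lra.
have [C1 C10 growth] := iter_one_growth mG G_neg a_gt0 G_lin s_ge0 rho_ge0 bU Ua
  U12 Us hb.
suff tails x dl : 0 < dl -> \forall n \near \oo,
    expR (- ((Jc + dl) * n%:R)) <= sbelow nu G n (x, c * n%:R) /\
    below nu G n (x, c * n%:R) <= expR (- ((Jc - dl) * n%:R)).
  move=> x; split=> dl dl0; apply: filterS (tails x dl dl0) => n [lo up]; split=> //.
    exact: (le_trans lo (sbelow_le_below nu mG n _)).
  exact: (le_trans (sbelow_le_below nu mG n _) up).
move=> dl0; near=> n; split.
  near: n.
  have dl4 : 0 < dl / 4 by rewrite divr_gt0.
  pose t := Num.min 1 (dl / 4 / (j0 + 1)).
  have j1 : 0 < j0 + 1 by lra.
  have t0 : 0 < t by rewrite lt_min ltr01 divr_gt0.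
  have t01 : 0 <= t <= 1 by rewrite ltW//= ge_min lexx.
  have tj : t * (j0 + 1) <= dl / 4 by rewrite -ler_pdivlMr// ge_min lexx orbT.
  (* Moving slightly towards z0 < c gives a strictly smaller mean cost, as the
     lower bound needs, at an arbitrarily small increase of the rate. *)
  have At := attainable_convex mG G_neg t01 dl4 A0 (Jatt _ dl4).
  have ct : t * z0 + (1 - t) * c < c.
    have : 0 < t * (c - z0) by rewrite mulr_gt0// subr_gt0.
    lra.
  have := sbelow_lower x At ct dl4; apply: filterS => n /(le_trans _); apply.
  rewrite ler_expR lerN2 ler_wpM2r//.
  have : 0 <= t * (Jc + dl / 4) by rewrite mulr_ge0 ?(ltW t0)//; lra.
  lra.
apply: (le_trans (below_chernoff nu mG s_ge0 kap n x _)).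
apply: (le_trans (ler_wpM2l (expR_ge0 _) (growth n x))).
rewrite mulrCA -expRD.
apply: (@le_trans _ _ (expR (dl * n%:R) * expR (- (Jc * n%:R)))).
  apply: ler_pM; rewrite ?mulr_ge0 ?expR_ge0 ?sqr_ge0//.
    by near: n; exact: expR_beats_square.
  by rewrite ler_expR; lra.
by rewrite -expRD ler_expR; lra.
Unshelve. all: by end_near. Qed.

End asymptotics.

(** * The quadratic Lyapunov function *)

Section spread.
Context (R : realType) (nu : probability R R).
Hypothesis y_int : nu.-integrable setT (EFin \o (fun y : R => y)).

(** If the law had no mass below 0, truncating at - n and letting n tend to
    infinity would make the mean nonnegative. *)
Lemma negative_mass : \int[nu]_y y < 0 -> 0 < \int[nu]_y (y < 0)%R%:R.
Proof.
move=> mean0; rewrite ltNge; apply/negP => neg0.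
have bneg : bmeas (fun y : R => (y < 0)%R%:R : R).
  by apply: bmeas_bool; apply: measurable_fun_ltr.
have cv : \int[nu]_y Num.max y (- n%:R) @[n --> \oo] --> \int[nu]_y y.
  apply: (@Rint_cvg_dom _ _ _ nu (fun n y => Num.max y (- n%:R)) (fun y => y) (fun y => `|y|)).
  - by move=> n; apply: measurable_maxr.
  - exact: (integrable_norm y_int).
  - move=> n y /=; case: (leP y (- n%:R)) => // yn.
    rewrite normrN normr_nat; have := ler_norm (- y); rewrite normrN; lra.
  - move=> y; apply: cvg_near_cst; near=> n.
    rewrite max_l// lerNl; near: n; exact: nbhs_infty_ger.
have : 0 <= \int[nu]_y y.
  rewrite -(cvg_lim _ cv)//; apply: limr_ge; first by apply/cvg_ex; eexists; exact: cv.
  apply: nearW => n; apply: (@le_trans _ _ (\int[nu]_y (- n%:R * (y < 0)%R%:R))).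
    by rewrite RintZ// mulr_le0// oppr_le0.
  apply: le_Rintegral => //.
  - by apply: bmeas_integrable; exact: bmeasZ.
  - apply: (le_integrable measurableT _ _ (integrable_norm y_int)) => /=.
      by apply/measurable_EFinP; apply: measurable_maxr.
    move=> y _; rewrite lee_fin normr_id; case: (leP y (- n%:R)) => // yn.
    by rewrite normrN normr_nat; have := ler_norm (- y); rewrite normrN; lra.
  - move=> y _; case: ltP => y0 /=; first by rewrite mulr1 le_max lexx orbT.
    by rewrite mulr0 le_max y0.
lra.
Unshelve. all: by end_near. Qed.

Lemma down_steps_exist : \int[nu]_y y < 0 -> exists d p : R,
  [/\ 0 < d, 0 < p & p <= \int[nu]_y (y <= - d)%R%:R].
Proof.
move=> /negative_mass mass; apply: contrapT => H.
have h0 n : \int[nu]_y (y <= - n.+1%:R^-1)%R%:R <= 0.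
  rewrite leNgt; apply/negP => h; apply: H.
  by exists n.+1%:R^-1, (\int[nu]_y (y <= - n.+1%:R^-1)%R%:R); rewrite invr_gt0.
have cv : \int[nu]_y (y <= - n.+1%:R^-1)%R%:R @[n --> \oo] -->
    \int[nu]_y (y < 0)%R%:R.
  apply: (@Rint_cvg _ _ _ nu (fun n y => (y <= - n.+1%:R^-1)%R%:R) (fun y => (y < 0)%R%:R) 1).
  - by move=> n; apply: (bmeas_bool R _).1; apply: measurable_fun_ler.
  - by move=> n y; rewrite normr_nat lern1 leq_b1.
  - move=> y; apply: cvg_near_cst; case: (ltP y 0) => y0; last first.
      apply: nearW => n; suff -> : (y <= - n.+1%:R^-1) = false by [].
      by apply/negbTE; rewrite -ltNge (lt_le_trans _ y0)// oppr_lt0 invr_gt0.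
    near=> n; suff -> : (y <= - n.+1%:R^-1) by [].
    rewrite lerNr invf_ple ?posrE ?oppr_gt0//.
    rewrite (@le_trans _ _ n%:R)//; last by rewrite ler_nat.
    by near: n; exact: nbhs_infty_ger.
move: mass; rewrite ltNge => /negP; apply; rewrite -(cvg_lim _ cv)//.
by apply: limr_le; [apply/cvg_ex; eexists; exact: cv|exact: nearW].
Unshelve. all: by end_near. Qed.

Lemma up_steps_exist : 0 < \int[nu]_y (0 < y)%R%:R -> exists d p : R,
  [/\ 0 < d, 0 < p & p <= \int[nu]_y (d <= y)%R%:R].
Proof.
move=> mass; apply: contrapT => H.
have h0 n : \int[nu]_y (n.+1%:R^-1 <= y)%R%:R <= 0.
  rewrite leNgt; apply/negP => h; apply: H.
  by exists n.+1%:R^-1, (\int[nu]_y (n.+1%:R^-1 <= y)%R%:R); rewrite invr_gt0.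
have cv : \int[nu]_y (n.+1%:R^-1 <= y)%R%:R @[n --> \oo] -->
    \int[nu]_y (0 < y)%R%:R.
  apply: (@Rint_cvg _ _ _ nu (fun n y => (n.+1%:R^-1 <= y)%R%:R) (fun y => (0 < y)%R%:R) 1).
  - by move=> n; apply: (bmeas_bool R _).1; apply: measurable_fun_ler.
  - by move=> n y; rewrite normr_nat lern1 leq_b1.
  - move=> y; apply: cvg_near_cst; case: (ltP 0 y) => y0; last first.
      apply: nearW => n; suff -> : (n.+1%:R^-1 <= y) = false by [].
      by apply/negbTE; rewrite -ltNge (le_lt_trans y0)// invr_gt0.
    near=> n; suff -> : (n.+1%:R^-1 <= y) by [].
    rewrite invf_ple ?posrE//.
    rewrite (@le_trans _ _ n%:R)//; last by rewrite ler_nat.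
    by near: n; exact: nbhs_infty_ger.
move: mass; rewrite ltNge => /negP; apply; rewrite -(cvg_lim _ cv)//.
by apply: limr_le; [apply/cvg_ex; eexists; exact: cv|exact: nearW].
Unshelve. all: by end_near. Qed.

End spread.

Section quadratic.
Context (R : realType) (nu : probability R R) (delta : R).
Hypothesis delta_gt0 : 0 < delta.
Hypothesis y_int : nu.-integrable setT (EFin \o (fun y : R => y)).
Hypothesis y2_int : nu.-integrable setT (EFin \o (fun y : R => y ^+ 2)).
Hypothesis y_mean : \int[nu]_y y = - delta.

(** V is the quadratic Lyapunov function; it is extended to negative states as the
    walk is, by its value at the atom. *)
Definition Vpos (x : R) : R := V delta (Num.max x 0).

Lemma Vpos_ge1 x : 1 <= Vpos x.
Proof.
rewrite /Vpos /V; set z := Num.max x 0.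
have z0 : 0 <= z by rewrite le_max lexx orbT.
by rewrite lerDl !mulr_ge0 ?invr_ge0 ?(ltW delta_gt0)// addr_ge0 ?sqr_ge0// mulr_ge0// ltW.
Qed.

Lemma measurable_Vpos : measurable_fun setT Vpos.
Proof.
have mm : measurable_fun setT (fun x : R => Num.max x 0) by exact: measurable_maxr.
apply: measurable_funD => //; apply: measurable_funM => //.
by apply: measurable_funD; [exact: measurable_funX|exact: measurable_funM].
Qed.

Let k : R := 2^-1 * delta^-1.
Let k_gt0 : 0 < k. Proof. by rewrite mulr_gt0// invr_gt0. Qed.
Let k_delta : k * delta = 2^-1. Proof. by rewrite /k mulfVK ?gt_eqF. Qed.

(** Without reflection the increment is x y / delta + y / 2 + k y ^ 2; reflection
    changes it by terms that these two bounds absorb. The linear term x y /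
    delta has mean - x, which is the reason for the normalisation of V. *)
Lemma Vpos_incr x y : 0 <= x ->
  x * y / delta + y / 2 <= Vpos (step x y) - Vpos x <=
  x * y / delta + k * y ^+ 2 + `|y| / 2.
Proof.
move=> x0; rewrite /Vpos (max_idPl (step_ge0 x y)) (max_idPl x0) /V.
rewrite /step (max_idPl x0) -/k.
have -> : 1 + k * (Num.max (x + y) 0 ^+ 2 + delta * Num.max (x + y) 0) -
    (1 + k * (x ^+ 2 + delta * x)) =
  k * (Num.max (x + y) 0 ^+ 2 - x ^+ 2) + k * delta * (Num.max (x + y) 0 - x).
  by ring.
have -> : x * y / delta = k * (2 * (x * y)) by rewrite /k; field; rewrite gt_eqF.
rewrite k_delta; have yn := ler_norm y; have yn' := ler_norm (- y).
rewrite normrN in yn'.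
case: (leP (x + y) 0) => xy.
  have h1 : k * (2 * (x * y)) <= k * (0 ^+ 2 - x ^+ 2).
    rewrite ler_pM2l// expr0n/= sub0r.
    have : x * (x + 2 * y) <= 0 by rewrite mulr_ge0_le0//; lra.
    by rewrite expr2; lra.
  (* This is (x + y) ^ 2 >= 0. *)
  have h2 : k * (0 ^+ 2 - x ^+ 2) <= k * (2 * (x * y)) + k * y ^+ 2.
    rewrite -mulrDr ler_pM2l// expr0n/= sub0r.
    by have := sqr_ge0 (x + y); rewrite sqrrD -mulr_natl; lra.
  apply/andP; split; lra.
have -> : (x + y) ^+ 2 - x ^+ 2 = 2 * (x * y) + y ^+ 2 by ring.
have h3 : 0 <= k * y ^+ 2 by rewrite mulr_ge0 ?sqr_ge0// ltW.
by rewrite mulrDr; apply/andP; split; lra.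
Qed.

Let bound x y : R := (x / delta) * `|y| + (k * y ^+ 2 + 2^-1 * `|y|).

Let bound_rest_int :
  nu.-integrable setT (EFin \o (fun y : R => k * y ^+ 2 + 2^-1 * `|y|)).
Proof.
by apply: rintegrableD; apply: rintegrableZ => //; exact: integrable_norm.
Qed.

Let bound_int x : nu.-integrable setT (EFin \o bound x).
Proof.
by apply: rintegrableD => //; apply: rintegrableZ; exact: integrable_norm.
Qed.

Lemma Vpos_step_norm x y : 0 <= x -> `|Vpos (step x y) - Vpos x| <= bound x y.
Proof.
move=> x0; have /andP[lo up] := Vpos_incr y x0.
have yn := ler_norm y; have yn' := ler_norm (- y); rewrite normrN in yn'.
have xd : 0 <= x / delta by rewrite divr_ge0// ltW.
have h1 := ler_wpM2l xd yn; have h2 := ler_wpM2l xd yn'.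
have h3 : 0 <= k * y ^+ 2 by rewrite mulr_ge0 ?sqr_ge0// ltW.
rewrite mulrAC in lo; rewrite mulrAC in up.
by rewrite /bound ler_norml; apply/andP; split; lra.
Qed.

Let measurable_Vpos_step x : measurable_fun setT (fun y => Vpos (step x y)).
Proof.
apply: (measurableT_comp measurable_Vpos).
exact: (measurableT_comp (@measurable_step R) (measurable_pair1 x)).
Qed.

Lemma Vpos_step_int x : nu.-integrable setT (EFin \o (fun y => Vpos (step x y))).
Proof.
have h z : 0 <= z -> nu.-integrable setT (EFin \o (fun y => Vpos (step z y))).
  move=> z0; have ib : nu.-integrable setT (EFin \o (fun y => Vpos z + bound z y)).
    by apply: rintegrableD => //; exact: rintegrable_cst.
  apply: (le_integrable measurableT _ _ ib).
    by apply/measurable_EFinP; exact: measurable_Vpos_step.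
  move=> y _ /=; rewrite lee_fin.
  have h1 := Vpos_step_norm y z0; have h2 := Vpos_ge1 z; have h3 := Vpos_ge1 (step z y).
  rewrite ger0_norm; last lra.
  apply: le_trans (ler_norm _); move: h1; rewrite ler_norml => /andP[_ h1]; lra.
have [x0|/ltW] := leP x 0; last exact: h.
have -> : (fun y => Vpos (step x y)) = (fun y => Vpos (step 0 y)).
  by apply/funext => y; rewrite step_neg.
exact: h.
Qed.

Let k2 : R := k * \int[nu]_y (y ^+ 2) + 2^-1 * \int[nu]_y `|y|.

Let norm_int : nu.-integrable setT (EFin \o (fun y : R => `|y|)).
Proof. exact: (integrable_norm y_int). Qed.

Let k2E : \int[nu]_y (k * y ^+ 2 + 2^-1 * `|y|) = k2.
Proof.
rewrite RintegralD//; [|exact: rintegrableZ..].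
by rewrite !RintegralZl.
Qed.

Lemma Vpos_drift x : 0 <= x ->
  Vpos x - x - delta / 2 <= \int[nu]_y Vpos (step x y) <= Vpos x - x + k2.
Proof.
move=> x0.
have i1 (c : R) : nu.-integrable setT (EFin \o (fun y => c * y)).
  exact: rintegrableZ.
have xd : x / delta * - delta = - x by rewrite mulrN divfK ?gt_eqF.
apply/andP; split.
  have -> : Vpos x - x - delta / 2 =
      \int[nu]_y (Vpos x + ((x / delta) * y + 2^-1 * y)).
    rewrite RintegralD//; [|exact: rintegrable_cst|exact: rintegrableD].
    rewrite Rint_cst RintegralD// !RintegralZl// y_mean xd; lra.
  apply: le_Rintegral => //; last 1 first.
  - move=> y _; have /andP[lo _] := Vpos_incr y x0; rewrite mulrAC in lo; lra.
  - by apply: rintegrableD; [exact: rintegrable_cst|exact: rintegrableD].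
  - exact: Vpos_step_int.
have -> : Vpos x - x + k2 =
    \int[nu]_y (Vpos x + ((x / delta) * y + (k * y ^+ 2 + 2^-1 * `|y|))).
  rewrite RintegralD//; [|exact: rintegrable_cst|exact: rintegrableD].
  by rewrite Rint_cst RintegralD// RintegralZl// y_mean xd k2E; lra.
apply: le_Rintegral => //; last 1 first.
- move=> y _; have /andP[_ up] := Vpos_incr y x0; rewrite mulrAC in up; lra.
- exact: Vpos_step_int.
- by apply: rintegrableD; [exact: rintegrable_cst|exact: rintegrableD].
Qed.

Definition Hpos x : R := Vpos x - \int[nu]_y Vpos (step x y).

Lemma Hpos_neg x : x <= 0 -> Hpos x = Hpos 0.
Proof.
move=> x0; rewrite /Hpos /Vpos (max_idPr x0) maxxx; congr (_ - _).
by apply: eq_Rintegral => y _; rewrite step_neg.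
Qed.

Lemma Hpos_bound : exists Bh : R, forall x, 0 <= x -> `|Hpos x - x| <= Bh.
Proof.
exists (delta / 2 + `|k2|) => x x0; have /andP[lo up] := Vpos_drift x0.
have := ler_norm k2; have := normr_ge0 k2; have := delta_gt0.
by rewrite /Hpos ler_norml => d0 n0 n1; apply/andP; split; lra.
Qed.

Lemma measurable_Hpos : measurable_fun setT Hpos.
Proof.
apply: measurable_funB; first exact: measurable_Vpos.
apply: (measurableT_comp (f := fine)) => //.
apply: (@measurable_fun_fubini_tonelli_F _ _ _ _ _ nu
  (fun z => (Vpos (step z.1 z.2))%:E)).
  apply/measurable_EFinP; apply: (measurableT_comp measurable_Vpos).
  exact: measurable_step.
by move=> z; rewrite lee_fin (le_trans ler01)// Vpos_ge1.
Qed.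

(** V need not be integrable under [pi], so invariance is applied to V truncated
    at n. Truncation is a contraction, hence the one-step increments are
    dominated by those of V, which are linear in the state and thus
    integrable. *)
Lemma Hpos_mean (pi : probability R R) :
  (forall f, bmeas f -> \int[pi]_x Q nu f x = \int[pi]_x f x) ->
  pi.-integrable setT (EFin \o (fun x : R => Num.max x 0)) ->
  \int[pi]_x Hpos x = 0.
Proof.
move=> pi_inv x_int.
pose u (n : nat) x := Num.min (Vpos x) n%:R.
have bu n : bmeas (u n).
  apply: (@bmeas_between _ _ _ 0 n%:R).
    by apply: measurable_minr => //; exact: measurable_Vpos.
  move=> x; rewrite ge_min lexx orbT andbT le_min ler0n andbT.
  by rewrite (le_trans ler01)// Vpos_ge1.
have Lip (x y c : R) : `|Num.min x c - Num.min y c| <= `|x - y|.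
  case: (leP x c) => xc; case: (leP y c) => yc //.
  - rewrite ler_norml; have := ler_norm (x - y); have := ler_norm (- (x - y)).
    rewrite normrN; lra.
  - rewrite ler_norml; have := ler_norm (x - y); have := ler_norm (- (x - y)).
    rewrite normrN; lra.
  - by rewrite subrr normr0.
pose w n x := u n x - Q nu (u n) x.
have bw n : bmeas (w n) by apply: bmeasB => //; exact: bmeas_Q.
have w0 n : \int[pi]_x w n x = 0.
  by rewrite RintB ?pi_inv ?subrr//; exact: bmeas_Q.
have wE n x : w n x = \int[nu]_y (u n x - u n (step x y)).
  by rewrite RintB ?Rint_cst//; [exact: bmeas_cst|exact: bmeas_step].
have HE x : Hpos x = \int[nu]_y (Vpos x - Vpos (step x y)).
  rewrite RintegralB//; [|exact: rintegrable_cst|exact: Vpos_step_int].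
  by rewrite Rint_cst.
have mx x : 0 <= Num.max x 0 :> R by rewrite le_max lexx orbT.
have red (x y : R) : step x y = step (Num.max x 0) y.
  by rewrite /step (max_idPl (mx x)).
have redV x : Vpos x = Vpos (Num.max x 0) by rewrite /Vpos (max_idPl (mx x)).
have nb (x y : R) : `|Vpos (step x y) - Vpos x| <= bound (Num.max x 0) y.
  by rewrite red [X in _ - X]redV; exact: (Vpos_step_norm y (mx x)).
have wcv x : w n x @[n --> \oo] --> Hpos x.
  rewrite HE; under eq_fun do rewrite wE.
  apply: (Rint_cvg_dom _ (bound_int (Num.max x 0))).
  - move=> n; apply: measurable_funB => //.
    exact: (bmeas_step x (bu n)).1.
  - move=> n y; rewrite distrC (le_trans (Lip _ _ _))//.
  - move=> y; apply: cvgB; apply: cvg_near_cst; near=> n; rewrite /u min_l//;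
      near: n; exact: nbhs_infty_ger.
have lin : pi.-integrable setT (EFin \o (fun x : R =>
    ((\int[nu]_y `|y|) / delta) * Num.max x 0 + k2)).
  by apply: rintegrableD; [exact: rintegrableZ|exact: rintegrable_cst].
have cv : \int[pi]_x w n x @[n --> \oo] --> \int[pi]_x Hpos x.
  apply: (Rint_cvg_dom (fun n => (bw n).1) lin) => // n x.
  rewrite wE (le_trans (le_normr_Rintegral _ _))//.
    by apply: bmeas_integrable; apply: bmeasB; [exact: bmeas_cst|exact: bmeas_step].
  apply: (@le_trans _ _ (\int[nu]_y bound (Num.max x 0) y)).
    apply: le_Rintegral => //.
      apply: integrable_norm; apply: bmeas_integrable.
      by apply: bmeasB; [exact: bmeas_cst|exact: bmeas_step].
    move=> y _; rewrite distrC (le_trans (Lip _ _ _))//.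
  rewrite RintegralD//; last exact: rintegrableZ.
  by rewrite RintegralZl// k2E; lra.
apply/esym/(cvg_unique _ _ cv) => //.
have -> : (fun n => \int[pi]_x w n x) = fun=> 0 by apply/funext.
exact: cvg_cst.
Unshelve. all: by end_near. Qed.

End quadratic.

Section invariance.
Context d (T : measurableType d) (R : realType) (P : probability T R).
Variables (D : nat -> {RV P >-> R}) (pi : probability R R).
Hypothesis pi_invariant : invariant_probability D pi.

Let nu := distribution P (D 0%N).

Lemma transitionE x (A : set R) : 0 <= x ->
  transition D x A = nu [set y | A (step x y)].
Proof.
move=> x0; rewrite /transition /path_law /nu /distribution /pushforward.
by rewrite /preimage /= /step (max_idPl x0).
Qed.

(** The space R_+ has full measure, so [pi] may be used on the whole line. *)
Lemma negative_null : pi (~` `[0, +oo[%classic) = 0.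
Proof.
have [p1 _] := pi_invariant.
rewrite probability_setC//.
by rewrite [X in (1 - X)%E]p1 subee.
Qed.

Lemma integral_nonneg (f : R -> \bar R) : measurable_fun setT f ->
  (forall x, 0 <= f x)%E ->
  (\int[pi]_x f x = \int[pi]_(x in `[0%R, +oo[) f x)%E.
Proof.
move=> mf f0; rewrite (@ge0_negligible_integral _ _ _ pi setT (~` `[0, +oo[%classic))//.
- by rewrite setDE setCK setTI.
- by apply: measurableC.
- exact: negative_null.
Qed.

(** Invariance on sets says that [pi] is the image of the product of [pi] and [nu]
    under one step; integrate f against it. *)
Lemma invariance f : bmeas f -> \int[pi]_x Q nu f x = \int[pi]_x f x.
Proof.
move=> bf; have bfs := bmeas_comp bf (@measurable_step R).
pose m' := measure_function_pushforward__canonical__measure_function_Measure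
  (pi \x nu)%E (@measurable_step R).
have mE A : measurable A -> m' A = pi A.
  move=> mA; have [_ /(_ A mA) <-] := pi_invariant.
  have mS : measurable ((fun z : R * R => step z.1 z.2) @^-1` A).
    by rewrite -[X in measurable X]setTI; exact: measurable_step.
  rewrite /m' /= /pushforward /= /product_measure1 integral_nonneg.
  - apply: eq_integral => x; rewrite inE/= in_itv/= andbT => x0.
    rewrite transitionE//=; congr (nu _).
    by apply/seteqP; split => y; rewrite /xsection /= inE.
  - exact: measurable_fun_xsection.
  - by move=> x.
have -> : \int[pi]_x f x = fine (\int[m']_x (f x)%:E)%E.
  by congr fine; apply: eq_measure_integral => A mA _; rewrite mE.
rewrite /Q -(Rint_prod pi nu bfs); congr fine.
apply/esym; apply: (@integral_pushforward _ _ _ _ _ _ (@measurable_step R)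
  (pi \x nu)%E setT (EFin \o f)) => //; first by apply/measurable_EFinP; exact: bf.1.
exact: (bmeas_prod_integrable pi nu bfs).
Qed.

End invariance.

(** * Events of the time averages *)

Section path_events.
Context d (T : measurableType d) (R : realType) (P : probability T R).
Variables (D : nat -> {RV P >-> R}) (D_iid : iid D).
Variables (F G : R -> R) (x : R).
Hypotheses (mG : measurable_fun setT G) (x_ge0 : 0 <= x).
Hypothesis FG : forall z, 0 <= z -> F z = G z.

Let nu := distribution P (D 0%N).

Lemma time_averageE n w :
  time_average n F (walk D x w) = n%:R^-1 * \sum_(0 <= k < n) G (walk D x w k).
Proof.
by congr (_ * _); apply: eq_bigr => k _; rewrite FG// walk_ge0.
Qed.

Lemma path_law_le n c : (0 < n)%N ->
  path_law D x [set Phi | time_average n F Phi <= c] =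
  (below nu G n (x, c * n%:R))%:E.
Proof.
move=> n0; have n0' : 0 < n%:R :> R by rewrite ltr0n.
have mq : measurable_fun setT (fun z : R * R => 0 <= z.2).
  by apply: measurable_fun_ler => //; exact: measurable_snd.
rewrite -(prob_state (c * n%:R) D_iid mG x_ge0 n mq); congr (P _).
by apply/seteqP; split => w /=; rewrite time_averageE subr_ge0 ler_pdivrMl// mulrC.
Qed.

Lemma path_law_lt n c : (0 < n)%N ->
  P [set w | time_average n F (walk D x w) < c] = (sbelow nu G n (x, c * n%:R))%:E.
Proof.
move=> n0; have n0' : 0 < n%:R :> R by rewrite ltr0n.
have mq : measurable_fun setT (fun z : R * R => 0 < z.2).
  by apply: measurable_fun_ltr => //; exact: measurable_snd.
rewrite -(prob_state (c * n%:R) D_iid mG x_ge0 n mq); congr (P _).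
by apply/seteqP; split => w /=; rewrite time_averageE subr_gt0 ltr_pdivrMl// mulrC.
Qed.

Lemma measurable_path_lt n c : (0 < n)%N ->
  measurable [set w | time_average n F (walk D x w) < c].
Proof.
move=> n0; have n0' : 0 < n%:R :> R by rewrite ltr0n.
have mq : measurable_fun setT (fun z : R * R => 0 < z.2).
  by apply: measurable_fun_ltr => //; exact: measurable_snd.
have -> : [set w | time_average n F (walk D x w) < c] =
    (fun w => 0 < (state D G x (c * n%:R) n w).2) @^-1` [set true].
  by apply/seteqP; split => w /=; rewrite time_averageE subr_gt0 ltr_pdivrMl// mulrC.
rewrite -[X in measurable X]setTI.
by apply: (measurableT_comp mq (measurable_state D (c * n%:R) mG x_ge0 n)).
Qed.

End path_events.

(** * The reflected random walk *)

Section second_moment.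
Context d (T : measurableType d) (R : realType) (P : probability T R).
Variables (D : {RV P >-> R}) (delta : R).
Hypothesis D_sq : ('E_P[fun w => (D w ^+ 2)%R] < +oo)%E.
Hypothesis D_mean : ('E_P[D] = (- delta)%:E)%E.

Let nu := distribution P D.

Let D2_int : P.-integrable setT (EFin \o (fun w => D w ^+ 2)).
Proof.
apply/integrableP; split.
  by apply/measurable_EFinP; apply: measurable_funX; exact: measurable_funPT.
move: D_sq; rewrite unlock; congr (_ < _)%E.
by apply: eq_integral => w _ /=; rewrite ger0_norm ?sqr_ge0.
Qed.

Let D_int : P.-integrable setT (EFin \o D).
Proof.
have i1 : P.-integrable setT (EFin \o (fun w => 1 + D w ^+ 2)).
  by apply: rintegrableD => //; exact: rintegrable_cst.
apply: (le_integrable measurableT _ _ i1).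
  by apply/measurable_EFinP; exact: measurable_funPT.
move=> w _ /=; rewrite lee_fin; apply: le_trans (ler_norm _).
have := sqr_ge0 (`|D w| - 1); rewrite sqrrB -normrX ger0_norm ?sqr_ge0//.
rewrite mulr1 expr1n -mulr_natl; have := normr_ge0 (D w); lra.
Qed.

Lemma law_integrable (f : R -> R) : measurable_fun setT f ->
  P.-integrable setT (EFin \o (fun w => f (D w))) -> nu.-integrable setT (EFin \o f).
Proof.
move=> mf fi; apply: (integrable_pushforward (measurable_funPT D)) => //.
by apply/measurable_EFinP.
Qed.

Lemma law_square_integrable : nu.-integrable setT (EFin \o (fun y : R => y ^+ 2)).
Proof. by apply: law_integrable => //; exact: measurable_funX. Qed.

Lemma law_id_integrable : nu.-integrable setT (EFin \o (fun y : R => y)).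
Proof. exact: law_integrable. Qed.

Lemma law_mean : \int[nu]_y y = - delta.
Proof.
transitivity (fine 'E_P[D]); last by rewrite D_mean.
rewrite unlock; congr fine.
apply: (@integral_distribution _ _ _ _ _ P D (fun y => y%:E)); last exact: D_int.
by apply/measurable_EFinP.
Qed.

Lemma law_positive : (0 < P [set w | (0 < D w)%R])%E -> 0 < \int[nu]_y (0 < y)%R%:R.
Proof.
move=> h.
have mq : measurable_fun setT (fun y : R => 0 < y) by exact: measurable_fun_ltr.
have mS : measurable [set w | 0 < D w].
  rewrite -[X in measurable X]setTI.
  exact: (measurableT_comp mq (measurable_funPT D)).
rewrite Rint_distribution; last exact: bmeas_bool.
have -> : \int[P]_w (0 < D w)%R%:R = fine (P [set w | 0 < D w]).
  congr fine; rewrite -[in RHS](setIT [set w | _]) -integral_indic//.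
  apply: eq_integral => w _; rewrite indicE.
  by have -> : (w \in [set w | 0 < D w]) = (0 < D w) by apply/idP/idP; rewrite inE.
by rewrite fine_gt0// h/= (le_lt_trans (probability_le1 P mS))// ltry.
Qed.

End second_moment.

Lemma econvex_opp (R : realType) (I : R -> \bar R) :
  econvex I -> econvex (fun c => I (- c)).
Proof.
move=> cI [c1 y1] [c2 y2] t; have := cI (- c1, y1) (- c2, y2) t.
rewrite !inE /= => h h1 h2; have := h h1 h2.
by rewrite !scalerN -opprD.
Qed.

Theorem proposition3p3 (d : measure_display) (T : measurableType d)
    (R : realType) (P : probability T R) (D : nat -> {RV P >-> R})
    (delta : R) (pi : probability R R) (phi thetap thetam : R)
    (D_iid : iid D)
    (D_sq : forall k, ('E_P[fun w => (D k w ^+ 2)%R] < +oo)%E)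
    (D_pos : forall k, (0 < P [set w | (0 < D k w)%R])%E)
    (D_mean : forall k, ('E_P[D k] = (- delta)%:E)%E)
    (delta_gt0 : 0 < delta)
    (pi_invariant : invariant_probability D pi)
    (pi_unique : forall mu : probability R R, invariant_probability D mu ->
       forall A : set R, measurable A -> mu A = pi A)
    (pi_mean : (\int[pi]_(x in `[0%R, +oo[) x%:E = phi%:E)%E)
    (thetap_lt1 : thetap < 1) (thetam_gt1 : 1 < thetam) :
  let F := fun x : R => x in
  let H := fun x : R => V delta x - transition_op D (V delta) x in
  let Fm := fun x : R => F x - thetam * H x in
  let Fp := fun x : R => F x - thetap * H x in
  let phim_ n := time_average n Fm in
  let phip_ n := time_average n Fp in
  let phi_ n := time_average n F in
  let Delta_ n := time_average n H in
  exists (Im Ip : R -> \bar R) (eps0 : R),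
    [/\ econvex Im, econvex Ip, 0 < eps0 &
     forall x : R, 0 <= x ->
     [/\ forall c : R, phi - eps0 < c < phi ->
           ((n%:R^-1)%:E * lne (path_law D x [set Phi | (phip_ n Phi <= c)%R])
             @[n --> \oo] --> - Ip c)%E /\ (- Ip c < 0)%E,
         forall c : R, phi < c < phi + eps0 ->
           ((n%:R^-1)%:E * lne (path_law D x [set Phi | (c <= phim_ n Phi)%R])
             @[n --> \oo] --> - Im c)%E /\ (- Im c < 0)%E &
         forall eps : R, 0 < eps < eps0 ->
           ((n%:R^-1)%:E * lne (path_law D x [set Phi |
                (~` `[- eps + thetap * Delta_ n Phi,
                      eps + thetam * Delta_ n Phi])%R (phi_ n Phi - phi)%R])
             @[n --> \oo] --> - Order.min (Ip (phi - eps)%R) (Im (phi + eps)%R))%E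
           /\ (- Order.min (Ip (phi - eps)%R) (Im (phi + eps)%R) < 0)%E]].
Proof.
move=> F H Fm Fp phim_ phip_ phi_ Delta_.
pose nu : probability R R := distribution P (D 0%N).
have y_int := law_id_integrable (D_sq 0%N).
have y2_int := law_square_integrable (D_sq 0%N).
have y_mean : \int[nu]_y y = - delta := law_mean (D_sq 0%N) (D_mean 0%N).
have [dd [pp [dd0 pp0 nu_down]]] : exists d p : R,
    [/\ 0 < d, 0 < p & p <= \int[nu]_y (y <= - d)%R%:R].
  by apply: down_steps_exist => //; rewrite y_mean oppr_lt0.
have [du [pu [du0 pu0 nu_up]]] : exists d p : R,
    [/\ 0 < d, 0 < p & p <= \int[nu]_y (d <= y)%R%:R].
  by apply: up_steps_exist; exact: law_positive.
have pi_inv f : bmeas f -> \int[pi]_x Q nu f x = \int[pi]_x f x.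
  exact: invariance.
pose Hp := Hpos nu delta.
(* The mean over R_+ becomes a mean over the line of the clipped state. *)
have x_intE : (\int[pi]_x (Num.max x 0)%:E = phi%:E)%E.
  rewrite (integral_nonneg pi_invariant) -?pi_mean.
  - by apply: eq_integral => x; rewrite inE/= in_itv/= andbT => /max_idPl ->.
  - by apply/measurable_EFinP; exact: measurable_maxr.
  - by move=> x; rewrite lee_fin le_max lexx orbT.
have mx : measurable_fun setT (fun x : R => Num.max x 0) by exact: measurable_maxr.
have x_int : pi.-integrable setT (EFin \o (fun x : R => Num.max x 0)).
  apply/integrableP; split; first exact/measurable_EFinP.
  rewrite (_ : (\int[pi]_x _)%E = phi%:E) ?ltry// -x_intE.
  by apply: eq_integral => x _ /=; rewrite ger0_norm// le_max lexx orbT.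
have x_mean : \int[pi]_x Num.max x 0 = phi by rewrite /Rintegral x_intE.
have H_mean : \int[pi]_x Hp x = 0.
  exact: (Hpos_mean delta_gt0 y_int y2_int pi_inv x_int).
have [Bh Hb] := Hpos_bound delta_gt0 y_int y2_int y_mean.
have mH : measurable_fun setT Hp by exact: measurable_Hpos.
have Hn x : x <= 0 -> Hp x = Hp 0 by exact: Hpos_neg.
have H_int : pi.-integrable setT (EFin \o Hp).
  have i1 : pi.-integrable setT (EFin \o (fun x : R => Num.max x 0 + `|Bh|)).
    by apply: rintegrableD => //; exact: rintegrable_cst.
  apply: (le_integrable measurableT _ _ i1); first exact/measurable_EFinP.
  move=> x _ /=; rewrite lee_fin; apply: le_trans (ler_norm _).
  have m0 : 0 <= Num.max x 0 by rewrite le_max lexx orbT.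
  have -> : Hp x = Hp (Num.max x 0) by case: (leP x 0) => // x0; rewrite Hn.
  have := Hb _ m0; rewrite -/Hp; have := ler_norm Bh.
  by rewrite !ler_norml => h1 /andP[h2 h3]; apply/andP; split; lra.
(* Both one-sided functionals have this form: (u, w) = (1, - thetap) and (-1,
   thetam). The condition 0 < u + w is the coercivity of G, and the mean is u
   phi since H has mean 0. *)
pose G (u w : R) x : R := u * Num.max x 0 + w * Hp x.
have mG u w : measurable_fun setT (G u w).
  by apply: measurable_funD; apply: measurable_funM.
have tail u w : 0 < u + w -> exists2 e0 : R, 0 < e0 &
  forall c, u * phi - e0 < c < u * phi -> exists Jc : R,
    [/\ 0 < Jc, rate nu (G u w) c = Jc%:E &
    forall x : R, exp_rate Jc (fun n => below nu (G u w) n (x, c * n%:R)) /\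
      exp_rate Jc (fun n => sbelow nu (G u w) n (x, c * n%:R))].
  move=> uw.
  have Gneg x : x <= 0 -> G u w x = G u w 0.
    by move=> x0; rewrite /G (max_idPr x0) maxxx Hn.
  have Glin x : 0 <= x -> `|G u w x - (u + w) * x| <= `|w| * Bh.
    move=> x0; rewrite /G (max_idPl x0).
    have -> : u * x + w * Hp x - (u + w) * x = w * (Hp x - x) by ring.
    by rewrite normrM ler_wpM2l// Hb.
  have Gint : pi.-integrable setT (EFin \o G u w).
    by apply: rintegrableD; exact: rintegrableZ.
  have Gmean : \int[pi]_x G u w x = u * phi.
    rewrite RintegralD//; [|exact: rintegrableZ..].
    by rewrite !RintegralZl// x_mean H_mean mulr0 addr0.
  have V0 x : 0 <= Vpos delta x by rewrite (le_trans ler01)// Vpos_ge1.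
  have Vd x (x0 : 0 <= x) :=
    (andP (Vpos_drift delta_gt0 y_int y2_int y_mean x0)).2.
  exact: (additive_lower_tail pi_inv dd0 pp0 nu_down du0 pu0 nu_up (mG u w) Gneg uw
    Glin Gint Gmean (measurable_Vpos delta) V0
    (Vpos_step_int delta_gt0 y_int y2_int) Vd).
(* On R_+ the transition operator of the statement is the integral over the law
   of the increment. *)
have HE z : 0 <= z -> H z = Hp z.
  move=> z0; rewrite /H /Hp /Hpos /Vpos (max_idPl z0); congr (_ - _).
  rewrite /transition_op unlock /Rintegral; congr fine.
  rewrite (@ge0_integral_distribution _ _ _ _ _ P (D 0%N)
    (fun y => (V delta (Num.max (step z y) 0))%:E)).
  - apply: eq_integral => w _ /=; rewrite (max_idPl (step_ge0 _ _)).
    by rewrite /step (max_idPl z0).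
  - apply/measurable_EFinP; apply: (measurableT_comp (measurable_Vpos delta)).
    exact: (measurableT_comp (@measurable_step R) (measurable_pair1 z)).
  - by move=> y; rewrite lee_fin (le_trans ler01)// (Vpos_ge1 delta_gt0).
pose Gp := G 1 (- thetap); pose Gm := G (-1) thetam.
have FpG z : 0 <= z -> Fp z = Gp z.
  by move=> z0; rewrite /Fp /Gp /G (max_idPl z0) HE// /F; ring.
have FmG z : 0 <= z -> (fun y => - Fm y) z = Gm z.
  by move=> z0; rewrite /Fm /Gm /G (max_idPl z0) HE// /F; ring.
have [ep ep0 tailp] : exists2 e0 : R, 0 < e0 & _ := tail 1 (- thetap) ltac:(lra).
have [em em0 tailm] : exists2 e0 : R, 0 < e0 & _ := tail (-1) thetam ltac:(lra).
have avgN n Phi : time_average n (fun y => - Fm y) Phi = - time_average n Fm Phi.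
  by rewrite /time_average sumrN mulrN.
have Gneg u w x : x <= 0 -> G u w x = G u w 0.
  by move=> x0; rewrite /G (max_idPr x0) maxxx Hn.
exists (fun c => rate nu Gm (- c)), (rate nu Gp), (Num.min ep em); split.
- exact (@econvex_opp _ _ (@rate_convex _ _ _ (mG _ _) (Gneg _ _))).
- exact (@rate_convex _ _ _ (mG _ _) (Gneg _ _)).
- by rewrite lt_min ep0.
move=> x x0.
split.
- move=> c /andP[c1 c2].
  have [|J [J0 rJ /(_ x)[hJ _]]] := tailp c.
    by rewrite mul1r c2 andbT (le_lt_trans _ c1)// lerD2l lerN2 ge_min lexx.
  rewrite rJ; split; last by rewrite -EFinN lte_fin oppr_lt0.
  apply: (exp_rate_lne _ hJ) => n n0.
  exact: (path_law_le D_iid (mG _ _) x0 FpG).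
- move=> c /andP[c1 c2].
  have [|J [J0 rJ /(_ x)[hJ _]]] := tailm (- c).
    rewrite mulN1r ltrN2 c1 andbT -opprD ltrN2 (lt_le_trans c2)// lerD2l ge_min.
    by rewrite lexx orbT.
  rewrite rJ; split; last by rewrite -EFinN lte_fin oppr_lt0.
  apply: (exp_rate_lne _ hJ) => n n0.
  rewrite -(path_law_le D_iid (mG _ _) x0 FmG)//; congr (path_law D x _).
  by apply/seteqP; split => Phi /=; rewrite avgN lerN2.
move=> eps /andP[e1 e2].
have [|J1 [J10 rJ1 /(_ x)[_ hJ1]]] := tailp (phi - eps).
  rewrite mul1r; apply/andP; split; last by rewrite ltrBlDr ltrDl.
  by rewrite ltrD2l ltrN2 (lt_le_trans e2)// ge_min lexx.
have [|J2 [J20 rJ2 /(_ x)[_ hJ2]]] := tailm (- (phi + eps)).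
  rewrite mulN1r -opprD !ltrN2 ltrDl e1 andbT ltrD2l.
  by rewrite (lt_le_trans e2)// ge_min lexx orbT.
rewrite rJ1 rJ2 -EFin_min; split; last first.
  by rewrite -EFinN lte_fin oppr_lt0 lt_min J10.
pose S n := [set w | ~ `[- eps + thetap * Delta_ n (walk D x w),
  eps + thetam * Delta_ n (walk D x w)]%classic (phi_ n (walk D x w) - phi)].
pose S1 n := [set w | time_average n Fp (walk D x w) < phi - eps].
pose S2 n := [set w | time_average n (fun y => - Fm y) (walk D x w) < - (phi + eps)].
(* Leaving the interval on the left or on the right is a strict deviation of one
   of the two functionals. *)
have SE n : S n = S1 n `|` S2 n.
  have lin (th : R) Phi : time_average n (fun y => F y - th * H y) Phi =
      phi_ n Phi - th * Delta_ n Phi.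
    by rewrite /phi_ /Delta_ /time_average sumrB -mulr_sumr mulrBr mulrCA.
  apply/seteqP; split => w.
    rewrite /S /= in_itv/= => /negP; rewrite negb_and -!ltNge => /orP[h|h]; [left|right].
      by rewrite /S1 /= /Fp lin; lra.
    by rewrite /S2 /= avgN /Fm lin; lra.
  rewrite /S /S1 /S2 /= in_itv/= avgN /Fp /Fm !lin => h; apply/negP.
  by rewrite negb_and -!ltNge; apply/orP; case: h => h; [left|right]; lra.
have P1 n : (0 < n)%N -> P (S1 n) = (sbelow nu Gp n (x, (phi - eps) * n%:R))%:E.
  exact: (path_law_lt D_iid (mG _ _) x0 FpG).
have P2 n : (0 < n)%N -> P (S2 n) = (sbelow nu Gm n (x, - (phi + eps) * n%:R))%:E.
  exact: (path_law_lt D_iid (mG _ _) x0 FmG).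
have mS1 n : (0 < n)%N -> measurable (S1 n).
  move=> n0; exact: (measurable_path_lt D (mG _ _) x0 FpG _ n0).
have mS2 n : (0 < n)%N -> measurable (S2 n).
  move=> n0; exact: (measurable_path_lt D (mG _ _) x0 FmG _ n0).
apply: (@exp_rate_lne _ _ (fun n => fine (P (S n)))) => [n n0|].
  rewrite fineK//; apply: fin_num_measure; rewrite SE.
  by apply: measurableU; [exact: mS1|exact: mS2].
apply: (exp_rate_union hJ1 hJ2) => n n0.
have mS : measurable (S n) by rewrite SE; apply: measurableU; [exact: mS1|exact: mS2].
have PS : P (S n) = (fine (P (S n)))%:E by rewrite fineK// fin_num_measure.
rewrite -!lee_fin EFinD -PS -P1// -P2//; split.
- by apply: le_measure; rewrite ?inE; [exact: mS1|exact: mS|rewrite SE; left].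
- by apply: le_measure; rewrite ?inE; [exact: mS2|exact: mS|rewrite SE; right].
- by rewrite SE; apply: measureU2; [exact: mS1|exact: mS2].
Qed.
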